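(* For each positive integer $n$, let $T_n$ be the number of lozenge tilings of the region $\mathcal{T}_n$. The numbers $T_n$ satisfy the following. (a) For each positive integer $n$, let $\zeta=e^{2\pi i/(3n+3)}$, and define a polynomial $P_n(x)$ by \[P_n(x)=\prod_{\substack{1\leq a<b\leq 3n+2\\(a,b)\neq(n+1,2n+2)}}(x+\zeta^a+\zeta^b),\] the product being over pairs of integers $(a,b)$. Then $P_n(x)\in\mathbb{Z}[x]$, $P_n(x)$ can be factored in $\mathbb{Z}[x]$ into polynomials with degrees at most $2n+2$, and $P_n(1)=\pm T_n^3$. (b) If $m,n$ are positive integers satisfying $m+1\mid n+1$, then $T_m\mid T_n$. (c) Let $\chi_{-3}$ be the primitive quadratic character modulo $3$, and let $L(2,\chi_{-3})$ be the Dirichlet $L$-function for $\chi_{-3}$ evaluated at $2$. Then, as $n\to\infty$, \[T_n=\exp\left(\frac{9\sqrt 3}{8\pi}L(2,\chi_{-3})\,n^2+o(n^2)\right),\] where $\exp\left(\frac{9\sqrt 3}{8\pi}L(2,\chi_{-3})\right)\approx 1.6235$. (d) For all sufficiently large $n$, $T_n$ contains at least $n/5$ prime factors, counting multiplicity.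
   Context: Let $\omega=e^{2\pi i/3}$ and consider the triangular grid in the complex plane: the tessellation of $\mathbb{C}$ by equilateral triangles of side length $1$ with vertices in $\mathbb{Z}[\omega]$ (''unit triangles''). For a positive integer $n$, the region $\mathcal{T}_n$ is the union of all unit triangles having a vertex at one of the $n(n+1)/2$ points $a(1-\omega)+b(1-\omega^2)$ with integers $a,b\ge 0$, $a+b\le n-1$. Equivalently, $\mathcal{T}_n$ is a triangular honeycomb arrangement of $n(n+1)/2$ regular hexagons of side $1$ (with rows of $1,2,\ldots,n$ hexagons), adjacent hexagons sharing an edge, each hexagon subdivided into six unit triangles. A lozenge is the union of two unit triangles of the grid sharing an edge. A lozenge tiling of $\mathcal{T}_n$ is a set of lozenges contained in $\mathcal{T}_n$ such that each unit triangle of $\mathcal{T}_n$ belongs to exactly one of them. The character $\chi_{-3}:\mathbb{Z}\to\{0,\pm1\}$ is given by $\chi_{-3}(k)=0$ if $3\mid k$, $\chi_{-3}(k)=1$ if $k\equiv1\pmod 3$, and $\chi_{-3}(k)=-1$ if $k\equiv 2\pmod 3$; and $L(2,\chi_{-3})=\sum_{k=1}^\infty\chi_{-3}(k)k^{-2}$. *)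

(* Defs.v *)
From mathcomp Require Import all_boot all_order all_algebra.
From mathcomp Require Import finmap.
From mathcomp Require Import all_classical all_reals all_analysis.
From mathcomp Require Import complex.

Set Implicit Arguments.
Unset Strict Implicit.
Unset Printing Implicit Defensive.

Import Order.TTheory GRing.Theory Num.Theory.
Import numFieldNormedType.Exports.
Local Open Scope ring_scope.

(** The pair [(x, y)] stands for the point [x + y omega] of Z[omega],
    where [omega = e^(2 i pi / 3)], so that [omega^2 = - 1 - omega]. *)
Definition eisenstein : Type := (int * int)%type.

Definition eis1 : eisenstein := (1, 0).
Definition omega : eisenstein := (0, 1).
Definition omega2 : eisenstein := - eis1 - omega.

(** A unit triangle of the grid is given by its lowest left vertex [z] (for
    [(z, true)], pointing up) or its bottom vertex [z] (for [(z, false)],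
    pointing down).  Since [- omega2 = e^(i pi / 3)], these are the triangles
    with vertices [z, z + 1, z + e^(i pi / 3)] and
    [z, z + e^(i pi / 3), z + omega]; each unit triangle arises exactly once. *)
Definition triangle : Type := (eisenstein * bool)%type.

Definition corners (up : bool) : seq eisenstein :=
  if up then [:: 0; eis1; - omega2] else [:: 0; - omega2; omega].

Definition vertices (t : triangle) : seq eisenstein :=
  [seq t.1 + v | v <- corners t.2].

Definition share_edge (t u : triangle) : bool :=
  count [in vertices u] (vertices t) == 2.

Definition hexagon_center (a b : nat) : eisenstein :=
  (eis1 - omega) *+ a + (eis1 - omega2) *+ b.

Definition hexagon_centers (n : nat) : seq eisenstein :=
  [seq hexagon_center a b | a <- iota 0 n, b <- iota 0 (n - a)].

Definition hexagon (c : eisenstein) : seq triangle :=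
  [seq (c - v, true) | v <- corners true] ++
  [seq (c - v, false) | v <- corners false].

(** The unit triangles of the region T_n, see [mem_region]. *)
Definition region (n : nat) : {fset triangle} :=
  seq_fset tt (flatten [seq hexagon c | c <- hexagon_centers n]).

Lemma mem_hexagon (c : eisenstein) (t : triangle) :
  (t \in hexagon c) = (c \in vertices t).
Proof.
have E (s : seq eisenstein) (z : eisenstein) (o o' : bool) :
    ((z, o) \in [seq (c - v, o') | v <- s]) =
    (o == o') && (c \in [seq z + v | v <- s]).
  elim: s => [|v s IH]; first by rewrite andbF.
  rewrite /= !inE IH xpair_eqE andbC -andb_orr; congr (_ && (_ || _)).
  by rewrite eq_sym subr_eq.
by case: t => z []; rewrite mem_cat !E ?orbF.
Qed.

Lemma mem_region (n : nat) (t : triangle) :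
  t \in region n <->
  exists a b : nat, (a + b <= n.-1)%N /\ (0 < n)%N /\ hexagon_center a b \in vertices t.
Proof.
rewrite seq_fsetE; split.
  case/flattenP=> h /mapP[c /allpairsPdep[a [b [Ha Hb ->]]] ->].
  rewrite mem_hexagon => H; exists a, b.
  move: Ha Hb; rewrite !mem_iota !add0n /= => Ha Hb; split; last first.
    by split=> //; apply: leq_ltn_trans Ha.
  move: Hb; rewrite ltn_subRL.
  by case: n {Ha} => // n; rewrite ltnS.
case=> a [b [Hab [n0 H]]]; apply/flattenP; exists (hexagon (hexagon_center a b)).
  apply/map_f/allpairsPdep; exists a, b.
  have lt_ab : (a + b < n)%N by rewrite -(prednK n0).
  split=> //; rewrite mem_iota add0n /=; last by rewrite ltn_subRL.
  by apply: leq_ltn_trans lt_ab; apply: leq_addr.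
by rewrite mem_hexagon.
Qed.

(** A lozenge is represented by the set of its two unit triangles. *)
Definition is_lozenge (n : nat) (L : {set region n}) : bool :=
  [exists t : region n, exists u : region n,
    share_edge (val t) (val u) && (L == [set t; u]%SET)].

Definition is_tiling (n : nat) (S : {set {set region n}}) : bool :=
  [forall L in S, is_lozenge L] &&
  [forall t : region n, #|[set L in S | t \in L]%SET| == 1].

Definition tilings (n : nat) : nat :=
  #|[set S : {set {set region n}} | is_tiling S]%SET|.

Definition zeta {R : realType} (n : nat) : R[i] :=
  let theta : R := 2 * pi / (3 * n + 3)%:R in Complex (cos theta) (sin theta).

Definition P (R : realType) (n : nat) : {poly R[i]} :=
  \prod_(1 <= a < (3 * n + 2).+1)
    \prod_(a.+1 <= b < (3 * n + 2).+1 | (a, b) != (n + 1, 2 * n + 2)%N)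
      ('X + (zeta n ^+ a + zeta n ^+ b)%:P).

Definition chi_m3 (k : int) : int :=
  if (k == 0 %[mod 3])%Z then 0 else if (k == 1 %[mod 3])%Z then 1 else -1.

Definition L2_chi_m3 (R : realType) : R :=
  limn (fun N : nat => \sum_(1 <= k < N.+1) (chi_m3 k%:Z)%:~R * (k%:R : R) ^- 2).

Definition growth (R : realType) : R :=
  9 * Num.sqrt 3 / (8 * pi) * L2_chi_m3 R.

Definition num_prime_factors (m : nat) : nat := \sum_(p <- primes m) logn p m.

(* Main.v *)
(** Pairing each upward unit triangle of [T_n] with the downward one it is
    glued to turns the lozenge tilings into permutations supported on the
    adjacency matrix.  These all have the same sign, so [T_n] is the absolute
    value of its determinant.  Plane waves antisymmetrized over the symmetric
    group S_3, of frequencies [0, a, b] modulo [3n + 3], vanish on the sides of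
    a triangle around the region and diagonalize the adjacency, with
    eigenvalues [1 + zeta ^ a + zeta ^ b].  Rotating a frequency triple does not
    change the modulus of the eigenvalue, so the product over all admissible
    pairs [(a, b)], which is the modulus of [P_n(1)], equals [T_n ^ 3].

    The Galois orbits of the pairs have at most [phi(3n + 3) <= 2n + 2]
    elements, and each orbit gives an integral factor of [P_n]: this is (a).
    For (b), the pairs divisible by [(n + 1) / (m + 1)] form a union of orbits.
    For (c), at fixed [a] the product over [b] is
    [|(- 1 - zeta ^ a) ^ (3n + 3) - 1|], whose logarithm is
    [(3n + 3) ln (max 1 |1 + zeta ^ a|)] up to a bounded error unless
    [zeta ^ a] is a primitive cube root of unity; the sum over [a] is a Riemann
    sum, and Fourier expansion evaluates the integral of [ln |1 + e^(it)|] over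
    [0, 2 pi / 3] in terms of [L(2, chi_{-3})].  For (d), every factor of
    [P_n(1)] coming from an orbit is at most [3 ^ (2n + 2)], so the growth of
    [T_n] forces many of them to be different from 1. *)

Require Import Defs.
From mathcomp Require Import all_boot all_order all_algebra all_fingroup all_field.
From mathcomp Require Import finmap.
From mathcomp Require Import ring lra zify.

Set Implicit Arguments.
Unset Strict Implicit.
Unset Printing Implicit Defensive.

Import Order.TTheory GRing.Theory Num.Theory.
Local Open Scope ring_scope.

(** * Lozenge tilings as permutations *)

(** The adjacency maps functions on downward triangles to functions on upward ones, so it has no
    eigenvectors as such. The same waves are sampled at two sets of points, giving the matrices
    [up_modes] and [down_modes], and the adjacency relates these two through a diagonal matrix. Only
    the moduli of their determinants are needed: orthogonality makes both equal to a power of 3n +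
    3, so they cancel. The waves are as many as the upward triangles because the central triple, the
    only one fixed by a rotation, has a wave that vanishes at all sampled points.

    No integral occurs in the asymptotics. The partial sums of the sine series are explicit
    primitives, and the mean value theorem compares their increments with Riemann sums.

    The count in (d) leaves little room: the constant obtained, [growth] / (2 ln 3), is about 0.2205
    against 1/5. Hence explicit numerical bounds on [growth] and ln 3 enter the proof. *)

Lemma hexagon_centerE (a b : nat) :
  hexagon_center a b = (a%:Z + 2 * b%:Z, b%:Z - a%:Z).
Proof.
rewrite /hexagon_center; apply: injective_projections.
  rewrite [LHS](raddfD fst) !(raddfMn fst) /=; lia.
rewrite [LHS](raddfD snd) !(raddfMn snd) /=; lia.
Qed.

Lemma vertices_up (p q : int) :
  vertices ((p, q), true) = [:: (p, q); (p + 1, q); (p + 1, q + 1)].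
Proof.
rewrite /vertices /corners /=; congr [:: _; _; _]; apply: injective_projections => /=; lia.
Qed.

Lemma vertices_down (p q : int) :
  vertices ((p, q), false) = [:: (p, q); (p + 1, q + 1); (p, q + 1)].
Proof.
rewrite /vertices /corners /=; congr [:: _; _; _]; apply: injective_projections => /=; lia.
Qed.

(** Equalities between coordinates of vertices depend only on the difference of the base points.
    Sharing an edge thus becomes a case check on differences in 0, 1, -1, all other differences
    making every equality false. *)
Lemma eq_shift (a x : int) :
  ((a + x == a) = (x == 0)) * ((a + x + 1 == a) = (x == -1)) *
  ((a + x == a + 1) = (x == 1)) * ((a + x + 1 == a + 1) = (x == 0)) *
  ((a == a + x) = (x == 0)) * ((a == a + x + 1) = (x == -1)) *
  ((a + 1 == a + x) = (x == 1)) * ((a + 1 == a + x + 1) = (x == 0)).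
Proof. by do 7?[split]; lia. Qed.

Ltac int_cases x :=
  have [->|] := eqVneq x 0; [|have [->|] := eqVneq x 1; [|have [->|] := eqVneq x (-1)]].

Ltac shift_cases p p' q q' :=
  let x := fresh "x" in let y := fresh "y" in
  rewrite -(subrKC p' p) -(subrKC q' q) !eq_shift; move: (p - p') (q - q') => x y;
  int_cases x => //; int_cases y => // /negPf-> /negPf-> /negPf->; by rewrite ?andbF.

(** The disjuncts are the neighbours across the left, the right and the bottom edge. *)
Lemma share_edge_up_down (p q p' q' : int) :
  share_edge ((p, q), true) ((p', q'), false) =
  [|| (p == p') && (q == q'), (p + 1 == p') && (q == q') | (p == p') && (q == q' + 1)].
Proof.
rewrite /share_edge vertices_up vertices_down /= !inE !xpair_eqE.
shift_cases p p' q q'.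
Qed.

Lemma share_edge_down_up (p q p' q' : int) :
  share_edge ((p', q'), false) ((p, q), true) = share_edge ((p, q), true) ((p', q'), false).
Proof.
rewrite share_edge_up_down /share_edge vertices_up vertices_down /= !inE !xpair_eqE.
shift_cases p p' q q'.
Qed.

Lemma share_edge_same (z w : eisenstein) (o : bool) : share_edge (z, o) (w, o) = false.
Proof.
case: z w => p q [p' q']; case: o; rewrite /share_edge ?vertices_up ?vertices_down /= !inE !xpair_eqE;
  shift_cases p p' q q'.
Qed.

(** Along the vertices of a unit triangle the sum of coordinates takes each residue modulo 3 once,
    and the hexagon lattice is residue 0; [(p', q')] is that vertex. A center (x, y) has x - 2y =
    3a, x + y = 3b and 2x - y = 3(a + b), which turns the conditions on a, b into linear
    inequalities. *)
Lemma mem_region_up (n : nat) (p q : int) : (((p, q), true) \in region n) =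
  [&& - 2 <= p + q, -1 <= p - 2 * q & 2 * p - q <= 3 * n%:Z - 3].
Proof.
apply/idP/idP.
  case/mem_region => a [b [ab [n0]]]; rewrite vertices_up hexagon_centerE !inE !xpair_eqE.
  by lia.
move=> H; apply/mem_region.
pose p' := if ((p + q) %% 3 == 0)%Z then p else p + 1.
pose q' := if ((p + q) %% 3 == 1)%Z then q + 1 else q.
exists `|((p' - 2 * q') %/ 3)%Z|%N, `|((p' + q') %/ 3)%Z|%N.
rewrite vertices_up hexagon_centerE !inE !xpair_eqE /p' /q'.
have : ((p + q) %% 3 == 0)%Z \/ ((p + q) %% 3 == 1)%Z \/ ((p + q) %% 3 == 2)%Z by lia.
by case=> [E|[E|E]]; rewrite ?E; do 2?case: eqP => ?; split; lia.
Qed.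

Lemma mem_region_down (n : nat) (p q : int) : (((p, q), false) \in region n) =
  [&& - 2 <= p + q, 0 <= p - 2 * q & 2 * p - q <= 3 * n%:Z - 2].
Proof.
apply/idP/idP.
  case/mem_region => a [b [ab [n0]]]; rewrite vertices_down hexagon_centerE !inE !xpair_eqE.
  by lia.
move=> H; apply/mem_region.
pose p' := if ((p + q) %% 3 == 1)%Z then p + 1 else p.
pose q' := if ((p + q) %% 3 == 0)%Z then q else q + 1.
exists `|((p' - 2 * q') %/ 3)%Z|%N, `|((p' + q') %/ 3)%Z|%N.
rewrite vertices_down hexagon_centerE !inE !xpair_eqE /p' /q'.
have : ((p + q) %% 3 == 0)%Z \/ ((p + q) %% 3 == 1)%Z \/ ((p + q) %% 3 == 2)%Z by lia.
by case=> [E|[E|E]]; rewrite ?E; do 2?case: eqP => ?; split; lia.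
Qed.

(* [(a, b, i)] with [a + b < n] stands for the [i]-th upward (or downward)
   unit triangle of the hexagon with center [hexagon_center a b]. *)
Definition cell (n : nat) : finType := {x : 'I_n * 'I_n * 'I_3 | x.1.1 + x.1.2 < n}%N.

(** The amounts subtracted are the entries of [corners up]: the hexagon center is the [i]-th vertex
    of the [i]-th triangle. Using [cell n] for both orientations makes the adjacency matrix
    square. *)
Definition cell_pos (up : bool) (n : nat) (x : cell n) : eisenstein :=
  let: (a, b, i) := val x in
  ((a + 2 * b)%:Z - (if up then 0 < i else i == 1 :> nat)%N%:Z,
   b%:Z - a%:Z - (if up then i == 2 :> nat else 0 < i)%N%:Z).

Lemma cell_pos_inj (up : bool) (n : nat) : injective (@cell_pos up n).
Proof.
move=> [[[a b] i] /= ab] [[[a' b'] i'] /= ab'].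
rewrite /cell_pos /= => -[E1 E2]; apply: val_inj => /=.
suff [Ea [Eb Ei]] : (a = a' :> nat) /\ (b = b' :> nat) /\ (i = i' :> nat).
  by congr (_, _, _); apply: val_inj.
have := ltn_ord i; have := ltn_ord i'.
case: up E1 E2; move: (nat_of_ord i) (nat_of_ord i') => u v; lia.
Qed.

Lemma mem_cell_pos (up : bool) (n : nat) (x : cell n) : (cell_pos up x, up) \in region n.
Proof.
case: x => [[[a b] i] /= ab]; have := ltn_ord i.
by case: up; rewrite ?mem_region_up ?mem_region_down /cell_pos /=; lia.
Qed.

Lemma cell_pos_surj (up : bool) (n : nat) (z : eisenstein) :
  (z, up) \in region n -> exists x : cell n, z = cell_pos up x.
Proof.
have mk (a b i : nat) : (a + b < n)%N -> (i < 3)%N ->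
    exists x : cell n, cell_pos up x =
     ((a + 2 * b)%:Z - (if up then 0 < i else i == 1 :> nat)%N%:Z,
       b%:Z - a%:Z - (if up then i == 2 :> nat else 0 < i)%N%:Z).
  move=> ab i3; have an : (a < n)%N by lia.
  have bn : (b < n)%N by lia.
  by exists (Sub (Ordinal an, Ordinal bn, Ordinal i3) ab).
case: z => p q /mem_region[a [b [ab [n0]]]].
case: up mk => mk; rewrite ?vertices_up ?vertices_down hexagon_centerE !inE !xpair_eqE.
  by case/or3P => /andP[/eqP E1 /eqP E2]; [have [||x xE] := mk a b 0 | have [||x xE] := mk a b 1
    | have [||x xE] := mk a b 2]; rewrite //; try lia;
    exists x; rewrite xE; congr (_, _) => /=; lia.
by case/or3P => /andP[/eqP E1 /eqP E2]; [have [||x xE] := mk a b 0 | have [||x xE] := mk a b 1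
  | have [||x xE] := mk a b 2]; rewrite //; try lia;
  exists x; rewrite xE; congr (_, _) => /=; lia.
Qed.

Section Tilings.
Variable n : nat.
Local Notation m := #|cell n|.

Definition up_pos (i : 'I_m) : eisenstein := cell_pos true (enum_val i).
Definition down_pos (i : 'I_m) : eisenstein := cell_pos false (enum_val i).

Definition adjacent (i j : 'I_m) : bool :=
  share_edge (up_pos i, true) (down_pos j, false).

Definition is_matching (s : 'S_m) : bool := [forall i, adjacent i (s i)].

Let up (i : 'I_m) : region n := FSetSub (mem_cell_pos true (enum_val i)).
Let down (i : 'I_m) : region n := FSetSub (mem_cell_pos false (enum_val i)).

Lemma up_pos_inj : injective up_pos.
Proof. by move=> i j /cell_pos_inj /enum_val_inj. Qed.

Lemma down_pos_inj : injective down_pos.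
Proof. by move=> i j /cell_pos_inj /enum_val_inj. Qed.

Lemma up_pos_surj (z : eisenstein) : (z, true) \in region n -> exists i, up_pos i = z.
Proof. by case/cell_pos_surj => x ->; exists (enum_rank x); rewrite /up_pos enum_rankK. Qed.

Lemma down_pos_surj (z : eisenstein) : (z, false) \in region n -> exists i, down_pos i = z.
Proof. by case/cell_pos_surj => x ->; exists (enum_rank x); rewrite /down_pos enum_rankK. Qed.

Let up_inj : injective up.
Proof. by move=> i j /(congr1 val) [] /cell_pos_inj /enum_val_inj. Qed.

Let down_inj : injective down.
Proof. by move=> i j /(congr1 val) [] /cell_pos_inj /enum_val_inj. Qed.

Let up_neq_down i j : up i != down j.
Proof. by apply/eqP => /(congr1 val). Qed.

Let updownP (t : region n) : (exists i, t = up i) \/ (exists i, t = down i).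
Proof.
case: t => -[z [] H].
  by have [i E] := up_pos_surj H; left; exists i; apply: val_inj; rewrite /= -E.
by have [i E] := down_pos_surj H; right; exists i; apply: val_inj; rewrite /= -E.
Qed.

Let lozengeP (L : {set region n}) :
  reflect (exists i j, adjacent i j /\ L = [set up i; down j]) (is_lozenge L).
Proof.
apply: (iffP existsP) => [[t /existsP[u /andP[tu /eqP ->]]]|[i [j [ij ->]]]].
  case: (updownP t) (updownP u) tu => [[i ->] [] [j ->]|[i ->] [] [j ->]] /=;
    rewrite ?share_edge_same // => ij.
    by exists i, j.
  exists j, i; split; last by rewrite setUC.
  move: ij; rewrite /adjacent /up_pos /down_pos.
  by case: (cell_pos _ _) (cell_pos _ _) => p q [p' q']; rewrite share_edge_down_up.
by exists (up i); apply/existsP; exists (down j); rewrite eqxx andbT.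
Qed.

Let tiling_of (s : 'S_m) : {set {set region n}} := [set [set up i; down (s i)] | i in 'I_m].

Let mem_up i j k : (up k \in [set up i; down j]) = (k == i).
Proof. by rewrite !inE (inj_eq up_inj) (negPf (up_neq_down _ _)) orbF. Qed.

Let mem_down i j k : (down k \in [set up i; down j]) = (k == j).
Proof. by rewrite !inE (inj_eq down_inj) eq_sym (negPf (up_neq_down _ _)). Qed.

Lemma tilings_matchings : tilings n = #|[set s : 'S_m | is_matching s]|.
Proof.
rewrite /tilings -(card_imset (f := tiling_of)).
  apply: eq_card => S; rewrite inE; apply/idP/imsetP => [/andP[/forall_inP loz /forallP cov]|].
    have ex_f i : exists j, adjacent i j /\ [set up i; down j] \in S.
      have /cards1P[L EL] := cov (up i).
      have : L \in [set L in S | up i \in L] by rewrite EL set11.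
      rewrite inE => /andP[LS]; have /lozengeP[i' [j [ij EL']]] := loz _ LS.
      by rewrite EL' mem_up => /eqP E; exists j; rewrite E -EL'.
    have [f fP] := fin_all_exists ex_f.
    have f_inj : injective f.
      move=> i j Eij; have /cards1P[L EL] := cov (down (f i)).
      have H k : f k = f i -> [set up k; down (f k)] = L.
        move=> Ek; apply/set1P; rewrite -EL inE (fP k).2 Ek.
        by rewrite mem_down eqxx.
      have := H j (esym Eij); rewrite -(H i erefl) => /setP /(_ (up i)).
      by rewrite !mem_up eqxx => /eqP.
    exists (perm f_inj).
      by rewrite inE; apply/forallP => i; rewrite permE (fP i).1.
    apply/setP => L; apply/idP/imsetP => [LS|[i _ ->]]; last by rewrite permE (fP i).2.
    have /lozengeP[i [j [ij EL]]] := loz _ LS; exists i => //; rewrite permE.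
    have /cards1P[L' EL'] := cov (up i).
    have -> : L = L' by apply/set1P; rewrite -EL' inE LS EL mem_up eqxx.
    by apply/esym/set1P; rewrite -EL' inE (fP i).2 mem_up eqxx.
  case=> s; rewrite inE => /forallP ms ->; apply/andP; split.
    by apply/forall_inP => _ /imsetP[i _ ->]; apply/lozengeP; exists i, (s i).
  apply/forallP => t; apply/cards1P.
  case: (updownP t) => -[k ->].
    exists [set up k; down (s k)]; apply/setP => L; rewrite !inE; apply/andP/eqP.
      by case=> /imsetP[i _ ->]; rewrite mem_up => /eqP->.
    by move=> ->; rewrite mem_up eqxx; split=> //; apply/imsetP; exists k.
  exists [set up (s^-1 k)%g; down k]; apply/setP => L; rewrite !inE; apply/andP/eqP.
    by case=> /imsetP[i _ ->]; rewrite mem_down => /eqP->; rewrite permK.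
  move=> ->; rewrite mem_down eqxx; split=> //; apply/imsetP.
  by exists (s^-1 k)%g; rewrite ?permKV.
move=> s1 s2 E; apply/permP => i.
have : [set up i; down (s1 i)] \in tiling_of s2 by rewrite -E; apply/imsetP; exists i.
case/imsetP => j _ /setP H.
have := H (up i); rewrite !mem_up eqxx => /esym/eqP ij.
by have := H (down (s1 i)); rewrite !mem_down eqxx ij => /esym/eqP.
Qed.

(** The identity matches triangles of equal index, which tiles each hexagon separately by three
    lozenges. *)
Lemma tilings_gt0 : (0 < tilings n)%N.
Proof.
rewrite tilings_matchings; apply/card_gt0P; exists 1%g; rewrite inE; apply/forallP => i.
rewrite perm1 /adjacent /up_pos /down_pos /cell_pos; case: (val _) => [[a b] i3].
by rewrite share_edge_up_down; have := ltn_ord i3; move: (nat_of_ord i3); lia.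
Qed.

End Tilings.

(** * All matchings have the same sign *)

Lemma vandermonde_perm (m : nat) (b : 'I_m -> int) (s : 'S_m) :
  \prod_(i < m) \prod_(j < m | (i < j)%N) (b (s j) - b (s i)) =
  (-1) ^+ s * \prod_(i < m) \prod_(j < m | (i < j)%N) (b j - b i).
Proof.
have E (f : 'I_m -> int) : \prod_(i < m) \prod_(j < m | (i < j)%N) (f j - f i) =
    \det (Vandermonde m (\row_j f j)).
  by rewrite det_Vandermonde; apply: eq_bigr => i _; apply: eq_bigr => j _; rewrite !mxE.
rewrite (E b) (E (b \o s)).
have -> : Vandermonde m (\row_j (b \o s) j) = col_perm s (Vandermonde m (\row_j b j)).
  by apply/matrixP => i j; rewrite !mxE.
by rewrite col_permE det_mulmx det_perm odd_permV mulrC.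
Qed.

Definition inversions (m : nat) (a b : 'I_m -> int) (s : 'S_m) : nat :=
  \sum_j \sum_i ((a i < a j)%R && (b (s j) < b (s i))%R).

(** Both sides range over unordered pairs, each represented once. *)
Lemma big_ltn_pairs_swap (m : nat) (F : 'I_m -> 'I_m -> int) (a : 'I_m -> int) :
  injective a -> (forall i j, F i j = F j i) ->
  \prod_(i < m) \prod_(j < m | (i < j)%N) F i j =
  \prod_(i < m) \prod_(j < m | a i < a j) F i j.
Proof.
move=> a_inj F_sym; rewrite !pair_big_dep /=.
rewrite (bigID (fun p : 'I_m * 'I_m => a p.1 < a p.2)) [RHS](bigID (fun p : 'I_m * 'I_m => p.1 < p.2)%N) /=.
congr (_ * _); first by apply: eq_bigl => p; rewrite andbC.
rewrite (reindex_inj (h := fun p : 'I_m * 'I_m => (p.2, p.1))) /=; last by move=> [? ?] [? ?] [-> ->].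
apply: eq_big => [[i j]|[i j] _] //=.
have := inj_eq a_inj i j; rewrite -val_eqE /=.
by case: (ltngtP i j); case: (ltgtP (a i) (a j)).
Qed.

(** The parity of a permutation and that of its inversions, taken for the order [a] on the source
    and [b] on the target, differ by the sign [C], which depends only on the two orders. *)
Lemma odd_perm_inversions (m : nat) (a b : 'I_m -> int) (s t : 'S_m) :
  injective a -> injective b -> inversions a b s = inversions a b t ->
  s = t :> bool.
Proof.
move=> a_inj b_inj.
pose C := \prod_(i < m) \prod_(j < m | (i < j)%N) sgz (a j - a i) *
          \prod_(i < m) \prod_(j < m | (i < j)%N) sgz (b j - b i).
have C_neq0 : C != 0.
  rewrite /C mulf_neq0 //; apply/prodf_neq0 => i _; apply/prodf_neq0 => j ij;
    by rewrite sgz_eq0 subr_eq0 ?(inj_eq a_inj) ?(inj_eq b_inj) -val_eqE gtn_eqF.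
have E (r : 'S_m) : (-1) ^+ r * C = (-1) ^+ inversions a b r.
  have sgE (f : 'I_m -> int) : \prod_(i < m) \prod_(j < m | (i < j)%N) sgz (f j - f i) =
      sgz (\prod_(i < m) \prod_(j < m | (i < j)%N) (f j - f i)).
    rewrite (big_morph _ (@sgzM int) (@sgz1 int)); apply: eq_bigr => i _.
    by rewrite (big_morph _ (@sgzM int) (@sgz1 int)).
  have Eb : (-1) ^+ r * (\prod_(i < m) \prod_(j < m | (i < j)%N) sgz (b j - b i)) =
      \prod_(i < m) \prod_(j < m | (i < j)%N) sgz (b (r j) - b (r i)).
    by rewrite (sgE b) (sgE (b \o r)) vandermonde_perm sgzM sgzX sgzN1.
  rewrite /C mulrCA {}Eb -big_split /=.
  under eq_bigr do rewrite -big_split /=.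
  rewrite (@big_ltn_pairs_swap _ (fun i j => sgz (a j - a i) * sgz (b (r j) - b (r i))) a) //; last first.
    by move=> i j; rewrite -[a i - a j]opprB -[b (r i) - _]opprB !sgzN mulrNN.
  rewrite /inversions exchange_big /= -prodrXr; apply: eq_bigr => i _.
  rewrite -prodrXr big_mkcond; apply: eq_bigr => j _ /=.
  case: ifP => // aij; rewrite gtr0_sgz ?subr_gt0 // mul1r.
  have [lt_b|gt_b|/b_inj/perm_inj eq_ij] := ltgtP (b (r j)) (b (r i)).
  - by rewrite ltr0_sgz ?subr_lt0.
  - by rewrite gtr0_sgz ?subr_gt0.
  - by rewrite eq_ij ltxx in aij.
move=> inv_eq; have : (-1) ^+ s * C = (-1) ^+ t * C by rewrite !E inv_eq.
move/(mulIf C_neq0); by case: (odd_perm s) (odd_perm t) => -[].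
Qed.

Lemma leq_card_by (T1 T2 : finType) (X : eqType) (A : {pred T1}) (B : {pred T2})
    (f : T1 -> X) (g : T2 -> X) : injective f ->
  (forall x, x \in A -> exists2 y, y \in B & g y = f x) -> (#|A| <= #|B|)%N.
Proof.
move=> f_inj AB; rewrite !cardE -(size_map f) -(size_map g).
apply: uniq_leq_size; first by rewrite map_inj_uniq ?enum_uniq.
move=> _ /mapP[x xA ->]; rewrite mem_enum in xA.
by have [y yB <-] := AB x xA; rewrite map_f // mem_enum.
Qed.

Lemma sum_bool_card (T : finType) (b : pred T) : (\sum_i (b i : nat) = #|b|)%N.
Proof. by rewrite -sum1_card [RHS]big_mkcond; apply: eq_bigr => i _; rewrite unfold_in; case: (b i). Qed.

Lemma lex_ltr (B p p' q q' : int) : 0 <= p < B -> 0 <= p' < B ->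
  (q * B + p < q' * B + p') = (q < q') || (q == q') && (p < p').
Proof.
move=> pB p'B; have [lt_q|gt_q|->] := ltgtP q q'; last by rewrite ltrD2l.
  have : (q + 1) * B <= q' * B by apply: ler_wpM2r; lia.
  by rewrite mulrDl mul1r; lia.
have : (q' + 1) * B <= q * B by apply: ler_wpM2r; lia.
by rewrite mulrDl mul1r; lia.
Qed.

(** * Inversions of a matching, row by row *)

Section Matchings.
Variable n : nat.
Local Notation m := #|cell n|.

Let P (i : 'I_m) : int := (up_pos i).1.
Let Q (i : 'I_m) : int := (up_pos i).2.
Let P' (i : 'I_m) : int := (down_pos i).1.
Let Q' (i : 'I_m) : int := (down_pos i).2.

Let upP i : [&& - 2 <= P i + Q i, -1 <= P i - 2 * Q i & 2 * P i - Q i <= 3 * n%:Z - 3].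
Proof.
have := mem_cell_pos true (enum_val i); rewrite -/(up_pos i) /P /Q.
by case: (up_pos i) => p q; rewrite mem_region_up.
Qed.

Let downP i : [&& - 2 <= P' i + Q' i, 0 <= P' i - 2 * Q' i & 2 * P' i - Q' i <= 3 * n%:Z - 2].
Proof.
have := mem_cell_pos false (enum_val i); rewrite -/(down_pos i) /P' /Q'.
by case: (down_pos i) => p q; rewrite mem_region_down.
Qed.

Let up_eq i j : P i = P j -> Q i = Q j -> i = j.
Proof. by move=> p q; apply: up_pos_inj; apply: injective_projections. Qed.

Let down_eq i j : P' i = P' j -> Q' i = Q' j -> i = j.
Proof. by move=> p q; apply: down_pos_inj; apply: injective_projections. Qed.

Let up_ex p q : [&& - 2 <= p + q, -1 <= p - 2 * q & 2 * p - q <= 3 * n%:Z - 3] ->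
  exists2 i, P i = p & Q i = q.
Proof. by rewrite -mem_region_up => /up_pos_surj[i E]; exists i; rewrite /P /Q E. Qed.

Let down_ex p q : [&& - 2 <= p + q, 0 <= p - 2 * q & 2 * p - q <= 3 * n%:Z - 2] ->
  exists2 i, P' i = p & Q' i = q.
Proof. by rewrite -mem_region_down => /down_pos_surj[i E]; exists i; rewrite /P' /Q' E. Qed.

Let adjE i j : adjacent i j =
  [|| (P i == P' j) && (Q i == Q' j), (P i + 1 == P' j) && (Q i == Q' j)
    | (P i == P' j) && (Q i == Q' j + 1)].
Proof.
rewrite /adjacent /P /Q /P' /Q'.
by case: (up_pos i) (down_pos j) => p q [p' q']; rewrite share_edge_up_down.
Qed.

(** The keys read the triangles row by row, from left to right. The shift by 5 and the base [B] keep
    the horizontal coordinate in [0, [B]), as [lex_ltr] demands. *)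
Let B : int := 4 * n%:Z + 20.
Let key (i : 'I_m) : int := Q i * B + (P i + 5).
Let key' (i : 'I_m) : int := Q' i * B + (P' i + 5).

Let key_lt i j : (key i < key j) = (Q i < Q j) || (Q i == Q j) && (P i < P j).
Proof.
have := upP i; have := upP j => Hj Hi.
by rewrite lex_ltr ?ltrD2r // /B; lia.
Qed.

Let key'_lt i j : (key' i < key' j) = (Q' i < Q' j) || (Q' i == Q' j) && (P' i < P' j).
Proof.
have := downP i; have := downP j => Hj Hi.
by rewrite lex_ltr ?ltrD2r // /B; lia.
Qed.

Let key_inj : injective key.
Proof.
move=> i j E; have := key_lt i j; have := key_lt j i; rewrite E ltxx => H1 H2.
by apply: up_eq; lia.
Qed.

Let key'_inj : injective key'.
Proof.
move=> i j E; have := key'_lt i j; have := key'_lt j i; rewrite E ltxx => H1 H2.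
by apply: down_eq; lia.
Qed.

(* [i] is matched across the bottom edge of its triangle, with the row below. *)
Let vert (s : 'S_m) (i : 'I_m) : bool := Q i == Q' (s i) + 1.

Let left_ups (j : 'I_m) : nat := \sum_i ((Q i == Q j) && (P i < P j)%R).
Let right_downs (j : 'I_m) : nat := \sum_i ((Q' i + 1 == Q j)%R && (P j < P' i)%R).
Let row_verts (s : 'S_m) (q : int) : nat := \sum_i (vert s i && (Q i == q)).

(** Upward triangles in rows at least [q] have their partners in rows at least [q], except those
    matched from row [q] to the row below. So the number of vertical edges at a row is a difference
    of two counts that do not involve [s]. *)
Let row_vertsE s q : is_matching s ->
  (row_verts s q + \sum_i (q <= Q' i)%R = \sum_i (q <= Q i)%R)%N.
Proof.
move=> /forallP ms; rewrite (reindex_inj (@perm_inj _ s)) /= -big_split /=.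
apply: eq_bigr => i _; have := ms i; rewrite adjE /vert; move: (P i) (Q i) (P' (s i)) (Q' (s i)) => p1 q1 p2 q2; clear; lia.
Qed.

(** A [j] matched within its row closes no inversion. If [j] is vertical, the inverted [i] are the
    upward triangles to its left matched within the row, and those of the row below whose partner is
    to the right of that of [j]. Vertical edges other than that of [j] are what [left_ups] and
    [right_downs] count in excess. *)
Let inversionsE s j : is_matching s ->
  (\sum_i ((key i < key j)%R && (key' (s j) < key' (s i))%R) + vert s j * row_verts s (Q j) =
   vert s j * (left_ups j + right_downs j + 1))%N.
Proof.
move=> /forallP ms; have mj := ms j; rewrite adjE in mj.
have [vj|hj] := boolP (vert s j); last first.
  rewrite !mul0n addn0 big1 // => i _.
  have := ms i; rewrite adjE key_lt key'_lt; move: mj hj; rewrite /vert.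
  have ne : (i == j) || (i != j) by case: eqP.
  have : P' (s i) = P' (s j) -> Q' (s i) = Q' (s j) -> i = j.
    by move=> e1 e2; apply: (@perm_inj _ s); apply: down_eq.
  have [->|ij] := eqVneq i j; first by lia.
  have : P i = P j -> Q i = Q j -> False by move=> e1 e2; case/eqP: ij; apply: up_eq.
  move=> h1 h2 *; have {}h2 : P' (s i) = P' (s j) -> Q' (s i) = Q' (s j) -> False.
    by move=> e1 e2; case/eqP: ij; apply: h2.
  by lia.
rewrite !mul1n /row_verts /left_ups /right_downs.
rewrite [X in (_ = _ + X + 1)%N](reindex_inj (@perm_inj _ s)) /=.
have E1 : (\sum_i (i == j) = 1)%N by rewrite (bigD1 j) //= eqxx big1 // => i /negPf->.
rewrite -[X in (_ = _ + X)%N]E1.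
rewrite -!big_split /=; apply: eq_bigr => i _.
have := ms i; rewrite adjE key_lt key'_lt; move: mj vj; rewrite /vert.
have [->|ij] := eqVneq i j.
  move: (P j) (Q j) (P' (s j)) (Q' (s j)) => pj qj pj' qj'; clear; lia.
have : P i = P j -> Q i = Q j -> False by move=> e1 e2; case/eqP: ij; apply: up_eq.
have : P' (s i) = P' (s j) -> Q' (s i) = Q' (s j) -> False.
  by move=> e1 e2; case/eqP: ij; apply: (@perm_inj _ s); apply: down_eq.
move: (P j) (Q j) (P' (s j)) (Q' (s j)) (P i) (Q i) (P' (s i)) (Q' (s i)).
move=> pj qj pj' qj' p q p' q' ne' ne + /eqP Eq + ; rewrite {}Eq in ne *.
have -> : (qj' + 1 == qj') = false by lia.
rewrite eqxx !andbF andbT /= => /eqP Ep; rewrite {}Ep in ne *.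
case/or3P => /andP[/eqP Ep /eqP Eq]; [rewrite {}Ep {}Eq in ne * | rewrite -{}Ep {}Eq in ne' ne * | rewrite {}Ep {}Eq in ne *].
- case: (ltgtP q' (qj' + 1)) => H; move: ne' ne H; clear; lia.
- case: (ltgtP q' (qj' + 1)) => H; move: ne' ne H; clear; lia.
- case: (ltgtP q' qj') => H; move: ne' ne H; clear; lia.
Qed.

Let below (j : 'I_m) : bool := [exists d, (P' d == P j) && (Q' d + 1 == Q j)].

Let vert_below s j : is_matching s -> vert s j -> below j.
Proof.
move=> /forallP /(_ j); rewrite adjE /vert => ms vj; apply/existsP; exists (s j).
by move: ms vj; move: (P j) (Q j) (P' (s j)) (Q' (s j)); lia.
Qed.

(* Within a row, moving [j] one step to the right trades one downward triangle
   on its right in the row below for one upward triangle on its left. *)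
Let left_right_const j j' : below j -> below j' -> Q j = Q j' ->
  (left_ups j + right_downs j = left_ups j' + right_downs j')%N.
Proof.
wlog : j j' / P j <= P j'.
  move=> W bj bj' E; have [/W|/ltW/W] := leP (P j) (P j'); first exact.
  by move=> H; rewrite -H.
move=> le_jj' /existsP[d /andP[/eqP pd /eqP qd]] /existsP[d' /andP[/eqP pd' /eqP qd']] E.
pose A (i : 'I_m) := [&& Q i == Q j, P j <= P i & P i < P j'].
pose D (i : 'I_m) := [&& Q' i + 1 == Q j, P j < P' i & P' i <= P j'].
have EA : (left_ups j' = left_ups j + #|A|)%N.
  rewrite -sum_bool_card -big_split; apply: eq_bigr => i _; rewrite /A -E /=.
  by move: (P j) (Q j) (P j') (P i) (Q i) le_jj' => *; lia.
have ED : (right_downs j = right_downs j' + #|D|)%N.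
  rewrite -sum_bool_card -big_split; apply: eq_bigr => i _; rewrite /D -E /=.
  by move: (P j) (Q j) (P j') (P' i) (Q' i) le_jj' => *; lia.
suff AD : #|D| = #|A| by rewrite EA ED AD addnAC addnA.
(* The region meets each row in an interval, so the upward triangles between [j] and [j'], and the
   downward ones between [d] and [d'], are all present. *)
have dj := upP j; have dj' := upP j'; have bd := downP d; have bd' := downP d'.
apply/eqP; rewrite eqn_leq; apply/andP; split.
  apply: (@leq_card_by _ _ (int * int)%type D A (fun i => (P' i - 1, Q' i + 1)) (@up_pos n)) => [i i' [e1 e2]|i].
    by apply: down_eq; lia.
  have := downP i; rewrite unfold_in => bi Di.
  have [|k pk qk] := @up_ex (P' i - 1) (Q' i + 1).
    move: Di; rewrite /D; lia.
  exists k; last by rewrite -pk -qk /P /Q; case: (up_pos k).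
  by rewrite unfold_in /A pk qk; move: Di; rewrite /D; lia.
apply: (@leq_card_by _ _ (int * int)%type A D (fun i => (P i + 1, Q i - 1)) (@down_pos n)) => [i i' [e1 e2]|i].
  by apply: up_eq; lia.
have := upP i; rewrite unfold_in => bi Ai.
have [|k pk qk] := @down_ex (P i + 1) (Q i - 1).
  move: Ai; rewrite /A; lia.
exists k; last by rewrite -pk -qk /P' /Q'; case: (down_pos k).
by rewrite unfold_in /D pk qk; move: Ai; rewrite /A; lia.
Qed.

(** The inversion number is a sum over vertical edges of a weight depending only on the row, and all
    matchings have the same number of vertical edges in each row. *)
Lemma matching_odd_perm (s t : 'S_m) : is_matching s -> is_matching t -> s = t :> bool.
Proof.
move=> ms mt; apply: (odd_perm_inversions key_inj key'_inj).
have row_eq q : row_verts s q = row_verts t q.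
  by apply/eqP; rewrite -(eqn_add2r (\sum_i (q <= Q' i)%R)) !row_vertsE.
pose w j : int := (left_ups j + right_downs j + 1)%N%:Z - (row_verts s (Q j))%:Z.
have invE r : is_matching r -> (forall q, row_verts s q = row_verts r q) ->
    (inversions key key' r)%:Z = \sum_(j | vert r j) w j.
  move=> mr Er; rewrite /inversions (big_morph Posz PoszD (erefl _)) [RHS]big_mkcond.
  apply: eq_bigr => j _; have := inversionsE j mr; rewrite /w -Er.
  by case: (vert r j); rewrite ?mul1n ?mul0n; lia.
(* The common weight of row [q], read off any triangle that can be matched downwards; the default 0
   is for rows without one, which carry no vertical edge. *)
pose W q : int := if [pick j | below j && (Q j == q)] is Some j then w j else 0.
have WE j : below j -> w j = W (Q j).
  move=> bj; rewrite /W; case: pickP => [k /andP[bk /eqP kj]|/(_ j)]; last by rewrite bj eqxx.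
  by rewrite /w (left_right_const bj bk (esym kj)) kj.
have sumE r : is_matching r -> \sum_(j | vert r j) w j = \sum_(q <- [seq Q j | j in vert r]) W q.
  move=> mr; rewrite big_image; apply: eq_bigr => j vj; apply: WE; exact: vert_below vj.
apply/eqP; rewrite -eqz_nat !invE // !sumE //; apply/eqP/perm_big.
apply/allP => q _ /=; apply/eqP.
have cnt r : count_mem q [seq Q j | j in vert r] = row_verts r q.
  rewrite count_map -size_filter /row_verts sum_bool_card cardE.
  congr size; rewrite /enum_mem -filter_predI; apply: eq_filter => i /=.
  by rewrite /= unfold_in /= andbC.
by rewrite !cnt.
Qed.

End Matchings.

(** * Frequency pairs *)

Section Pairs.
Local Open Scope nat_scope.
Variable n : nat.
Local Notation N := (3 * n + 3).

(* The gaps [(g1, g2, g3)] of a cyclic triple of residues modulo [N], rotated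
   so that [g1 < g2] and [g1 <= g3]; the cells parametrize these. *)
Definition gaps (x : cell n) : nat * nat * nat :=
  let: (c, d, i) := val x in
  (n - c - d, n - c - d + 1 + 3 * c + i, n - c - d + 3 * d + 2 - i).

(** The frequencies {0, a, b} have cyclic gaps a, b - a, N - b. The index [k] chooses which of the
    three frequencies is translated to 0. *)
Definition cell_pair (x : cell n) (k : nat) : nat * nat :=
  let: (g1, g2, g3) := gaps x in
  if k == 0 then (g1, g1 + g2) else if k == 1 then (g2, g2 + g3) else (g3, g3 + g1).

Definition generic_pair (p : nat * nat) : bool :=
  [&& 0 < p.1, p.1 < p.2, p.2 < N & p != (n + 1, 2 * n + 2)].

Lemma gapsP (x : cell n) : let: (g1, g2, g3) := gaps x in
  [/\ 0 < g1, g1 < g2, g1 <= g3 & g1 + g2 + g3 = N].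
Proof.
case: x => [[[c d] i] /= cd]; have := ltn_ord i.
by move: (nat_of_ord c) (nat_of_ord d) (nat_of_ord i) cd => {}c {}d {}i; split; lia.
Qed.

Lemma gaps_inj : injective gaps.
Proof.
move=> [[[c d] i] /= cd] [[[c' d'] i'] /= cd'] [E1 E2 E3]; apply: val_inj => /=.
suff [Ec [Ed Ei]] : (c = c' :> nat) /\ (d = d' :> nat) /\ (i = i' :> nat).
  by congr (_, _, _); apply: val_inj.
have := ltn_ord i; have := ltn_ord i'.
move: (nat_of_ord i) (nat_of_ord i') E2 E3 => u v; lia.
Qed.

(** Here s + t = 3(n - g1) + 2, so the residues of [s] and [t] modulo 3 add up to 2 and their
    quotients to n - g1: one residue and the two quotients determine the gaps. *)
Lemma gaps_surj g1 g2 g3 : 0 < g1 -> g1 < g2 -> g1 <= g3 -> g1 + g2 + g3 = N ->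
  exists x, gaps x = (g1, g2, g3).
Proof.
move=> h1 h2 h3 E.
pose s := g2 - g1 - 1; pose t := g3 - g1.
have cn : s %/ 3 < n by rewrite /s; lia.
have dn : t %/ 3 < n by rewrite /t; lia.
have i3 : s %% 3 < 3 by lia.
have cdn : s %/ 3 + t %/ 3 < n by rewrite /s /t; lia.
exists (Sub (Ordinal cn, Ordinal dn, Ordinal i3) cdn).
by rewrite /gaps /=; congr (_, _, _); rewrite /s /t; lia.
Qed.

Lemma cell_pair_generic x k : k < 3 -> generic_pair (cell_pair x k).
Proof.
have := gapsP x; rewrite /cell_pair /generic_pair.
case: (gaps x) => [[g1 g2] g3] [h1 h2 h3 h4].
by case: k => [|[|[|]]] //= _; rewrite xpair_eqE; lia.
Qed.

Lemma cell_pair_inj x x' k k' : k < 3 -> k' < 3 ->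
  cell_pair x k = cell_pair x' k' -> x = x' /\ k = k'.
Proof.
move=> k3 k3' E; suff [Eg Ek] : gaps x = gaps x' /\ k = k' by split=> //; apply: gaps_inj.
have := gapsP x; have := gapsP x'; move: E; rewrite /cell_pair.
case: (gaps x) (gaps x') => [[g1 g2] g3] [[g1' g2'] g3'].
move=> E [h1' h2' h3' h4'] [h1 h2 h3 h4]; move: E.
case: k k3 => [|[|[|]]] //= _; case: k' k3' => [|[|[|]]] //= _ [E1 E2]; split=> //;
  try congr (_, _, _); lia.
Qed.

(** Unless the gaps are all equal, exactly one rotation starts with a smallest gap followed by a
    strictly larger one. Equal gaps are the excluded pair. *)
Lemma cell_pair_surj p : generic_pair p -> exists x k, k < 3 /\ p = cell_pair x k.
Proof.
case: p => a b; rewrite /generic_pair xpair_eqE /= => H.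
have [] : ((a < b - a) && (a <= N - b)) \/ ((N - b < a) && (N - b <= b - a)) \/
   ((b - a < N - b) && (b - a <= a)) by lia.
  move=> /andP[h1 h2]; have [||||x E] := @gaps_surj a (b - a) (N - b); try lia.
  by exists x, 0; split=> //; rewrite /cell_pair E /=; congr (_, _); lia.
case=> /andP[h1 h2].
  have [||||x E] := @gaps_surj (N - b) a (b - a); try lia.
  by exists x, 1; split=> //; rewrite /cell_pair E /=; congr (_, _); lia.
have [||||x E] := @gaps_surj (b - a) (N - b) a; try lia.
by exists x, 2; split=> //; rewrite /cell_pair E /=; congr (_, _); lia.
Qed.

Definition generic_pairs : seq (nat * nat) :=
  [seq p <- [seq (a, b) | a <- index_iota 1 N, b <- index_iota a.+1 N]
     | p != (n + 1, 2 * n + 2)].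

Lemma generic_pairs_uniq : uniq generic_pairs.
Proof.
apply: filter_uniq; apply: allpairs_uniq_dep => [|a _|]; rewrite ?iota_uniq //.
by move=> [a b] [a' b'] _ _ [-> ->].
Qed.

Lemma mem_generic_pairs p : (p \in generic_pairs) = generic_pair p.
Proof.
rewrite mem_filter; apply/andP/idP.
  case=> p_ne /allpairsPdep[a [b [+ + E]]]; rewrite !mem_index_iota => Ha Hb.
  by rewrite /generic_pair p_ne E /=; lia.
case: p => a b /and4P[/= h1 h2 h3 ->]; split=> //.
by apply/allpairsPdep; exists a, b; rewrite !mem_index_iota; split=> //; lia.
Qed.

Lemma big_generic_pairs_seq (R : Type) (idx : R) (op : Monoid.com_law idx) (F : nat * nat -> R) :
  \big[op/idx]_(1 <= a < N) \big[op/idx]_(a.+1 <= b < N | (a, b) != (n + 1, 2 * n + 2)) F (a, b) =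
  \big[op/idx]_(p <- generic_pairs) F p.
Proof.
rewrite big_filter [RHS]big_mkcond big_allpairs_dep /=.
by apply: eq_bigr => a _; rewrite big_mkcond.
Qed.

Lemma big_generic_pairs (R : Type) (idx : R) (op : Monoid.com_law idx) (F : nat * nat -> R) :
  \big[op/idx]_(p <- generic_pairs) F p =
  \big[op/idx]_(x : cell n) \big[op/idx]_(k < 3) F (cell_pair x k).
Proof.
transitivity (\big[op/idx]_(p <- [seq cell_pair y.1 (y.2 : 'I_3) | y : cell n * 'I_3]) F p); last first.
  by rewrite big_image /= pair_big.
apply: perm_big; apply: uniq_perm; first exact: generic_pairs_uniq.
  rewrite map_inj_uniq ?enum_uniq // => -[x k] [x' k'] /= E.
  have [-> Ek] := cell_pair_inj (ltn_ord k) (ltn_ord k') E.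
  by congr (_, _); apply: val_inj.
move=> p; rewrite mem_generic_pairs; apply/idP/imageP.
  by case/cell_pair_surj => x [k [k3 Ep]]; exists (x, Ordinal k3).
by case=> -[x k] _ /= ->; apply: cell_pair_generic.
Qed.

(** Folds the square of all frequencies along its diagonal; it serves both for products of waves and
    for logarithms of eigenvalues. *)
Lemma sum_square_generic_pairs (V : nmodType) (F : nat * nat -> V) :
  (forall a b, F (a, b) = F (b, a)) -> (forall b, F (0, b) = 0%R) ->
  (forall a, F (a, a) = 0%R) -> F (n + 1, 2 * n + 2) = 0%R ->
  (\sum_(a < N) \sum_(b < N) F (a : nat, b : nat) = (\sum_(p <- generic_pairs) F p) *+ 2)%R.
Proof.
move=> Fsym F0 Fdiag Fc.
transitivity ((\sum_(a < N) \sum_(b < N | (a < b)%N) F (a : nat, b : nat)) *+ 2)%R.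
  rewrite mulr2n [X in (_ + X)%R](exchange_big_dep xpredT) //= -big_split /=.
  apply: eq_bigr => a _; rewrite [X in (X + _)%R]big_mkcond [X in (_ + X)%R]big_mkcond -big_split /=.
  apply: eq_bigr => b _.
  by case: ltngtP => [_|_|->]; rewrite ?addr0 ?add0r ?Fdiag // Fsym.
congr (_ *+ 2)%R; rewrite -(@big_generic_pairs_seq _ _ _ F).
transitivity (\sum_(0 <= a < N) \sum_(a.+1 <= b < N) F (a, b))%R.
  by rewrite big_mkord; apply: eq_bigr => a _; rewrite big_geq_mkord.
have N0 : 0 < N by rewrite addn3.
rewrite [LHS](big_ltn N0) [X in (X + _)%R]big1 ?add0r; last by move=> b _; apply: F0.
apply: eq_bigr => a _; rewrite [RHS]big_mkcond; apply: eq_bigr => b _.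
by case: eqP => // ->.
Qed.

End Pairs.

(** * Antisymmetrized waves *)

Definition wave_terms (Y : int * int * int) : seq (bool * int * int) :=
  let: (y1, y2, y3) := Y in
  [:: (false, y1, y2); (true, y2, y1); (false, y2, y3);
      (true, y3, y2); (false, y3, y1); (true, y1, y3)].

Section Wave.
Variable C : fieldType.
Implicit Types (x w : C) (Y : int * int * int).

(* The determinant of the 3x3 matrix with columns [1, x ^ y, w ^ y] for the
   three entries [y] of [Y]. *)
Definition wave x w Y : C :=
  \sum_(t <- wave_terms Y) (-1) ^+ t.1.1 * (x ^ t.1.2 * w ^ t.2).

Definition wave_unfold x w y1 y2 y3 : wave x w (y1, y2, y3) =
  x ^ y1 * w ^ y2 - x ^ y2 * w ^ y1 + x ^ y2 * w ^ y3 - x ^ y3 * w ^ y2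
  + x ^ y3 * w ^ y1 - x ^ y1 * w ^ y3.
Proof.
by rewrite /wave /wave_terms !big_cons big_nil /= expr0 expr1; ring.
Qed.

(** In each monomial of the determinant the three coordinates are exponents of 1, x and w in some
    order, so the three shifts multiply it by 1, x and w once each. *)
Lemma wave_shift x w y1 y2 y3 : x != 0 -> w != 0 ->
  wave x w (y1 + 1, y2, y3) + wave x w (y1, y2 + 1, y3) + wave x w (y1, y2, y3 + 1) =
  (1 + x + w) * wave x w (y1, y2, y3).
Proof. by move=> x0 w0; rewrite !wave_unfold !expfzDr // !expr1z; ring. Qed.

Lemma wave12 x w y y3 : wave x w (y, y, y3) = 0.
Proof. by rewrite wave_unfold; ring. Qed.

Lemma wave13 x w y y2 : wave x w (y, y2, y) = 0.
Proof. by rewrite wave_unfold; ring. Qed.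

Lemma wave23 x w y y1 : wave x w (y1, y, y) = 0.
Proof. by rewrite wave_unfold; ring. Qed.

Lemma wave_per x w y1 y2 y3 (N : int) : x ^ N = 1 -> w ^ N = 1 -> x != 0 -> w != 0 ->
  wave x w (y1 + N, y2, y3) = wave x w (y1, y2, y3).
Proof. by move=> xN wN x0 w0; rewrite !wave_unfold !expfzDr // xN wN; ring. Qed.

Lemma waveC x w Y : wave w x Y = - wave x w Y.
Proof. by case: Y => [[y1 y2] y3]; rewrite !wave_unfold; ring. Qed.

Lemma wave1x w Y : wave 1 w Y = 0.
Proof. by case: Y => [[y1 y2] y3]; rewrite wave_unfold !exp1rz; ring. Qed.

Lemma wavexx x Y : wave x x Y = 0.
Proof. by case: Y => [[y1 y2] y3]; rewrite wave_unfold; ring. Qed.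

(* Rotating the frequencies [{0, a, b}] to [{0, b - a, - a}] only multiplies
   the wave by a phase. *)
Lemma wave_rot x w y1 y2 y3 : x != 0 -> w != 0 ->
  wave (w / x) x^-1 (y1, y2, y3) = x ^ (- (y1 + y2 + y3)) * wave x w (y1, y2, y3).
Proof.
move=> x0 w0; rewrite !wave_unfold !expfzMl !exprz_inv.
have E u v s : w ^ u * x ^ (- u) * x ^ (- v) = x ^ (- (u + v + s)) * (x ^ s * w ^ u).
  by rewrite !mulrA -[x ^ _ * x ^ s]expfzDr // -mulrA -expfzDr // mulrC; congr (x ^ _ * _); lia.
rewrite (E y1 y2 y3) (E y2 y1 y3) (E y2 y3 y1) (E y3 y2 y1) (E y3 y1 y2) (E y1 y3 y2).
have [-> -> -> -> ->] : [/\ y2 + y1 + y3 = y1 + y2 + y3, y2 + y3 + y1 = y1 + y2 + y3,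
  y3 + y2 + y1 = y1 + y2 + y3, y3 + y1 + y2 = y1 + y2 + y3 &
  y1 + y3 + y2 = y1 + y2 + y3] by split; lia.
by ring.
Qed.

End Wave.

Section Orthogonality.
Variables (C : numClosedFieldType) (N : nat) (z : C).
Hypothesis prim_z : N.-primitive_root z.
Let N_gt0 := prim_order_gt0 prim_z.

Lemma prim_root_neq0 : z != 0.
Proof.
by rewrite (prim_root_eq0 prim_z) -lt0n.
Qed.
Let z0 := prim_root_neq0.

Lemma prim_root_norm : `|z| = 1.
Proof.
apply/eqP; rewrite -(@pexpr_eq1 _ _ N) //.
by rewrite -normrX (prim_expr_order prim_z) normr1.
Qed.

Lemma prim_root_conj : z^* = z^-1.
Proof.
by rewrite invC_norm prim_root_norm expr1n invr1 mul1r.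
Qed.

Lemma prim_exprz_eq1 (k : int) : (z ^ k == 1) = (N %| `|k|)%N.
Proof.
rewrite (prim_order_dvd prim_z); case: k => k //=; rewrite ?absz_nat //.
by rewrite NegzE -[LHS]/(z ^- k.+1 == 1) invr_eq1.
Qed.

Lemma sum_prim_root (k : int) :
  \sum_(a < N) (z ^+ a) ^ k = if (N %| `|k|)%N then N%:R else 0.
Proof.
under eq_bigr => a _ do rewrite -[z ^+ a]/(z ^ a) exprzAC -[_ ^ a]/(_ ^+ a).
rewrite -prim_exprz_eq1; case: eqP => [->|/eqP ne1].
  by rewrite (eq_bigr (fun=> 1)) ?sumr_const ?card_ord // => a _; rewrite expr1n.
apply: (mulfI (x := z ^ k - 1)); first by rewrite subr_eq0.
by rewrite mulr0 -subrX1 -[_ ^+ N]/(_ ^ N) exprzAC -[z ^ N]/(z ^+ N) prim_expr_order // exp1rz subrr.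
Qed.

(** An open alcove of the affine Weyl group of type A2 at scale [N]: waves vanish on its walls y2 =
    y3, y3 = y1 and y1 = y2 + N. *)
Definition alcove (Y : int * int * int) : bool :=
  let: (y1, y2, y3) := Y in [&& y2 < y3, y3 < y1 & y1 < y2 + N%:Z].

Definition coord_sum (Y : int * int * int) : int := let: (y1, y2, y3) := Y in y1 + y2 + y3.

(* Congruences between the entries of two points of the alcove with the same
   sum are equalities: the three multiples of [N] involved add up to zero and
   differ pairwise by less than [2 * N]. *)
Lemma alcove_rigid Y Y' t t' : alcove Y -> alcove Y' -> coord_sum Y = coord_sum Y' ->
  t \in wave_terms Y -> t' \in wave_terms Y' ->
  (N %| `|t'.1.2 - t.1.2|)%N && (N %| `|t'.2 - t.2|)%N = (Y == Y') && (t == t').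
Proof.
case: Y Y' t t' => [[y1 y2] y3] [[y1' y2'] y3'] [[s u] v] [[s' u'] v'] /=.
move=> al al' tot tY tY'; apply/andP/andP; last first.
  by case=> _ /eqP[_ -> ->]; rewrite !subrr !dvdn0.
case=> /dvdnP[k1 E1] /dvdnP[k2 E2].
have [c1 F1] : exists c1 : int, u' - u = c1 * N%:Z.
  by case: (lerP 0 (u' - u)) => H; [exists k1%:Z | exists (- k1%:Z)]; lia.
have [c2 F2] : exists c2 : int, v' - v = c2 * N%:Z.
  by case: (lerP 0 (v' - v)) => H; [exists k2%:Z | exists (- k2%:Z)]; lia.
(* [w0] is the coordinate that the term omits; inside the alcove all coordinates differ by less than
   [N]. *)
have bnd (Y : int * int * int) s0 u0 v0 : alcove Y -> (s0, u0, v0) \in wave_terms Y ->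
  let w0 := coord_sum Y - u0 - v0 in
  [/\ `|u0 - v0| < N%:Z, `|u0 - w0| < N%:Z & `|v0 - w0| < N%:Z].
  case: Y => [[a b] c] /= alY; rewrite !inE !xpair_eqE.
  by do ![case/orP]; case/andP => /andP[_ /eqP ->] /eqP ->; split; lia.
have [b1 b2 b3] := bnd _ _ _ _ (al : alcove (y1, y2, y3)) tY.
have [b1' b2' b3'] := bnd _ _ _ _ (al' : alcove (y1', y2', y3')) tY'.
rewrite /= in b1 b2 b3 b1' b2' b3'.
have lt2 (c : int) : `|c * N%:Z| < 2 * N%:Z -> `|c| < 2.
  by rewrite normrM [ `|N%:Z|]ger0_norm // ltr_pM2r // ltz_nat.
(* The omitted coordinate moves by -(c1 + c2) [N], whence the two combinations below. *)
have d1 : `|c1 - c2| < 2 by apply: lt2; rewrite mulrBl; lia.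
have d2 : `|2 * c1 + c2| < 2 by apply: lt2; rewrite mulrDl -mulrA; lia.
have d3 : `|2 * c2 + c1| < 2 by apply: lt2; rewrite mulrDl -mulrA; lia.
have [c1_0 c2_0] : c1 = 0 /\ c2 = 0 by move: d1 d2 d3; clear; rewrite !ltr_norml; lia.
move: F1 F2; rewrite c1_0 c2_0 !mul0r => F1 F2.
clear - al al' tot tY tY' F1 F2.
move: tY tY'; rewrite !inE !xpair_eqE.
by do ![case/orP]; case/andP => /andP[/eqP -> /eqP ?] /eqP ?;
   do ![case/orP]; case/andP => /andP[/eqP -> /eqP ?] /eqP ?; lia.
Qed.

Lemma conj_wave (a b : nat) Y : (wave (z ^+ a) (z ^+ b) Y)^* =
  \sum_(t <- wave_terms Y) (-1) ^+ t.1.1 * ((z ^+ a) ^ (- t.1.2) * (z ^+ b) ^ (- t.2)).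
Proof.
have E (k : nat) (u : int) : ((z ^+ k) ^ u)^* = (z ^+ k) ^ (- u).
  by rewrite fmorphXz rmorphXn /= prim_root_conj exprVn exprz_inv.
rewrite /wave rmorph_sum; apply: eq_bigr => t _.
by rewrite !rmorphM rmorph_sign /= !E.
Qed.

(** Each of the 36 products of terms gives two geometric sums, both nonzero only on equal exponents
    modulo [N]. By [alcove_rigid] only the six diagonal products survive. *)
Lemma wave_orthogonal Y Y' : alcove Y -> alcove Y' -> coord_sum Y = coord_sum Y' ->
  \sum_(a < N) \sum_(b < N)
    (wave (z ^+ a) (z ^+ b) Y)^* * wave (z ^+ a) (z ^+ b) Y' =
  if Y == Y' then 6 * N%:R ^+ 2 else 0.
Proof.
move=> alY alY' totY.
pose S (t t' : bool * int * int) : C := (-1) ^+ t.1.1 * (-1) ^+ t'.1.1 *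
  ((\sum_(a < N) (z ^+ a) ^ (t'.1.2 - t.1.2)) * (\sum_(b < N) (z ^+ b) ^ (t'.2 - t.2))).
transitivity (\sum_(t <- wave_terms Y) \sum_(t' <- wave_terms Y') S t t').
  under eq_bigr do under eq_bigr do rewrite conj_wave big_distrlr /=.
  under eq_bigr do rewrite exchange_big /=.
  rewrite exchange_big /=; apply: eq_bigr => t _.
  under eq_bigr do rewrite exchange_big /=.
  rewrite exchange_big /=; apply: eq_bigr => t' _.
  rewrite /S big_distrlr mulr_sumr /=; apply: eq_bigr => a _.
  rewrite mulr_sumr; apply: eq_bigr => b _.
  rewrite !expfzDr ?expf_neq0 ?z0 //; ring.
have SE t t' : t \in wave_terms Y -> t' \in wave_terms Y' ->
    S t t' = if (Y == Y') && (t == t') then N%:R ^+ 2 else 0.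
  move=> tY tY'; rewrite /S !sum_prim_root -(alcove_rigid alY alY' totY tY tY').
  have [d1|d1] := boolP (N %| _)%N; have [d2|d2] := boolP (N %| _)%N;
    rewrite ?mul0r ?mulr0 //=.
  move: (alcove_rigid alY alY' totY tY tY'); rewrite d1 d2 => /esym/andP[_ /eqP ->].
  by rewrite -expr2 sqrr_sign mul1r.
case: (eqVneq Y Y') SE => [EY|neY] SE; last first.
  by apply: big1_seq => t /= tY; apply: big1_seq => t' /= tY'; rewrite SE.
have uY : uniq (wave_terms Y').
  case: (Y') alY' => [[y1 y2] y3] /= al; rewrite !inE !xpair_eqE /=; clear - al; lia.
rewrite EY in SE *.
transitivity (\sum_(t <- wave_terms Y') (N%:R ^+ 2 : C)).
  apply: eq_big_seq => t tY; rewrite (bigD1_seq t) //= SE // eqxx /= big1_seq ?addr0 //.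
  by move=> t' /andP[/= ne tY']; rewrite SE // eq_sym (negPf ne).
rewrite big_const_seq count_predT iter_addr_0.
have -> : size (wave_terms Y') = 6 by case: (Y') => [[? ?] ?].
by rewrite -[LHS]mulr_natl.
Qed.

End Orthogonality.

(** * Diagonalization *)

Section Spectrum.
Variables (C : numClosedFieldType) (n : nat) (z : C).
Local Notation N := (3 * n + 3)%N.
Hypothesis prim_z : N.-primitive_root z.
Let z0 : z != 0 := prim_root_neq0 prim_z.
Local Notation m := #|cell n|.

Definition adjacency : 'M[C]_m := \matrix_(i, j) (adjacent i j)%:R.

Lemma norm_det_adjacency : `|\det adjacency| = (tilings n)%:R.
Proof.
have E : \det adjacency = \sum_(s : 'S_m | is_matching s) (-1) ^+ s.
  rewrite /determinant [RHS]big_mkcond; apply: eq_bigr => s _.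
  case: ifPn => [/forallP ms|].
    by rewrite big1 ?mulr1 // => i _; rewrite mxE ms.
  rewrite negb_forall => /existsP[i /negPf ni].
  by rewrite (bigD1 i) //= mxE ni mul0r mulr0.
rewrite tilings_matchings -sum1dep_card E.
have [/forallP s0|] := boolP [forall s : 'S_m, ~~ is_matching s].
  by rewrite !big1 ?normr0 // => s ms; case/negP: (s0 s).
rewrite negb_forall => /existsP[s /negPn ms].
rewrite (eq_bigr (fun=> (-1) ^+ s * 1)); last first.
  by move=> t mt; rewrite mulr1 (matching_odd_perm mt ms).
rewrite -mulr_sumr normrM normrX normrN1 expr1n mul1r natr_sum ger0_norm //.
by apply: sumr_ge0.
Qed.

(* Coordinates with [y1 - y3], [y3 - y2], [y2 + N - y1] the distances, in
   units of half the triangle height, to the three sides of an enclosing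
   triangle; a wave vanishes on these sides. *)
Definition up_coord (p : eisenstein) : int * int * int := (p.1 + 3, p.2 - p.1 - 2, - p.2).
Definition down_coord (p : eisenstein) : int * int * int := (p.1 + 3, p.2 - p.1 - 1, - p.2).

Definition mode (p : nat * nat) (Y : int * int * int) : C := wave (z ^+ p.1) (z ^+ p.2) Y.
Definition freq (p : nat * nat) : C := 1 + z ^+ p.1 + z ^+ p.2.

Let zN (a : nat) : (z ^+ a) ^ N%:Z = 1.
Proof. by rewrite -exprnP exprAC (prim_expr_order prim_z) expr1n. Qed.

Let alcove_up (i : 'I_m) : alcove N (up_coord (up_pos i)).
Proof.
have := mem_cell_pos true (enum_val i); rewrite -/(up_pos i).
by case: (up_pos i) => p q; rewrite mem_region_up /alcove /up_coord /=; lia.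
Qed.

Let alcove_down (i : 'I_m) : alcove N (down_coord (down_pos i)).
Proof.
have := mem_cell_pos false (enum_val i); rewrite -/(down_pos i).
by case: (down_pos i) => p q; rewrite mem_region_down /alcove /down_coord /=; lia.
Qed.

(** The hypotheses are the inequalities of the region relaxed by one, so a triangle outside attains
    one of them and lies on a wall of the alcove. *)
Let mode_outside (f : nat * nat) (p : eisenstein) : 0 <= p.1 + p.2 + 3 ->
  0 <= p.1 - 2 * p.2 + 1 -> 2 * p.1 - p.2 + 4 <= N%:Z -> (p, false) \notin region n ->
  mode f (down_coord p) = 0.
Proof.
case: p => p q /= h1 h2 h3; rewrite mem_region_down => H.
rewrite /mode /down_coord /=.
have [E|[E|E]] : p + 3 = - q \/ q - p - 1 = - q \/ p + 3 = (q - p - 1) + N%:Z by lia.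
- by rewrite E wave13.
- by rewrite E wave23.
- by rewrite E wave_per ?zN ?expf_neq0 // wave12.
Qed.

(** In these coordinates the three neighbours of an upward triangle are its three unit shifts. A
    neighbour missing from the region may be included, since the wave is zero there. *)
Lemma sum_adjacent_mode (f : nat * nat) (i : 'I_m) :
  \sum_j (adjacent i j)%:R * mode f (down_coord (down_pos j)) =
  freq f * mode f (up_coord (up_pos i)).
Proof.
have upi := mem_cell_pos true (enum_val i); rewrite -/(up_pos i) in upi.
have one (p : eisenstein) : 0 <= p.1 + p.2 + 3 ->
    0 <= p.1 - 2 * p.2 + 1 -> 2 * p.1 - p.2 + 4 <= N%:Z ->
    \sum_(j : 'I_m) (p == down_pos j)%:R * mode f (down_coord (down_pos j)) = mode f (down_coord p).
  move=> h1 h2 h3; have [/down_pos_surj[j Ej]|out] := boolP ((p, false) \in region n).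
    rewrite (bigD1 j) //= Ej eqxx mul1r big1 ?addr0 // => k kj.
    by rewrite -Ej (inj_eq (@down_pos_inj n)) eq_sym (negPf kj) mul0r.
  rewrite (mode_outside _ h1 h2 h3 out) big1 // => j _.
  case: eqP => [E|_]; last by rewrite mul0r.
  by case/negP: out; rewrite E /down_pos mem_cell_pos.
case E : (up_pos i) upi => [p q]; rewrite mem_region_up => H.
have adjE j : (adjacent i j)%:R = ((p, q) == down_pos j)%:R + ((p + 1, q) == down_pos j)%:R +
    ((p, q - 1) == down_pos j)%:R :> C.
  rewrite /adjacent E; case: (down_pos j) => p' q'; rewrite share_edge_up_down !xpair_eqE.
  have -> : (q == q' + 1) = (q - 1 == q') by rewrite subr_eq.
  have [] : [/\ ~~ ((p == p') && (q == q') && ((p + 1 == p') && (q == q'))),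
      ~~ ((p == p') && (q == q') && ((p == p') && (q - 1 == q'))) &
      ~~ ((p + 1 == p') && (q == q') && ((p == p') && (q - 1 == q')))] by split; lia.
  move: ((p == p') && (q == q')) ((p + 1 == p') && (q == q')) ((p == p') && (q - 1 == q')).
  by do 3!case=> //=; rewrite ?addr0 ?add0r.
rewrite (eq_bigr _ (fun j _ => congr1 (fun u => u * _) (adjE j))).
under eq_bigr do rewrite !mulrDl.
rewrite !big_split /= !one /=; try lia.
rewrite /mode /freq /up_coord /down_coord /= -wave_shift ?expf_neq0 //.
have -> : p + 1 + 3 = p + 3 + 1 by lia.
have -> : q - (p + 1) - 1 = q - p - 2 by lia.
have -> : q - 1 - p - 1 = q - p - 2 by lia.
have -> : q - p - 1 = q - p - 2 + 1 by lia.
have -> : - (q - 1) = - q + 1 by lia.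
by congr (_ + _); rewrite addrC.
Qed.

Lemma mode_rot (a b : nat) Y : (a <= b)%N -> (a <= N)%N ->
  mode (b - a, N - a)%N Y = (z ^+ a) ^ (- coord_sum Y) * mode (a, b) Y.
Proof.
move=> ab aN; case: Y => [[y1 y2] y3]; rewrite /mode /= -wave_rot ?expf_neq0 //.
congr wave; first by rewrite expfB_cond // (negPf z0).
apply: (mulIf (expf_neq0 a z0)); rewrite mulVf ?expf_neq0 // -exprD subnK //.
exact: prim_expr_order.
Qed.

Let zNk (a : nat) (k : int) : `|(z ^+ a) ^ k| = 1.
Proof. by case: k => k; rewrite /exprz ?normfV !normrX (prim_root_norm prim_z) !expr1n ?invr1. Qed.

(** Rotation fixes the central triple but multiplies its wave by a cube root of unity to the power
    -[coord_sum Y], here different from 1. Upward and downward coordinates have sums 1 and 2. *)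
Lemma mode_center Y : ~~ (3 %| `|coord_sum Y|)%N -> mode (n + 1, 2 * n + 2)%N Y = 0.
Proof.
move=> nY; have := @mode_rot (n + 1) (2 * n + 2) Y.
have -> : (2 * n + 2 - (n + 1) = n + 1)%N by lia.
have -> : (N - (n + 1) = 2 * n + 2)%N by lia.
move=> /(_ ltac:(lia) ltac:(lia)) E; apply/eqP; move/eqP: E.
rewrite -subr_eq0 -{1}[mode _ _]mul1r -mulrBl mulf_eq0 => /orP[|//].
have prim3 : 3.-primitive_root (z ^+ (n + 1)).
  have -> : (n + 1 = N %/ 3)%N by lia.
  by apply: dvdn_prim_root => //; apply/dvdnP; exists (n + 1)%N; lia.
by rewrite subr_eq0 eq_sym (prim_exprz_eq1 prim3) abszN (negPf nY).
Qed.

(** The factor 6 is 2 for exchanging the frequencies and 3 for rotating them; the rotation phases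
    cancel because the coordinate sums agree. *)
Lemma sum_modes Y Y' : coord_sum Y = coord_sum Y' -> ~~ (3 %| `|coord_sum Y|)%N ->
  \sum_(a < N) \sum_(b < N) (mode (nat_of_ord a, nat_of_ord b) Y)^* * mode (nat_of_ord a, nat_of_ord b) Y' =
  6 * \sum_(x : cell n) (mode (cell_pair x 0) Y)^* * mode (cell_pair x 0) Y'.
Proof.
move=> tot nY; pose F (p : nat * nat) := (mode p Y)^* * mode p Y'.
have F0l b : F (0, b)%N = 0 by rewrite /F /mode /= !wave1x mulr0.
have Fxx a : F (a, a)%N = 0 by rewrite /F /mode /= !wavexx mulr0.
have Fsym a b : F (a, b)%N = F (b, a)%N.
  by rewrite /F /mode /= (waveC (z ^+ b) (z ^+ a) Y) (waveC (z ^+ b) (z ^+ a) Y') rmorphN mulrNN.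
have Frot a b : (a <= b)%N -> (a <= N)%N -> F (b - a, N - a)%N = F (a, b)%N.
  move=> ab aN; rewrite /F !mode_rot // tot rmorphM mulrACA.
  by rewrite -normCKC zNk expr1n mul1r.
have Fc : F (n + 1, 2 * n + 2)%N = 0 by rewrite /F !mode_center ?mulr0 // -tot.
rewrite (@sum_square_generic_pairs n _ F) //.
have -> : 6 = 2 * 3 :> C by rewrite -natrM.
rewrite -mulrA -[LHS]mulr_natl; congr (_ * _).
rewrite big_generic_pairs mulr_sumr; apply: eq_bigr => x _.
rewrite !big_ord_recr big_ord0 /= add0r -/(F _).
have := gapsP x; rewrite /cell_pair; case: (gaps x) => [[g1 g2] g3] /= [g1p g12 g13 gN].
have -> : F (g3, g3 + g1)%N = F (g2, g2 + g3)%N.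
  by rewrite -(Frot g2 (g2 + g3)%N); [congr (F (_, _)); lia|lia|lia].
have -> : F (g2, g2 + g3)%N = F (g1, g1 + g2)%N.
  by rewrite -(Frot g1 (g1 + g2)%N); [congr (F (_, _)); lia|lia|lia].
ring.
Qed.

Definition up_modes : 'M[C]_m :=
  \matrix_(t, i) mode (cell_pair (enum_val t) 0) (up_coord (up_pos i)).
Definition down_modes : 'M[C]_m :=
  \matrix_(t, i) mode (cell_pair (enum_val t) 0) (down_coord (down_pos i)).

Lemma modes_adjacency :
  down_modes *m adjacency^T =
  diag_mx (\row_t freq (cell_pair (enum_val t) 0)) *m up_modes.
Proof.
apply/matrixP => t i; rewrite mul_diag_mx !mxE -sum_adjacent_mode.
by apply: eq_bigr => j _; rewrite !mxE mulrC.
Qed.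

(** The Gram matrix of the columns is [N] ^ 2 times the identity: the 6 of [sum_modes] cancels the 6
    of [wave_orthogonal]. *)
Lemma norm_det_modes (coord : 'I_m -> int * int * int) (s : int) :
  injective coord -> (forall i, alcove N (coord i)) -> (forall i, coord_sum (coord i) = s) ->
  ~~ (3 %| `|s|)%N ->
  `|\det (\matrix_(t < m, i < m) mode (cell_pair (enum_val t) 0) (coord i))| = N%:R ^+ m.
Proof.
move=> c_inj c_alc c_sum s3; set V := \matrix_(_, _) _.
have E : (map_mx Num.conj V)^T *m V = (N%:R ^+ 2)%:M.
  apply/matrixP => i j; rewrite !mxE; apply: (mulfI (x := 6)); first by rewrite pnatr_eq0.
  have := sum_modes (etrans (c_sum i) (esym (c_sum j))); rewrite c_sum => /(_ s3).
  rewrite /mode /= (wave_orthogonal prim_z) ?c_sum // (inj_eq c_inj).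
  rewrite (reindex _ (onW_bij _ (enum_val_bij (cell n)))) /= => H.
  rewrite mulrb [RHS]fun_if mulr0 H; congr (_ * _).
  by apply: eq_bigr => t _; rewrite !mxE.
have := congr1 (fun A => `|\det A|) E.
rewrite det_mulmx det_tr det_map_mx normrM norm_conjC det_scalar -expr2.
rewrite normrX normrX ger0_norm // [N%:R ^+ 2 ^+ _]exprAC => /eqP.
by rewrite eqrXn2 // ?exprn_ge0 // => /eqP.
Qed.

Lemma tilings_prod_freq :
  (tilings n)%:R = \prod_(x : cell n) `|freq (cell_pair x 0)|.
Proof.
have N0 : (N%:R : C) ^+ m != 0 by rewrite expf_neq0 // pnatr_eq0 addn3.
have EU : `|\det up_modes| = N%:R ^+ m.
  apply: (@norm_det_modes _ 1) => // [i j|i].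
    rewrite /up_coord => -[e1 e2 e3]; apply: up_pos_inj.
    by apply: injective_projections; lia.
  by rewrite /up_coord /=; lia.
have ED : `|\det down_modes| = N%:R ^+ m.
  apply: (@norm_det_modes _ 2) => // [i j|i].
    rewrite /down_coord => -[e1 e2 e3]; apply: down_pos_inj.
    by apply: injective_projections; lia.
  by rewrite /down_coord /=; lia.
have := congr1 (fun A => `|\det A|) modes_adjacency.
rewrite !det_mulmx !normrM det_tr norm_det_adjacency EU ED det_diag mulrC.
move/(mulIf N0) => ->; rewrite normr_prod.
rewrite [RHS](reindex _ (onW_bij _ (enum_val_bij (cell n)))) /=.
by apply: eq_bigr => t _; rewrite mxE.
Qed.

Lemma norm_freq_rot (a b : nat) : (a <= b)%N -> (a <= N)%N ->
  `|freq (b - a, N - a)%N| = `|freq (a, b)|.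
Proof.
move=> ab aN; have -> : freq (a, b) = z ^+ a * freq (b - a, N - a)%N.
  rewrite /freq /= !mulrDr mulr1 -!exprD !subnKC // (prim_expr_order prim_z).
  by rewrite [RHS]addrC addrA.
by rewrite normrM normrX (prim_root_norm prim_z) expr1n mul1r.
Qed.

Lemma tilings_cube_freq :
  (tilings n)%:R ^+ 3 = \prod_(p <- generic_pairs n) `|freq p|.
Proof.
rewrite big_generic_pairs tilings_prod_freq -prodrXl.
apply: eq_bigr => x _; rewrite !big_ord_recr big_ord0 /= mul1r.
have := gapsP x; rewrite /cell_pair; case: (gaps x) => [[g1 g2] g3] /= [g1p g12 g13 gN].
have -> : `|freq (g3, g3 + g1)%N| = `|freq (g2, g2 + g3)%N|.
  by rewrite -(norm_freq_rot (a := g2) (b := g2 + g3)); [congr (`|freq (_, _)|); lia|lia|lia].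
have -> : `|freq (g2, g2 + g3)%N| = `|freq (g1, g1 + g2)%N|.
  by rewrite -(norm_freq_rot (a := g1) (b := g1 + g2)); [congr (`|freq (_, _)|); lia|lia|lia].
by rewrite !exprS expr0 mulr1 mulrA.
Qed.

End Spectrum.

(** * Unit-closed families *)

Section Cyc.
Variable F : numFieldType.
Local Notation intrp := (map_poly (intr : int -> F)).

Lemma cyclotomic_intr (n : nat) (z : F) :
  n.-primitive_root z -> intrp 'Phi_n = cyclotomic z n.
Proof.
elim/ltn_ind: n z => n IHn z prim_z; have n_gt0 := prim_order_gt0 prim_z.
have [_ _ inDn] := divisors_correct n_gt0.
have uDn := divisors_uniq n.
have nzq : \prod_(d <- rem n (divisors n)) intrp 'Phi_d != 0.
  rewrite monic_neq0 // monic_prod // => d _.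
  by rewrite monic_map // Cyclotomic_monic.
apply: (mulIf nzq).
transitivity ('X^n - 1 : {poly F}).
  have <- : intrp ('X^n - 1) = 'X^n - 1 by rewrite rmorphB /= map_polyXn rmorph1.
  by rewrite -prod_Cyclotomic // rmorph_prod [RHS](big_rem n) ?inDn //=.
rewrite (prod_cyclotomic prim_z) (big_rem n) ?inDn //= divnn n_gt0 expr1.
congr (_ * _); apply: eq_big_seq => d.
rewrite mem_rem_uniq ?inE //= inDn => /andP[n'd ddvn].
by rewrite -IHn ?dvdn_prim_root // ltn_neqAle n'd dvdn_leq.
Qed.

(* Reduce [c] modulo the cyclotomic polynomial: the remainder has fewer
   coefficients than there are conjugates, so it must be constant. *)
Lemma conj_invariant_int (n : nat) (z : F) (c : {poly int}) :
  n.-primitive_root z ->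
  (forall k, coprime k n -> (intrp c).[z ^+ k] = (intrp c).[z]) ->
  exists w : int, (intrp c).[z] = w%:~R.
Proof.
move=> prim_z inv; have n_gt0 := prim_order_gt0 prim_z.
have monPhi := Cyclotomic_monic n.
set r := Pdiv.Ring.rmodp c 'Phi_n.
have sz_r : (size r <= totient n)%N.
  by rewrite -ltnS -size_Cyclotomic Pdiv.Ring.ltn_rmodp monic_neq0.
have er k : coprime k n -> (intrp r).[z ^+ k] = (intrp c).[z].
  move=> co_k; rewrite -(inv k co_k) (Pdiv.RingMonic.rdivp_eq monPhi c).
  rewrite rmorphD rmorphM /= (cyclotomic_intr prim_z) hornerD hornerM.
  have /eqP-> : root (cyclotomic z n) (z ^+ k).
    by rewrite (root_cyclotomic prim_z) prim_root_exp_coprime.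
  by rewrite mulr0 add0r.
have e0 : intrp r - ((intrp c).[z])%:P = 0.
  pose rs := [seq z ^+ k | k : 'I_n in [pred k : 'I_n | coprime k n]].
  apply/eqP; apply: contraT => /max_poly_roots H.
  have szrs : size rs = totient n.
    rewrite size_image totient_count_coprime big_mkord -sum1_card.
    rewrite big_mkcond /=; apply: eq_bigr => k _.
    by rewrite inE coprime_sym; case: coprime.
  suff : (size rs < totient n)%N by rewrite szrs ltnn.
  apply: leq_trans (H rs _ _) _.
  - apply/allP=> _ /imageP[k co_k ->]; rewrite /root hornerD hornerN hornerC.
    by rewrite er // subrr.
  - rewrite map_inj_uniq ?enum_uniq // => i j /eqP.
    rewrite (eq_prim_root_expr prim_z) !modn_small ?ltn_ord // => /eqP.
    exact: val_inj.
  - apply: leq_trans (size_polyD _ _) _; rewrite geq_max size_polyN.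
    rewrite (leq_trans (size_poly _ _) sz_r) /=.
    by rewrite (leq_trans (size_polyC_leq1 _)) // totient_gt0.
exists r`_0; move/eqP: e0; rewrite subr_eq0 => /eqP/(congr1 (coefp 0)).
by rewrite /= coefC eqxx coef_map /= => ->.
Qed.

End Cyc.

Section Closed.
Variables (F : numFieldType) (p : nat) (z : F).
Hypothesis prim_z : p.+2.-primitive_root z.
Local Notation Z := 'I_p.+2.
Local Notation intrp := (map_poly (intr : int -> F)).

Definition scale_set (k : Z) (T : {set Z}) : {set Z} := [set k * j | j in T].

Definition unit_closed (S : {set {set Z}}) : Prop :=
  forall k T, k \is a GRing.unit -> T \in S -> scale_set k T \in S.

Definition root_sum (T : {set Z}) : F := \sum_(j in T) z ^+ (j : nat).

Lemma scale_set_inj k : k \is a GRing.unit -> injective (scale_set k).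
Proof. by move=> uk; apply: imset_inj; apply: mulrI. Qed.

Lemma scale_setM k l T : scale_set k (scale_set l T) = scale_set (k * l) T.
Proof. by rewrite /scale_set -imset_comp; apply: eq_imset => j /=; rewrite mulrA. Qed.

Lemma scale_set1 T : scale_set 1 T = T.
Proof. by rewrite /scale_set (eq_imset _ (@mul1r _)) imset_id. Qed.

(** [G] is the product with an indeterminate in place of [z]. Evaluating it at another primitive
    root permutes the factors by scaling, so every coefficient is invariant under conjugation and
    [conj_invariant_int] applies. *)
Lemma unit_closed_prod_int (S : {set {set Z}}) : unit_closed S ->
  exists q : {poly int}, intrp q = \prod_(T in S) ('X + (root_sum T)%:P).
Proof.
move=> cS.
pose G : {poly {poly int}} :=
  \prod_(T in S) ('X + (\sum_(j in T) 'X^(nat_of_ord j))%:P).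
pose ev k (c : {poly int}) : F := (intrp c).[z ^+ k].
have evG k : map_poly (ev k) G =
    \prod_(T in S) ('X + (\sum_(j in T) z ^+ (k * j)%N)%:P).
  have -> : map_poly (ev k) G =
      map_poly (horner_eval (z ^+ k) \o intrp) G by [].
  rewrite rmorph_prod /=; apply: eq_bigr => T _.
  rewrite rmorphD /= map_polyX map_polyC /=; congr (_ + _%:P).
  rewrite /= rmorph_sum /= rmorph_sum; apply: eq_bigr => j _ /=.
  by rewrite map_polyXn /horner_eval hornerXn exprM.
have inv i k : coprime k p.+2 -> ev k G`_i = ev 1 G`_i.
  move=> co_k; have coefG l : ev l G`_i = (map_poly (ev l) G)`_i.
    by rewrite coef_map_id0 // /ev rmorph0 horner0.
  rewrite !{}coefG !evG; congr (polyseq _)`_i.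
  have uk : (k%:R : Z) \is a GRing.unit.
    by move: (@unitZpE p.+2 k isT); rewrite coprime_sym co_k.
  apply/esym; rewrite (reindex_inj (scale_set_inj uk)) /=; apply/esym.
  transitivity (\prod_(T | scale_set k%:R T \in S)
      ('X + (\sum_(j in scale_set k%:R T) z ^+ (1 * j)%N)%:P)); last by [].
  apply: eq_big => [T | T _].
    apply/idP/idP; first exact: cS.
    move/(cS (k%:R)^-1); rewrite scale_setM mulVr // scale_set1 unitrV.
    exact.
  rewrite big_imset /=; last by move=> ? ? _ _; apply: mulrI.
  congr (_ + _%:P); apply: eq_bigr => j _; rewrite mul1n.
  by rewrite /= (val_Zp_nat (p := p.+2)) // modnMml (prim_expr_mod prim_z).
have /fin_all_exists[w wE] (i : 'I_(size G)) : exists w : int, ev 1 G`_i = w%:~R.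
  rewrite /ev expr1; apply: (conj_invariant_int prim_z) => k co_k.
  by rewrite -[z in RHS]expr1; apply: inv.
(* [insub] only extends [w] from ordinals to naturals; the 0 is never reached below [size G]. *)
exists (\poly_(i < size G) (if insub i is Some j then w j else 0)); rewrite (_ : \prod_(T in S) _ = map_poly (ev 1) G).
  apply/polyP=> i; rewrite coef_map_id0 // coef_poly.
  rewrite coef_map_id0; last by rewrite /ev rmorph0 horner0.
  case: ltnP => szG; first by rewrite insubT -wE.
  by have -> : G`_i = 0 by [rewrite nth_default]; rewrite mulr0z /ev rmorph0 horner0.
rewrite evG; apply: eq_bigr => T _; congr (_ + _%:P).
by apply: eq_bigr => j _; rewrite mul1n.
Qed.

Lemma unit_closed_factor (S : {set {set Z}}) : unit_closed S ->
  exists s : seq {poly int},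
    intrp (\prod_(q <- s) q) = \prod_(T in S) ('X + (root_sum T)%:P) /\
    forall q, q \in s -> exists O : {set {set Z}},
      [/\ O \subset S, (#|O| <= totient p.+2)%N &
          intrp q = \prod_(T in O) ('X + (root_sum T)%:P)].
Proof.
have [m] := ubnP #|S|; elim: m S => // m IH S /ltnSE leS cS.
have [->|[T TS]] := set_0Vmem S.
  by exists [::]; rewrite !big_nil big_set0 rmorph1; split.
pose O : {set {set Z}} := [set scale_set k T | k in [pred k : Z | k \is a GRing.unit]].
have cO : unit_closed O.
  move=> k _ uk /imsetP[l ul ->]; rewrite scale_setM.
  by apply/imsetP; exists (k * l) => //; rewrite inE unitrM uk.
have OS : O \subset S by apply/subsetP => _ /imsetP[k uk ->]; apply: cS.
have TO : T \in O.
  by apply/imsetP; exists 1; [rewrite inE unitr1 | rewrite scale_set1].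
have cD : unit_closed (S :\: O).
  move=> k U uk; rewrite !inE => /andP[UO US]; rewrite cS // andbT.
  apply: contra UO => /(cO k^-1); rewrite unitrV scale_setM mulVr // scale_set1.
  exact.
have [|s [sE sO]] := IH (S :\: O) _ cD.
  apply: leq_trans leS; apply: proper_card; apply/properP; split.
    exact: subsetDl.
  by exists T => //; rewrite inE TO.
have [q qE] := unit_closed_prod_int cO.
exists (q :: s); split.
  rewrite big_cons rmorphM /= qE sE [RHS](bigID (mem O)) /=; congr (_ * _).
    by apply: eq_bigl => U; rewrite andbC; case: (boolP (U \in O)) => //= /(subsetP OS).
  by apply: eq_bigl => U; rewrite !inE andbC.
move=> r; rewrite inE => /predU1P[-> | /sO[O' [O'S cardO' rE]]].
  exists O; split=> //; apply: leq_trans (leq_imset_card _ _) _.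
  rewrite -(@card_units_Zp p.+2) // /units_Zp.
  rewrite cardsT -(card_image val_inj) subset_leq_card //.
  apply/subsetP => k; rewrite !inE => uk; apply/imageP.
  by exists (FinRing.unit Z uk).
exists O'; split=> //; apply: subset_trans O'S _; exact: subsetDl.
Qed.

End Closed.

(** * Frequency pairs as two-element sets of residues *)

Section PairSets.
Variable n : nat.
Local Notation N := (3 * n + 3)%N.
Local Notation Z := 'I_((3 * n).+1.+2).

Definition pair_set (p : nat * nat) : {set Z} := [set inord p.1; inord p.2].

(* The pairs of nonzero residues modulo [N] that are not contained in the
   subgroup of order 3. *)
Definition pair_sets : {set {set Z}} :=
  [set T : {set Z} | [&& #|T| == 2, 0 \notin T & [exists j in T, j *+ 3 != 0]]].

Let valE (a : nat) : (a < N)%N -> (inord a : Z) = a :> nat.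
Proof. by move=> aN; rewrite inordK //; lia. Qed.

Let triple_eq0 (j : Z) : (j *+ 3 == 0) = (N %| 3 * j)%N.
Proof.
rewrite Zp_mulrn -val_eqE /= /dvdn addn3.
by rewrite (mulnC 3 (nat_of_ord j)).
Qed.

Lemma pair_sets_unit_closed : unit_closed pair_sets.
Proof.
move=> k T uk; rewrite !inE => /and3P[cT T0 /exists_inP[j jT j3]].
rewrite /scale_set card_imset; last exact: mulrI.
apply/and3P; split=> //.
  apply: contra T0 => /imsetP[i iT /esym/eqP].
  by rewrite mulrI_eq0 => [/eqP <-//|]; apply: mulrI.
apply/exists_inP; exists (k * j); first exact: imset_f.
by rewrite -mulrnAr mulrI_eq0 //; apply: mulrI.
Qed.

Lemma pair_set_inj p p' : generic_pair n p -> generic_pair n p' ->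
  pair_set p = pair_set p' -> p = p'.
Proof.
case: p p' => a b [a' b'] /and4P[/= a0 ab bN _] /and4P[/= a0' ab' bN' _] /setP E.
have mem (c : nat) : (c < N)%N -> (c == a) || (c == b) = (c == a') || (c == b').
  move=> cN; have := E (inord c).
  by rewrite /pair_set !inE -!val_eqE /= !valE //; lia.
have := mem a; have := mem b; have := mem a'; have := mem b'.
by move=> h1 h2 h3 h4; congr (_, _); lia.
Qed.

Lemma mem_pair_set p : generic_pair n p -> pair_set p \in pair_sets.
Proof.
case: p => a b /and4P[/= a0 ab bN ne]; rewrite inE /pair_set /=.
have aN : (a < N)%N by lia.
rewrite cards2 -val_eqE /= !valE // neq_ltn ab /= !inE -!val_eqE /= !valE //.
apply/andP; split; first by lia.
apply/existsP; have [d3|nd3] := boolP (N %| 3 * a)%N; [exists (inord b)|exists (inord a)];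
  rewrite !inE eqxx ?orbT /= triple_eq0 valE //.
(* If both entries lie in the subgroup of order 3, they are its two nonzero elements in increasing
   order: the excluded pair. *)
have [u Eu] : exists u, (3 * a = u * N)%N by apply/dvdnP.
apply/negP => /dvdnP[v Ev]; case/negP: ne; rewrite xpair_eqE.
have N0 : (0 < N)%N by lia.
have uv : (u < v)%N by rewrite -(ltn_pmul2r N0) -Eu -Ev; lia.
have v3 : (v < 3)%N by rewrite -(ltn_pmul2r N0) -Ev; lia.
have u0 : (0 < u)%N by rewrite -(ltn_pmul2r N0) -Eu; lia.
have [u1 v2] : u = 1%N /\ v = 2%N by lia.
by move: Eu Ev; rewrite u1 v2; lia.
Qed.

Lemma pair_sets_surj T : T \in pair_sets -> exists2 p, generic_pair n p & T = pair_set p.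
Proof.
rewrite inE => /and3P[/cards2P[x [y [xy ET]]] T0 /exists_inP[j jT j3]].
wlog lt_xy : x y xy ET / (x < y)%N.
  move=> W; have [/W|/W|/val_inj E] := ltngtP x y; first exact.
  - by apply; [rewrite eq_sym | rewrite setUC].
  - by rewrite E eqxx in xy.
exists (nat_of_ord x, nat_of_ord y); last by rewrite /pair_set /= !inord_val.
have yN := ltn_ord y; move: T0 jT j3; rewrite ET !inE triple_eq0 -!val_eqE /= => x0y0 jxy nd.
rewrite /generic_pair xpair_eqE /=.
apply/and4P; split; try lia.
apply/negP => /andP[/eqP Ex /eqP Ey]; case/negP: nd.
by case/orP: jxy => /eqP ->; rewrite ?Ex ?Ey; apply/dvdnP; [exists 1%N|exists 2%N]; lia.
Qed.

Lemma big_pair_sets (R : Type) (idx : R) (op : Monoid.com_law idx) (G : {set Z} -> R) :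
  \big[op/idx]_(T in pair_sets) G T = \big[op/idx]_(p <- generic_pairs n) G (pair_set p).
Proof.
rewrite -big_enum /= -(big_map pair_set xpredT G); apply: perm_big.
apply: uniq_perm; first exact: enum_uniq.
  rewrite map_inj_in_uniq ?generic_pairs_uniq // => p p'.
  by rewrite !mem_generic_pairs; apply: pair_set_inj.
move=> T; rewrite mem_enum; apply/idP/mapP.
  by case/pair_sets_surj => p gp ->; exists p; rewrite ?mem_generic_pairs.
by case=> p; rewrite mem_generic_pairs => gp ->; apply: mem_pair_set.
Qed.

Lemma root_sum_pair_set (F : numFieldType) (z : F) p : generic_pair n p ->
  root_sum z (pair_set p) = z ^+ p.1 + z ^+ p.2.
Proof.
case: p => a b /and4P[/= a0 ab bN ne]; have aN : (a < N)%N by lia.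
by rewrite /root_sum /pair_set big_setU1 ?big_set1 /= ?valE // inE -val_eqE /= !valE // neq_ltn ab.
Qed.

(** Units modulo [N] are prime to 3, as are exactly two residues out of three. *)
Lemma totient_le : (totient N <= 2 * n + 2)%N.
Proof.
have -> : N = (3 * n.+1)%N by lia.
have -> : (2 * n + 2 = 2 * n.+1)%N by lia.
rewrite totient_count_coprime.
have <- : (\sum_(0 <= d < 3 * n.+1) ~~ (3 %| d) = 2 * n.+1)%N.
  elim: (n.+1) => [|k IH]; first by rewrite muln0 big_geq.
  have -> : (3 * k.+1 = (3 * k).+3)%N by lia.
  by rewrite !big_nat_recr //= IH; lia.
apply: leq_sum => d _; case: (boolP (3 %| d)%N) => //= d3; last by case: coprime.
case: (boolP (coprime _ _)) => // /eqP co.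
have : (3 %| gcdn (3 * n.+1) d)%N by rewrite dvdn_gcd d3 dvdn_mulr.
by rewrite co.
Qed.

End PairSets.

Section Factors.
Variables (C : numClosedFieldType) (n : nat) (z : C).
Local Notation N := (3 * n + 3)%N.
Hypothesis prim_z : N.-primitive_root z.
Local Notation intrp := (map_poly (intr : int -> C)).

Let prim_z' : (3 * n).+1.+2.-primitive_root z.
Proof. by rewrite -addn3. Qed.

Lemma big_pair_sets_poly :
  \prod_(T in pair_sets n) ('X + (root_sum z T)%:P) =
  \prod_(p <- generic_pairs n) ('X + (z ^+ p.1 + z ^+ p.2)%:P).
Proof.
rewrite big_pair_sets; apply: eq_big_seq => p; rewrite mem_generic_pairs => gp.
by rewrite root_sum_pair_set.
Qed.

Lemma norm_freq_le p : `|freq z p| <= 3.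
Proof.
rewrite /freq (le_trans (ler_normD _ _)) //.
rewrite (le_trans (lerD (ler_normD _ _) (lexx _))) //.
by rewrite normr1 !normrX !(prim_root_norm prim_z) !expr1n (_ : 1 + 1 + 1 = 3) //; ring.
Qed.

Lemma generic_factors : exists s : seq {poly int},
  intrp (\prod_(q <- s) q) = \prod_(p <- generic_pairs n) ('X + (z ^+ p.1 + z ^+ p.2)%:P) /\
  forall q, q \in s -> ((size q).-1 <= 2 * n + 2)%N /\ `|(intrp q).[1]| <= 3 ^+ (2 * n + 2).
Proof.
have [s [sE sO]] := unit_closed_factor prim_z' (@pair_sets_unit_closed n).
exists s; split; first by rewrite sE big_pair_sets_poly.
move=> q /sO[O [OS cardO qE]].
have {}cardO : (#|O| <= 2 * n + 2)%N by apply: leq_trans cardO _; rewrite -addn3 totient_le.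
split.
  rewrite -(size_map_inj_poly (f := intr : int -> C)) //; last exact: intr_inj.
  rewrite qE -big_enum /=.
  under eq_bigr do rewrite -[root_sum _ _]opprK polyCN.
  by rewrite size_prod_XsubC /= -cardE.
rewrite qE horner_prod normr_prod; apply: le_trans (_ : 3 ^+ #|O| <= _); last first.
  by rewrite ler_weXn2l // ler1n.
rewrite -prodr_const; apply: ler_prod => T TO; rewrite normr_ge0 /=.
have [p gp ->] := pair_sets_surj (subsetP OS _ TO).
by rewrite !hornerE root_sum_pair_set // addrA norm_freq_le.
Qed.

Lemma subgroup_factor (m d : nat) : n.+1 = (d * m.+1)%N ->
  exists r : int, \prod_(p <- generic_pairs n) freq z p =
    r%:~R * \prod_(p <- generic_pairs m) freq (z ^+ d) p.
Proof.
move=> E; have d0 : (0 < d)%N by lia.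
have dN : (d %| (3 * n).+3)%N by apply/dvdnP; exists (3 * m.+1)%N; lia.
(* [S1] is the image of the pairs of [m] under multiplication by [d]; the cofactor [r] is the value
   at 1 of the integral polynomial of the complement. *)
pose S1 := [set T in pair_sets n | [forall j in T, d %| (j : nat)]]%N.
have cS1 : unit_closed S1.
  move=> k T uk /setIdP[TS /forall_inP Td]; apply/setIdP; split.
    exact: pair_sets_unit_closed.
  apply/forall_inP => _ /imsetP[j jT ->] /=.
  by rewrite /dvdn modn_dvdm // -/(dvdn _ _) dvdn_mull // Td.
have cD : unit_closed (pair_sets n :\: S1).
  move=> k T uk /setDP[TS nT]; apply/setDP; split; first exact: pair_sets_unit_closed.
  apply: contra nT => kT.
  have := cS1 k^-1 (scale_set k T); rewrite unitrV => /(_ uk kT).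
  by rewrite scale_setM mulVr // scale_set1.
have [q qE] := unit_closed_prod_int prim_z' cD.
exists q.[1].
have -> : \prod_(p <- generic_pairs n) freq z p = \prod_(T in pair_sets n) (1 + root_sum z T).
  rewrite big_pair_sets; apply: eq_big_seq => p; rewrite mem_generic_pairs => gp.
  by rewrite root_sum_pair_set // addrA.
rewrite (bigID (mem S1)) /= mulrC; congr (_ * _).
  have -> : (q.[1])%:~R = (intrp q).[1] :> C by rewrite -[1 in RHS](rmorph1 intr) horner_map.
  rewrite qE horner_prod; apply: eq_big => [T|T _]; first by rewrite in_setD andbC.
  by rewrite !hornerE.
transitivity (\prod_(T in S1) (1 + root_sum z T)).
  by apply: eq_bigl => T; rewrite andbC; case: (boolP (T \in S1)) => // /setIdP[->].
rewrite -big_enum /=.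
pose dp (p : nat * nat) : nat * nat := (d * p.1, d * p.2)%N.
have gdp p : generic_pair m p -> generic_pair n (dp p).
  case: p => a b; rewrite /generic_pair /dp /= !xpair_eqE => /and4P[a0 ab bN ne].
  have -> : (3 * n + 3 = d * (3 * m + 3))%N by lia.
  rewrite muln_gt0 d0 a0 !ltn_pmul2l // ab bN /=.
  apply: contra ne => /andP[/eqP e1 /eqP e2].
  have -> : a = (m + 1)%N by apply/eqP; rewrite -(eqn_pmul2l d0); lia.
  by rewrite eqxx /= -(eqn_pmul2l d0); lia.
transitivity (\prod_(T <- [seq pair_set n (dp p) | p <- generic_pairs m]) (1 + root_sum z T)).
  apply: perm_big; apply: uniq_perm; first exact: enum_uniq.
    rewrite map_inj_in_uniq ?generic_pairs_uniq // => p p'.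
    rewrite !mem_generic_pairs => gp gp' /pair_set_inj; move/(_ (gdp _ gp) (gdp _ gp')).
    case: p p' {gp gp'} => a b [a' b'] [/eqP + /eqP +].
    by rewrite !eqn_pmul2l // => /eqP -> /eqP ->.
  move=> T; rewrite mem_enum; apply/setIdP/mapP.
    case=> /pair_sets_surj[[a b] gp ->] /forall_inP Td.
    have aN : (a < (3 * n).+1.+2)%N by move: gp => /and4P[/=]; lia.
    have bN : (b < (3 * n).+1.+2)%N by move: gp => /and4P[/=]; lia.
    have := Td (inord a); rewrite !inE eqxx inordK // => /(_ isT) /dvdnP[a' Ea].
    have := Td (inord b); rewrite !inE eqxx orbT inordK // => /(_ isT) /dvdnP[b' Eb].
    exists (a', b'); last by rewrite /dp /= Ea Eb !(mulnC d).
    rewrite mem_generic_pairs; move: gp; rewrite /generic_pair !xpair_eqE /= Ea Eb.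
    have -> : (3 * n + 3 = (3 * m + 3) * d)%N by lia.
    rewrite muln_gt0 d0 !ltn_pmul2r // andbT => /and4P[-> -> -> ne] /=.
    apply: contra ne => /andP[/eqP -> /eqP ->]; apply/andP; split; lia.
  case=> p; rewrite mem_generic_pairs => gp ->; split; first exact/mem_pair_set/gdp.
  apply/forall_inP => j; have /and4P[/= _ h1 h2 _] := gdp p gp.
  by rewrite !inE => /orP[] /eqP -> /=; rewrite inordK ?dvdn_mulr //; lia.
rewrite big_map; apply: eq_big_seq => p; rewrite mem_generic_pairs => gp.
by rewrite root_sum_pair_set ?gdp // /freq /= !exprM addrA.
Qed.

End Factors.

(** * Numerical bounds *)

From mathcomp Require Import all_classical all_reals all_analysis.
From mathcomp Require Import complex.

Import numFieldNormedType.Exports.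
Local Open Scope classical_set_scope.
Local Open Scope ring_scope.

Section Numerics.
Variable R : realType.
Implicit Types x y : R.

(** Each Taylor bound below is obtained from the preceding one by this comparison of derivatives. *)
Lemma le_of_is_derive (f g df dg : R -> R) x : 0 <= x ->
  (forall t, 0 <= t <= x -> is_derive t 1 f (df t)) ->
  (forall t, 0 <= t <= x -> is_derive t 1 g (dg t)) ->
  (forall t, 0 <= t <= x -> df t <= dg t) -> f 0 <= g 0 -> f x <= g x.
Proof.
move=> x0 Hf Hg le_d le0.
have [||c cx E] := @MVT_segment R (g \- f) (fun t => dg t - df t) 0 x x0.
- by move=> t /subset_itv_oo_cc; rewrite in_itv /= => tx; apply: is_deriveB; [apply: Hg | apply: Hf].
- apply: derivable_within_continuous => t; rewrite in_itv /= => tx.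
  by apply: derivableB; [case: (Hg t tx) | case: (Hf t tx)].
have : 0 <= (g x - f x) - (g 0 - f 0).
  rewrite -[leRHS]/((g \- f) x - (g \- f) 0) E subr0 mulr_ge0 // subr_ge0.
  by apply: le_d; move: cx; rewrite in_itv.
lra.
Qed.

Lemma sin_le_id x : 0 <= x -> sin x <= x.
Proof.
move=> x0; apply: (le_of_is_derive (g := id) (df := cos) (dg := fun=> 1)) => //.
by rewrite sin0.
Qed.

Lemma is_derive_poly_eq (p : {poly R}) (f : R -> R) (d x : R) :
  (forall t, f t = p.[t]) -> p^`().[x] = d -> is_derive x 1 f d.
Proof. by move=> /funext -> <-; apply: is_derive_poly. Qed.

Lemma cos_ge2 x : 0 <= x -> 1 - x ^+ 2 / 2 <= cos x.
Proof.
move=> x0; set f := fun x : R => 1 - x ^+ 2 / 2; set df := fun x : R => - (x).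
assert (D : forall t, 0 <= t <= x -> is_derive t 1 f (df t)).
  move=> t _; apply: (@is_derive_poly_eq (1 - 2^-1 *: 'X^2)) => [y|].
    by rewrite !hornerE /f /=; lra.
  by rewrite !poly.derivE !hornerE /df /=; lra.
apply: (le_of_is_derive x0 (dg := fun x => - sin x) D _) => [t /andP[t0 _]|].
  by rewrite lerN2 sin_le_id.
by rewrite /f cos0; lra.
Qed.

Lemma sin_ge3 x : 0 <= x -> x - x ^+ 3 / 6 <= sin x.
Proof.
move=> x0; set f := fun x : R => x - x ^+ 3 / 6; set df := fun x : R => 1 - x ^+ 2 / 2.
assert (D : forall t, 0 <= t <= x -> is_derive t 1 f (df t)).
  move=> t _; apply: (@is_derive_poly_eq ('X - 6^-1 *: 'X^3)) => [y|].
    by rewrite !hornerE /f /=; lra.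
  by rewrite !poly.derivE !hornerE /df /=; lra.
apply: (le_of_is_derive x0 (dg := fun x => cos x) D _) => [t /andP[t0 _]|].
  by rewrite cos_ge2.
by rewrite /f sin0; lra.
Qed.

Lemma cos_le4 x : 0 <= x -> cos x <= 1 - x ^+ 2 / 2 + x ^+ 4 / 24.
Proof.
move=> x0; set f := fun x : R => 1 - x ^+ 2 / 2 + x ^+ 4 / 24; set df := fun x : R => - (x - x ^+ 3 / 6).
assert (D : forall t, 0 <= t <= x -> is_derive t 1 f (df t)).
  move=> t _; apply: (@is_derive_poly_eq (1 - 2^-1 *: 'X^2 + 24^-1 *: 'X^4)) => [y|].
    by rewrite !hornerE /f /=; lra.
  by rewrite !poly.derivE !hornerE /df /=; lra.
apply: (le_of_is_derive x0 (df := fun x => - sin x) _ D) => [t /andP[t0 _]|].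
  by rewrite lerN2 sin_ge3.
by rewrite /f cos0; lra.
Qed.

Lemma sin_le5 x : 0 <= x -> sin x <= x - x ^+ 3 / 6 + x ^+ 5 / 120.
Proof.
move=> x0; set f := fun x : R => x - x ^+ 3 / 6 + x ^+ 5 / 120; set df := fun x : R => 1 - x ^+ 2 / 2 + x ^+ 4 / 24.
assert (D : forall t, 0 <= t <= x -> is_derive t 1 f (df t)).
  move=> t _; apply: (@is_derive_poly_eq ('X - 6^-1 *: 'X^3 + 120^-1 *: 'X^5)) => [y|].
    by rewrite !hornerE /f /=; lra.
  by rewrite !poly.derivE !hornerE /df /=; lra.
apply: (le_of_is_derive x0 (df := fun x => cos x) _ D) => [t /andP[t0 _]|].
  by rewrite cos_le4.
by rewrite /f sin0; lra.
Qed.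

Lemma cos_ge6 x : 0 <= x -> 1 - x ^+ 2 / 2 + x ^+ 4 / 24 - x ^+ 6 / 720 <= cos x.
Proof.
move=> x0; set f := fun x : R => 1 - x ^+ 2 / 2 + x ^+ 4 / 24 - x ^+ 6 / 720; set df := fun x : R => - (x - x ^+ 3 / 6 + x ^+ 5 / 120).
assert (D : forall t, 0 <= t <= x -> is_derive t 1 f (df t)).
  move=> t _; apply: (@is_derive_poly_eq (1 - 2^-1 *: 'X^2 + 24^-1 *: 'X^4 - 720^-1 *: 'X^6)) => [y|].
    by rewrite !hornerE /f /=; lra.
  by rewrite !poly.derivE !hornerE /df /=; lra.
apply: (le_of_is_derive x0 (dg := fun x => - sin x) D _) => [t /andP[t0 _]|].
  by rewrite lerN2 sin_le5.
by rewrite /f cos0; lra.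
Qed.

Lemma sin_ge7 x : 0 <= x -> x - x ^+ 3 / 6 + x ^+ 5 / 120 - x ^+ 7 / 5040 <= sin x.
Proof.
move=> x0; set f := fun x : R => x - x ^+ 3 / 6 + x ^+ 5 / 120 - x ^+ 7 / 5040; set df := fun x : R => 1 - x ^+ 2 / 2 + x ^+ 4 / 24 - x ^+ 6 / 720.
assert (D : forall t, 0 <= t <= x -> is_derive t 1 f (df t)).
  move=> t _; apply: (@is_derive_poly_eq ('X - 6^-1 *: 'X^3 + 120^-1 *: 'X^5 - 5040^-1 *: 'X^7)) => [y|].
    by rewrite !hornerE /f /=; lra.
  by rewrite !poly.derivE !hornerE /df /=; lra.
apply: (le_of_is_derive x0 (dg := fun x => cos x) D _) => [t /andP[t0 _]|].
  by rewrite cos_ge6.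
by rewrite /f sin0; lra.
Qed.

(** Tripling the angle gives cos pi = -1, that is (c + 1)(2c - 1)^2 = 0 for the cosine c, which is
    positive. *)
Lemma cos_pithird : cos (pi / 3) = 2^-1 :> R.
Proof.
have pi0 := @pi_gt0 R.
have c0 : 0 < cos (pi / 3 : R).
  by apply: cos_gt0_pihalf; apply/andP; split; lra.
have : cos (pi / 3 + (pi / 3) *+ 2) = -1 :> R by rewrite -mulrS -[_ *+ 3]mulr_natr mulfVK ?pnatr_eq0 // cospi.
rewrite cosD cos_mulr2n sin_mulr2n; have := cos2Dsin2 (pi / 3 : R).
set c := cos _ in c0 *; set s := sin _ => E1 E2.
have : (c + 1) * (2 * c - 1) ^+ 2 = 0.
  have {E1} E1 : s ^+ 2 = 1 - c ^+ 2 by rewrite -E1; ring.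
  have <- : c * (c ^+ 2 *+ 2 - 1) - s * (c * s *+ 2) + 1 = 0 by rewrite E2; ring.
  have -> : s * (c * s *+ 2) = 2 * c * s ^+ 2 by ring.
  by rewrite E1; ring.
move/eqP; rewrite mulf_eq0 => /orP[/eqP|]; first lra.
by rewrite sqrf_eq0 => /eqP; lra.
Qed.

Lemma sin_pithird : sin (pi / 3) = Num.sqrt 3 / 2 :> R.
Proof.
have pi0 := @pi_gt0 R.
have s0 : 0 < sin (pi / 3 : R) by apply: sin_gt0_pi; apply/andP; split; lra.
have E : sin (pi / 3 : R) ^+ 2 = (Num.sqrt 3 / 2) ^+ 2.
  by rewrite expr_div_n sqr_sqrtr // sin2cos2 cos_pithird; field.
by apply/eqP; rewrite -(eqrXn2 (n := 2)) ?E ?(ltW s0) ?divr_ge0 ?sqrtr_ge0.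
Qed.

Lemma sin_pisixth : sin (pi / 6) = 2^-1 :> R.
Proof. by rewrite -cos_pithird -cosBpihalf -cosN; congr cos; field. Qed.

(** At 355/678, a sixth of the bound, the Taylor minorant of sine already exceeds 1/2 = sin (pi /
    6). The lower bound on pi is obtained likewise at 1043/1992. *)
Lemma pi_lt : pi < 355 / 113 :> R.
Proof.
have pi0 := @pi_gt0 R; rewrite ltNge; apply/negP => H.
have : sin (355 / 678) <= 2^-1 :> R.
  rewrite -sin_pisixth leNgt ltr_sin ?in_itv /= -?leNgt; lra.
rewrite leNgt => /negP; apply; apply: lt_le_trans (sin_ge7 _); lra.
Qed.

Lemma pi_gt : 1043 / 332 < pi :> R.
Proof.
have pi2 := @pi_ge2 R; rewrite ltNge; apply/negP => H.
have : 2^-1 <= sin (1043 / 1992) :> R.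
  rewrite -sin_pisixth leNgt ltr_sin ?in_itv /= -?leNgt; lra.
rewrite leNgt => /negP; apply; apply: le_lt_trans (sin_le5 _) _; lra.
Qed.

Lemma expR_ge2 x : 0 <= x -> 1 + x + x ^+ 2 / 2 <= expR x.
Proof.
move=> x0; set f := fun x : R => 1 + x + x ^+ 2 / 2; set df := fun x : R => 1 + x.
assert (D : forall t, 0 <= t <= x -> is_derive t 1 f (df t)).
  move=> t _; apply: (@is_derive_poly_eq (1 + 'X + 2^-1 *: 'X^2)) => [y|].
    by rewrite !hornerE /f /=; lra.
  by rewrite !poly.derivE !hornerE /df /=; lra.
apply: (le_of_is_derive x0 (dg := fun x => expR x) D _) => [t /andP[t0 _]|].
  by rewrite /df expR_ge1Dx.
by rewrite /f ?oppr0 expR0; lra.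
Qed.

Lemma expR_ge3 x : 0 <= x -> 1 + x + x ^+ 2 / 2 + x ^+ 3 / 6 <= expR x.
Proof.
move=> x0; set f := fun x : R => 1 + x + x ^+ 2 / 2 + x ^+ 3 / 6; set df := fun x : R => 1 + x + x ^+ 2 / 2.
assert (D : forall t, 0 <= t <= x -> is_derive t 1 f (df t)).
  move=> t _; apply: (@is_derive_poly_eq (1 + 'X + 2^-1 *: 'X^2 + 6^-1 *: 'X^3)) => [y|].
    by rewrite !hornerE /f /=; lra.
  by rewrite !poly.derivE !hornerE /df /=; lra.
apply: (le_of_is_derive x0 (dg := fun x => expR x) D _) => [t /andP[t0 _]|].
  by rewrite /df expR_ge2.
by rewrite /f ?oppr0 expR0; lra.
Qed.

Lemma expR_ge4 x : 0 <= x -> 1 + x + x ^+ 2 / 2 + x ^+ 3 / 6 + x ^+ 4 / 24 <= expR x.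
Proof.
move=> x0; set f := fun x : R => 1 + x + x ^+ 2 / 2 + x ^+ 3 / 6 + x ^+ 4 / 24; set df := fun x : R => 1 + x + x ^+ 2 / 2 + x ^+ 3 / 6.
assert (D : forall t, 0 <= t <= x -> is_derive t 1 f (df t)).
  move=> t _; apply: (@is_derive_poly_eq (1 + 'X + 2^-1 *: 'X^2 + 6^-1 *: 'X^3 + 24^-1 *: 'X^4)) => [y|].
    by rewrite !hornerE /f /=; lra.
  by rewrite !poly.derivE !hornerE /df /=; lra.
apply: (le_of_is_derive x0 (dg := fun x => expR x) D _) => [t /andP[t0 _]|].
  by rewrite /df expR_ge3.
by rewrite /f ?oppr0 expR0; lra.
Qed.

Lemma is_derive_expRN x : is_derive x 1 (fun x : R => expR (- x)) (- expR (- x)).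
Proof.
rewrite (_ : (fun _ => _) = expR \o -%R) //; apply: is_derive_eq.
by rewrite mulrN1.
Qed.

Lemma expRN_le2 x : 0 <= x -> expR (- x) <= 1 - x + x ^+ 2 / 2.
Proof.
move=> x0; set f := fun x : R => 1 - x + x ^+ 2 / 2; set df := fun x : R => - (1 - x).
assert (D : forall t, 0 <= t <= x -> is_derive t 1 f (df t)).
  move=> t _; apply: (@is_derive_poly_eq (1 - 'X + 2^-1 *: 'X^2)) => [y|].
    by rewrite !hornerE /f /=; lra.
  by rewrite !poly.derivE !hornerE /df /=; lra.
assert (DE : forall t, 0 <= t <= x -> is_derive t 1 (fun x : R => expR (- x)) (- expR (- t))).
  by move=> t _; apply: is_derive_expRN.
apply: (le_of_is_derive x0 (df := fun x => - expR (- x)) DE D) => [t /andP[t0 _]|].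
  by rewrite /df lerN2 expR_ge1Dx.
by rewrite /f ?oppr0 expR0; lra.
Qed.

Lemma expRN_ge3 x : 0 <= x -> 1 - x + x ^+ 2 / 2 - x ^+ 3 / 6 <= expR (- x).
Proof.
move=> x0; set f := fun x : R => 1 - x + x ^+ 2 / 2 - x ^+ 3 / 6; set df := fun x : R => - (1 - x + x ^+ 2 / 2).
assert (D : forall t, 0 <= t <= x -> is_derive t 1 f (df t)).
  move=> t _; apply: (@is_derive_poly_eq (1 - 'X + 2^-1 *: 'X^2 - 6^-1 *: 'X^3)) => [y|].
    by rewrite !hornerE /f /=; lra.
  by rewrite !poly.derivE !hornerE /df /=; lra.
assert (DE : forall t, 0 <= t <= x -> is_derive t 1 (fun x : R => expR (- x)) (- expR (- t))).
  by move=> t _; apply: is_derive_expRN.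
apply: (le_of_is_derive x0 (dg := fun x => - expR (- x)) D DE) => [t /andP[t0 _]|].
  by rewrite /df lerN2 expRN_le2.
by rewrite /f ?oppr0 expR0; lra.
Qed.

Lemma expRN_le4 x : 0 <= x -> expR (- x) <= 1 - x + x ^+ 2 / 2 - x ^+ 3 / 6 + x ^+ 4 / 24.
Proof.
move=> x0; set f := fun x : R => 1 - x + x ^+ 2 / 2 - x ^+ 3 / 6 + x ^+ 4 / 24; set df := fun x : R => - (1 - x + x ^+ 2 / 2 - x ^+ 3 / 6).
assert (D : forall t, 0 <= t <= x -> is_derive t 1 f (df t)).
  move=> t _; apply: (@is_derive_poly_eq (1 - 'X + 2^-1 *: 'X^2 - 6^-1 *: 'X^3 + 24^-1 *: 'X^4)) => [y|].
    by rewrite !hornerE /f /=; lra.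
  by rewrite !poly.derivE !hornerE /df /=; lra.
assert (DE : forall t, 0 <= t <= x -> is_derive t 1 (fun x : R => expR (- x)) (- expR (- t))).
  by move=> t _; apply: is_derive_expRN.
apply: (le_of_is_derive x0 (df := fun x => - expR (- x)) DE D) => [t /andP[t0 _]|].
  by rewrite /df lerN2 expRN_ge3.
by rewrite /f ?oppr0 expR0; lra.
Qed.

Lemma expRN_ge5 x : 0 <= x -> 1 - x + x ^+ 2 / 2 - x ^+ 3 / 6 + x ^+ 4 / 24 - x ^+ 5 / 120 <= expR (- x).
Proof.
move=> x0; set f := fun x : R => 1 - x + x ^+ 2 / 2 - x ^+ 3 / 6 + x ^+ 4 / 24 - x ^+ 5 / 120; set df := fun x : R => - (1 - x + x ^+ 2 / 2 - x ^+ 3 / 6 + x ^+ 4 / 24).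
assert (D : forall t, 0 <= t <= x -> is_derive t 1 f (df t)).
  move=> t _; apply: (@is_derive_poly_eq (1 - 'X + 2^-1 *: 'X^2 - 6^-1 *: 'X^3 + 24^-1 *: 'X^4 - 120^-1 *: 'X^5)) => [y|].
    by rewrite !hornerE /f /=; lra.
  by rewrite !poly.derivE !hornerE /df /=; lra.
assert (DE : forall t, 0 <= t <= x -> is_derive t 1 (fun x : R => expR (- x)) (- expR (- t))).
  by move=> t _; apply: is_derive_expRN.
apply: (le_of_is_derive x0 (dg := fun x => - expR (- x)) D DE) => [t /andP[t0 _]|].
  by rewrite /df lerN2 expRN_le4.
by rewrite /f ?oppr0 expR0; lra.
Qed.

End Numerics.

(** * The growth constant *)

Lemma chi_m3_nat (k : nat) : chi_m3 k%:Z =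
  if (k %% 3 == 0)%N then 0 else if (k %% 3 == 1)%N then 1 else -1.
Proof. by rewrite /chi_m3 !modz_nat; case: (k %% 3)%N (ltn_pmod k (isT : (0 < 3)%N)) => [|[|[|]]]. Qed.

Lemma chi_m3_add3 (k : nat) : chi_m3 (k + 3)%N%:Z = chi_m3 k%:Z.
Proof. by rewrite !chi_m3_nat modnDr. Qed.

Lemma chi_m3_double (k : nat) : chi_m3 (2 * k)%N%:Z = - chi_m3 k%:Z.
Proof.
rewrite !chi_m3_nat -modnMmr.
by case: (k %% 3)%N (ltn_pmod k (isT : (0 < 3)%N)) => [|[|[|]]].
Qed.

Section Series.
Variable R : realType.

Definition chi_sum (n : nat) : R :=
  \sum_(1 <= k < n.+1) (chi_m3 k%:Z)%:~R * (k%:R : R) ^- 2.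

Lemma sin_chi_m3 (k : nat) :
  sin (k%:R * (2 * pi / 3)) = Num.sqrt 3 / 2 * (chi_m3 k%:Z)%:~R :> R.
Proof.
have s23 : sin (2 * pi / 3) = Num.sqrt 3 / 2 :> R.
  have -> : 2 * pi / 3 = - (pi / 3) + pi :> R by field.
  by rewrite sinDpi sinN opprK sin_pithird.
elim/ltn_ind: k => -[|[|[|k]]] IH.
- by rewrite mul0r sin0 mulr0.
- by rewrite mul1r s23 mulr1.
- have -> : 2 * (2 * pi / 3) = pi / 3 + pi :> R by field.
  by rewrite sinDpi sin_pithird mulrN1.
have -> : k.+3%:R * (2 * pi / 3) = k%:R * (2 * pi / 3) + pi *+ 2 :> R.
  by rewrite -[k.+3]addn3 natrD; field.
by rewrite sinD2pi IH 1?ltnW // -chi_m3_add3 addn3.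
Qed.

Lemma chi_sum_cvg : chi_sum @ \oo --> L2_chi_m3 R.
Proof.
suff : cvgn chi_sum by [].
have -> : chi_sum = series (fun k => (chi_m3 k.+1%:Z)%:~R * (k.+1%:R : R) ^- 2).
  by apply/funext => n; rewrite /chi_sum big_add1.
apply: normed_cvg; apply: nondecreasing_is_cvgn.
  by apply: nondecreasing_series => k _ _; apply: normr_ge0.
exists 2 => _ [n _ <-].
have H k : `|(chi_m3 k.+1%:Z)%:~R * (k.+1%:R : R) ^- 2| <= k.+1%:R ^- 2.
  have k2 : 0 <= k.+1%:R ^- 2 :> R by rewrite invr_ge0 exprn_ge0.
  rewrite normrM (ger0_norm k2) ler_piMl //.
  rewrite chi_m3_nat; case: ifP => _; first by rewrite normr0.
  by case: ifP => _; rewrite ?normr1 // mulrN1z normrN1.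
change (\sum_(0 <= k < n) `|(chi_m3 k.+1%:Z)%:~R * (k.+1%:R : R) ^- 2| <= 2).
case: n => [|n]; first by rewrite big_geq.
have : \sum_(0 <= k < n.+1) `|(chi_m3 k.+1%:Z)%:~R * (k.+1%:R : R) ^- 2| <= 2 - n.+1%:R^-1.
  elim: n => [|n IH].
    by apply: le_trans (_ : 1 <= _); [rewrite big_nat1 (le_trans (H 0)) ?expr1n ?invr1|lra].
  rewrite big_nat_recr //=; apply: le_trans (lerD IH (H n.+1)) _.
  have -> : n.+2%:R = n.+1%:R + 1 :> R by rewrite -natr1.
  have : 0 < n.+1%:R :> R by [].
  move: (n.+1%:R : R) => x x0; rewrite -subr_ge0.
  rewrite (_ : _ - _ = (x * (x + 1) ^+ 2)^-1); last by field; lra.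
  by rewrite invr_ge0 mulr_ge0 ?exprn_ge0; lra.
by move/le_trans; apply; rewrite lerBlDr lerDl invr_ge0.
Qed.

Lemma chi_sumS (n : nat) :
  chi_sum n.+1 = chi_sum n + (chi_m3 n.+1%:Z)%:~R * (n.+1%:R : R) ^- 2.
Proof. by rewrite /chi_sum big_nat_recr. Qed.

Lemma chi_sum0 : chi_sum 0 = 0. Proof. by rewrite /chi_sum big_geq. Qed.

(** Alternation subtracts twice the terms of even index, and these equal -1/4 of the terms of half
    the index by [chi_m3_double]. *)
Lemma alt_chi_sum (n : nat) :
  \sum_(k < (2 * n)%N) (-1) ^+ k * (chi_m3 k.+1%:Z)%:~R * (k.+1%:R : R) ^- 2 =
  chi_sum (2 * n)%N + chi_sum n / 2.
Proof.
elim: n => [|n IH]; first by rewrite muln0 big_ord0 !chi_sum0 mul0r addr0.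
have E : (2 * n.+1 = (2 * n).+2)%N by rewrite mulnS.
rewrite E !big_ord_recr /= IH !chi_sumS -E chi_m3_double natrM.
have S0 : (-1) ^+ (2 * n)%N = 1 :> R by rewrite exprM sqrrN !expr1n.
rewrite [(-1) ^+ _.+1]exprS S0 mulr1 mulN1r mul1r rmorphN /=.
have : 0 < n.+1%:R :> R by [].
move: (n.+1%:R : R) (_ / (2 * n).+1%:R ^+ 2) (chi_sum _) (chi_sum _) ((chi_m3 n.+1)%:~R : R) => x y u v c x0.
have : x != 0 by rewrite gt_eqF.
by move=> {}x0; field; rewrite x0.
Qed.

Lemma alt_chi_sum_cvg :
  (fun n : nat => \sum_(k < (2 * n)%N) (-1) ^+ k * (chi_m3 k.+1%:Z)%:~R * (k.+1%:R : R) ^- 2)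
     @ \oo --> 3 / 2 * L2_chi_m3 R.
Proof.
have -> : 3 / 2 * L2_chi_m3 R = L2_chi_m3 R + L2_chi_m3 R / 2 by field.
under eq_fun do rewrite alt_chi_sum.
apply: cvgD; last by apply: cvgMr_tmp; apply: chi_sum_cvg.
have H : (muln 2) @ \oo --> \oo by apply: cvg_mulnl.
exact: cvg_comp H chi_sum_cvg.
Qed.

Lemma chi_sum3 (n : nat) :
  chi_sum (3 * n)%N = \sum_(j < n) ((3 * j + 1)%:R ^- 2 - (3 * j + 2)%:R ^- 2).
Proof.
elim: n => [|n IH]; first by rewrite muln0 big_ord0 chi_sum0.
rewrite mulnS !addSn add0n !chi_sumS IH big_ord_recr /= !chi_m3_nat.
have [-> [-> ->]] : ((3 * n).+1 %% 3 = 1 /\ (3 * n).+2 %% 3 = 2 /\ (3 * n).+3 %% 3 = 0)%N by lia.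
by rewrite /= mul1r mul0r addr0 mulN1r addrA addn1 addn2.
Qed.

End Series.

Section Growth.
Variable R : realType.

(** A telescoping minorant. With u = x(x + 1) the denominators to compare are (9u + 2)^2 and 81(u^2
    + 2cu + c + c^2); c = 2/9 matches the terms in u and leaves a difference of 18. *)
Lemma chi_term_ge (x : R) : 0 <= x ->
  (x ^+ 2 + 2 / 9)^-1 / 27 - ((x + 1) ^+ 2 + 2 / 9)^-1 / 27 <=
  (3 * x + 1) ^- 2 - (3 * x + 2) ^- 2.
Proof.
move=> x0; rewrite -subr_ge0.
have p1 : 0 < x ^+ 2 + 2 / 9 by nra.
have p2 : 0 < (x + 1) ^+ 2 + 2 / 9 by nra.
have p3 : 0 < 3 * x + 1 by lra.
have p4 : 0 < 3 * x + 2 by lra.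
rewrite (_ : _ - _ = (2 * x + 1) / 27 * 18 /
  ((x ^+ 2 + 2 / 9) * ((x + 1) ^+ 2 + 2 / 9) * (3 * x + 1) ^+ 2 * (3 * x + 2) ^+ 2)).
  apply: divr_ge0; first by lra.
  by rewrite !mulr_ge0 ?exprn_ge0 //; lra.
by field; rewrite !gt_eqF; lra.
Qed.

(** The constant 27/125, slightly below 2/9, reverses the comparison once x(x + 1) exceeds about
    17.2. *)
Lemma chi_term_le (x : R) : 4 <= x ->
  (3 * x + 1) ^- 2 - (3 * x + 2) ^- 2 <=
  (x ^+ 2 + 27 / 125)^-1 / 27 - ((x + 1) ^+ 2 + 27 / 125)^-1 / 27.
Proof.
move=> x0; rewrite -subr_ge0.
have p1 : 0 < x ^+ 2 + 27 / 125 by nra.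
have p2 : 0 < (x + 1) ^+ 2 + 27 / 125 by nra.
have p3 : 0 < 3 * x + 1 by lra.
have p4 : 0 < 3 * x + 2 by lra.
rewrite (_ : _ - _ = (2 * x + 1) / 27 *
    ((3 * x + 1) ^+ 2 * (3 * x + 2) ^+ 2 - 81 * ((x ^+ 2 + 27 / 125) * ((x + 1) ^+ 2 + 27 / 125))) /
  ((x ^+ 2 + 27 / 125) * ((x + 1) ^+ 2 + 27 / 125) * (3 * x + 1) ^+ 2 * (3 * x + 2) ^+ 2)).
  apply: divr_ge0; last by rewrite !mulr_ge0 ?exprn_ge0 //; lra.
  by apply: mulr_ge0; nra.
by field; rewrite !gt_eqF; lra.
Qed.

Lemma L2_chi_m3_bounds : 668 / 855 <= L2_chi_m3 R <= 443 / 567.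
Proof.
pose S := (1 - 2 ^- 2) + (4 ^- 2 - 5 ^- 2) + (7 ^- 2 - 8 ^- 2) + (10 ^- 2 - 11 ^- 2) : R.
have S4 : chi_sum R (3 * 4)%N = S.
  rewrite chi_sum3 !big_ord_recr big_ord0 /= /S add0r.
  by rewrite mulr1n muln0 !add0n expr1n invr1.
have lo n : S + (4 ^+ 2 + 2 / 9)^-1 / 27 - ((4 + n)%:R ^+ 2 + 2 / 9)^-1 / 27 <= chi_sum R (3 * (4 + n))%N.
  elim: n => [|n IH]; first by rewrite S4 addn0; lra.
  rewrite addnS chi_sum3 big_ord_recr -chi_sum3 /=.
  have := @chi_term_ge (4 + n)%:R (ler0n _ _).
  move: (4 + n)%N IH => m IH.
  rewrite -[m.+1%:R]natr1 (natrD _ (3 * m)%N 1) (natrD _ (3 * m)%N 2) natrM; lra.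
have hi n : chi_sum R (3 * (4 + n))%N <= S + (4 ^+ 2 + 27 / 125)^-1 / 27 - ((4 + n)%:R ^+ 2 + 27 / 125)^-1 / 27.
  elim: n => [|n IH]; first by rewrite S4 addn0; lra.
  rewrite addnS chi_sum3 big_ord_recr -chi_sum3 /=.
  have := @chi_term_le (4 + n)%:R; rewrite ler_nat => /(_ isT).
  move: (4 + n)%N IH => m IH.
  rewrite -[m.+1%:R]natr1 (natrD _ (3 * m)%N 1) (natrD _ (3 * m)%N 2) natrM; lra.
have cv : (fun n => chi_sum R (3 * n)%N) @ \oo --> L2_chi_m3 R.
  have H : (muln 3) @ \oo --> \oo by apply: cvg_mulnl.
  exact: cvg_comp H (@chi_sum_cvg R).
have lim : lim ((fun n => chi_sum R (3 * n)%N) @ \oo) = L2_chi_m3 R by apply: cvg_lim.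
rewrite -lim; apply/andP; split.
  apply: limr_ge; first by apply/cvg_ex; exists (L2_chi_m3 R).
  (* From 50 on, the telescoping remainder fits in the slack of the lower bound. *)
  exists 50 => // n /= n50.
  have := lo (n - 4)%N; rewrite subnKC; last by apply: leq_trans n50.
  apply: le_trans.
  have : (n%:R ^+ 2 + 2 / 9)^-1 <= (50 ^+ 2 + 2 / 9)^-1 :> R.
    have n50' : 50 <= n%:R :> R by rewrite ler_nat.
    rewrite lef_pV2 ?posrE; nra.
  have -> : (50 ^+ 2 + 2 / 9)^-1 = 9 / 22502 :> R by field.
  have -> : (4 ^+ 2 + 2 / 9)^-1 = 9 / 146 :> R by field.
  rewrite /S; lra.
apply: limr_le; first by apply/cvg_ex; exists (L2_chi_m3 R).
exists 4 => // n /= n4.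
have := hi (n - 4)%N; rewrite subnKC // => /le_trans; apply.
have : 0 <= (n%:R ^+ 2 + 27 / 125)^-1 :> R.
  by rewrite invr_ge0 addr_ge0 ?exprn_ge0 //; lra.
have -> : (4 ^+ 2 + 27 / 125)^-1 = 125 / 2027 :> R by field.
rewrite /S; lra.
Qed.

(** Archimedes' bounds, two convergents of the continued fraction. *)
Lemma sqrt3_bounds : 265 / 153 <= Num.sqrt (3 : R) <= 1351 / 780.
Proof.
have E (x : R) : 0 <= x -> x = Num.sqrt (x ^+ 2) by move=> ?; rewrite sqrtr_sqr ger0_norm.
rewrite (E (265 / 153)) 1?(E (1351 / 780)); try lra.
by rewrite !ler_wsqrtr //; lra.
Qed.

(** The factor 4 is kept apart for [exp_growth]: short Taylor polynomials are accurate enough near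
    0.121, and the result is raised to the fourth power. *)
Lemma growth_bounds : 4 * (51 / 421) <= growth R <= 4 * (122 / 1007).
Proof.
have /andP[s1 s2] := sqrt3_bounds.
have /andP[l1 l2] := L2_chi_m3_bounds.
have p1 := @pi_gt R; have p2 := @pi_lt R.
have pi0 : 0 < 8 * pi :> R by lra.
rewrite /growth mulrAC ler_pdivlMr // ler_pdivrMr //.
have s0 : 0 <= Num.sqrt 3 :> R by lra.
have H1 : 265 / 153 * (668 / 855) <= Num.sqrt 3 * L2_chi_m3 R by apply: ler_pM; lra.
have H2 : Num.sqrt 3 * L2_chi_m3 R <= 1351 / 780 * (443 / 567) by apply: ler_pM; lra.
rewrite -mulrA; apply/andP; split; lra.
Qed.

Lemma natr16235 : 16235%:R = 3247 * 5 :> R.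
Proof. by rewrite -natrM; congr (_%:R). Qed.

Lemma exp_growth : `|expR (growth R) - 16235%:R / 10%:R ^+ 4| < (2 * 10%:R ^+ 4)^-1.
Proof.
have /andP[g1 g2] := growth_bounds.
rewrite natr16235.
have lo : 3247 * 5 / 10 ^+ 4 - (2 * 10 ^+ 4)^-1 < expR (growth R).
  apply: lt_le_trans (_ : expR (4 * (51 / 421)) <= _); last by rewrite ler_expR.
  have /(@expR_ge4 R) : 0 <= 51 / 421 :> R by rewrite divr_ge0.
  rewrite (expRM_natl 4) {g1 g2}.
  move: (expR (51 / 421)) (expR_ge0 (51 / 421 : R)) => y y0.
  set q := (X in X <= y) => yq.
  have q0 : 0 <= q by rewrite /q; clear; lra.
  by apply: lt_le_trans (lerXn2r 4 q0 y0 yq); rewrite /q; clear; lra.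
(* The upper bound is the inverse of a lower bound for the exponential of the opposite. *)
have hi : expR (growth R) < 3247 * 5 / 10 ^+ 4 + (2 * 10 ^+ 4)^-1.
  apply: le_lt_trans (_ : expR (4 * (122 / 1007)) < _); first by rewrite ler_expR.
  have /(@expRN_ge5 R) : 0 <= 122 / 1007 :> R by clear; lra.
  rewrite (expRM_natl 4) -[expR (122 / 1007)]invrK -(expRN (122 / 1007)) {g1 g2}.
  move: (expR (- _)) (expR_gt0 (- (122 / 1007) : R)) => y y0.
  set q := (X in X <= y) => yq.
  have q0 : 0 < q by rewrite /q; clear; lra.
  have : (y^-1) ^+ 4 <= (q^-1) ^+ 4.
    by apply: lerXn2r; rewrite ?nnegrE ?invr_ge0 ?lef_pV2 ?posrE ?(ltW y0) ?(ltW q0).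
  move/le_lt_trans; apply; rewrite exprVn.
  rewrite -[X in X < _]mul1r (ltr_pdivrMr _ _ (exprn_gt0 4 q0)) /q {yq q0 q}.
  lra.
rewrite ltr_norml; apply/andP; split; lra.
Qed.

End Growth.

(** * Riemann sums *)

Section Riemann.
Variable R : realType.
Implicit Types (t r : R) (K : nat).

(** Real part of the finite geometric sum of e^(it) (-r e^(it))^k, multiplied by |1 + r
    e^(it)|^2. *)
Lemma poisson_kernel t r K :
  (\sum_(k < K) (-1) ^+ k * r ^+ k * cos (k.+1%:R * t)) *
    (1 + 2 * r * cos t + r ^+ 2) =
  cos t + r - (-1) ^+ K * r ^+ K * (cos (K.+1%:R * t) + r * cos (K%:R * t)).
Proof.
elim: K => [|K IH].
  by rewrite big_ord0 !mul0r cos0 !mul1r; ring.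
rewrite big_ord_recr /= mulrDl IH !exprS.
have -> : cos (K.+2%:R * t) = 2 * cos t * cos (K.+1%:R * t) - cos (K%:R * t).
  have -> : K.+2%:R * t = K.+1%:R * t + t by rewrite -[K.+2%:R]natr1 mulrDl mul1r.
  have -> : K%:R * t = K.+1%:R * t - t by rewrite -[K.+1%:R]natr1 mulrDl mul1r addrK.
  by rewrite cosB cosD; ring.
by ring.
Qed.

(** Partial Fourier sum of ln |1 + e^(it)|, whose value is ln (2 + 2 cos t) / 2. *)
Definition cos_psum t K : R := \sum_(k < K) (-1) ^+ k / k.+1%:R * cos (k.+1%:R * t).

(** In r from 0 to 1, the derivative of ln |1 + r e^(it)| minus its partial series is the remainder
    of [poisson_kernel]. Its numerator is at most 2 r^K and its denominator at least 3/4, hence 8/3;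
    the bound is uniform in t. *)
Lemma ln_cos_approx t K : - 2^-1 <= cos t ->
  `|ln (2 + 2 * cos t) / 2 - cos_psum t K| <= 8 / 3 / K.+1%:R.
Proof.
move=> c0.
have D0 r : 0 <= r <= 1 -> 3 / 4 <= 1 + 2 * r * cos t + r ^+ 2.
  move=> /andP[r0 r1].
  have h1 : 0 <= r * (cos t + 2^-1) by rewrite mulr_ge0 //; lra.
  have h2 := sqr_ge0 (r - 2^-1); lra.
pose a k : R := (-1) ^+ k * cos (k.+1%:R * t).
pose p : {poly R} := 1 + (2 * cos t) *: 'X + 'X^2.
pose q : {poly R} := \sum_(k < K) (a k / k.+1%:R) *: 'X^(k.+1).
have pE r : p.[r] = 1 + 2 * r * cos t + r ^+ 2.
  by rewrite /p !hornerE; ring.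
have qE : q.[1] = cos_psum t K.
  rewrite /q horner_sum; apply: eq_bigr => k _.
  by rewrite !hornerE expr1n mulr1 /a mulrAC.
have dp r : p^`().[r] = 2 * (cos t + r).
  by rewrite /p !poly.derivE !hornerE /=; ring.
have dq r : q^`().[r] = \sum_(k < K) (-1) ^+ k * r ^+ k * cos (k.+1%:R * t).
  rewrite /q raddf_sum horner_sum; apply: eq_bigr => k _ /=.
  rewrite derivZ derivXn hornerZ hornerMn hornerXn /a /= -mulr_natr; field.
  by rewrite nat1r pnatr_eq0.
pose f r := ln p.[r] / 2 - q.[r].
pose df r := p^`().[r] / p.[r] / 2 - q^`().[r].
have dfE r : 0 <= r <= 1 -> df r =
    (-1) ^+ K * r ^+ K * (cos (K.+1%:R * t) + r * cos (K%:R * t)) / p.[r].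
  move=> r01; have p0 : p.[r] != 0 by rewrite pE gt_eqF //; have := D0 r r01; lra.
  have E := poisson_kernel t r K; rewrite -pE -dq in E.
  by apply: (mulIf p0); rewrite mulfVK // mulrBl E dp; field.
have df_le r : 0 <= r <= 1 -> `|df r| <= 8 / 3 * r ^+ K.
  move=> r01; have /andP[r0 r1] := r01.
  have p0 := D0 r r01; rewrite -pE in p0.
  have p0' : 0 < p.[r] by lra.
  rewrite dfE // normrM normfV (gtr0_norm p0') ler_pdivrMr //.
  rewrite !normrM normrX normrN1 expr1n mul1r normrX (ger0_norm r0).
  have c2 : `|cos (K.+1%:R * t) + r * cos (K%:R * t)| <= 2.
    apply: le_trans (ler_normD _ _) _; rewrite normrM (ger0_norm r0).
    have := cos_max (K.+1%:R * t); have := cos_max (K%:R * t); nra.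
  have rK : 0 <= r ^+ K by rewrite exprn_ge0.
  apply: le_trans (ler_wpM2l rK c2) _; nra.
assert (Df : forall r, 0 <= r <= 1 -> is_derive r 1 f (df r)).
  move=> r r01; have p0 : 0 < p.[r] by rewrite pE; have := D0 r r01; lra.
  have dln := @is_derive1_ln R _ p0.
  rewrite /f /df; apply: is_deriveB.
  rewrite (_ : (fun _ => _) = 2^-1 \*: (@ln R \o horner p)); last first.
    by apply/funext => x; rewrite /= mulrC.
  apply: is_derive_eq; rewrite /GRing.scale /=; ring.
pose g r := 8 / 3 / K.+1%:R * r ^+ K.+1.
assert (Dg : forall r, 0 <= r <= 1 -> is_derive r 1 g (8 / 3 * r ^+ K)).
  move=> r _; apply: (@is_derive_poly_eq R ((8 / 3 / K.+1%:R) *: 'X^(K.+1))) => [x|].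
    by rewrite !hornerE.
  rewrite derivZ derivXn hornerZ hornerMn hornerXn /= -mulr_natr; field.
  by rewrite nat1r pnatr_eq0.
have f0 : f 0 = 0.
  have -> : f 0 = ln p.[0] / 2 - q.[0] by [].
  rewrite (_ : p.[0] = 1); last by rewrite pE; ring.
  rewrite ln1 mul0r sub0r /q horner_sum big1 ?oppr0 // => k _.
  by rewrite hornerZ hornerXn expr0n mulr0.
have g0 : g 0 = 0 by rewrite /g expr0n mulr0.
have g1 : g 1 = 8 / 3 / K.+1%:R by rewrite /g expr1n mulr1.
have f1 : f 1 = ln (2 + 2 * cos t) / 2 - cos_psum t K.
  by rewrite /f qE pE; congr (ln _ / _ - _); ring.
rewrite -f1 -g1 ler_norml lerNl; apply/andP; split.
  apply: (le_of_is_derive (f := fun r => - f r) (df := fun r => - df r) ler01 _ Dg) => [r r01|r|].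
  - by apply: is_deriveN; apply: Df.
  - by move=> /df_le; rewrite ler_norml => /andP[]; lra.
  - by rewrite f0 g0 oppr0.
apply: (le_of_is_derive ler01 Df Dg) => [r|]; last by rewrite f0 g0.
by move=> /df_le; rewrite ler_norml => /andP[]; lra.
Qed.

Definition sin_psum K t : R := \sum_(k < K) (-1) ^+ k / k.+1%:R ^+ 2 * sin (k.+1%:R * t).

Lemma is_derive_sin_psum K t : is_derive t 1 (sin_psum K) (cos_psum t K).
Proof.
elim: K => [|K IH].
  rewrite (_ : sin_psum 0 = cst 0); last by apply/funext => x; rewrite /sin_psum big_ord0.
  rewrite /cos_psum big_ord0; exact: is_derive_cst.
pose c : R := (-1) ^+ K / K.+1%:R ^+ 2.
rewrite (_ : sin_psum K.+1 = sin_psum K \+ c \*: (sin \o (K.+1%:R \*: id))); last first.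
  by apply/funext => x; rewrite /sin_psum big_ord_recr.
rewrite /cos_psum big_ord_recr /=; apply: is_deriveD.
apply: is_derive_eq; rewrite /GRing.scale /= /c; field.
by rewrite nat1r pnatr_eq0.
Qed.

Definition log_chord t : R := ln (2 + 2 * cos t) / 2.

Lemma cos_2pithird : cos (2 * pi / 3) = - 2^-1 :> R.
Proof.
have -> : 2 * pi / 3 = - (pi / 3) + pi :> R by field.
by rewrite cosDpi cosN cos_pithird.
Qed.

Lemma ler_cos : {in `[0, pi] &, {mono (@cos R) : x y /~ y <= x}}.
Proof. by move=> x y xI yI; rewrite !leNgt ltr_cos. Qed.

Lemma cos_geNhalf t : 0 <= t <= 2 * pi / 3 -> - 2^-1 <= cos t.
Proof.
move=> /andP[t0 t1]; have pi0 := @pi_gt0 R.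
by rewrite -cos_2pithird ler_cos ?in_itv //=; apply/andP; split; lra.
Qed.

Lemma log_chord_nincr x y : 0 <= x -> x <= y -> y <= 2 * pi / 3 ->
  log_chord y <= log_chord x.
Proof.
move=> x0 xy y1; have pi0 := @pi_gt0 R.
have cxy : cos y <= cos x by rewrite ler_cos ?in_itv //=; apply/andP; split; lra.
have cy : - 2^-1 <= cos y by apply: cos_geNhalf; apply/andP; split; lra.
rewrite /log_chord ler_pM2r ?ler_ln ?posrE //; lra.
Qed.

(** The mean value theorem gives a value of [cos_psum] in between, which is close to a value of the
    monotone function [log_chord]. *)
Lemma sin_psum_increment x y K : 0 <= x -> x <= y -> y <= 2 * pi / 3 ->
  (y - x) * (log_chord y - 8 / 3 / K.+1%:R) <= sin_psum K y - sin_psum K x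
    <= (y - x) * (log_chord x + 8 / 3 / K.+1%:R).
Proof.
move=> x0 xy y1.
have [|| c] := @MVT_segment R (sin_psum K) (cos_psum^~ K) x y xy.
- by move=> t _; apply: is_derive_sin_psum.
- apply: derivable_within_continuous => t _.
  by case: (is_derive_sin_psum K t).
rewrite in_itv /= => /andP[xc cy] ->; rewrite (mulrC (cos_psum c K)).
have := @ln_cos_approx c K; rewrite -/(log_chord c) cos_geNhalf; last by apply/andP; split; lra.
move=> /(_ isT); move: (8 / 3 / K.+1%:R) => e; rewrite ler_norml => /andP[lo hi].
have h1 := log_chord_nincr x0 xc (le_trans cy y1).
have h2 := log_chord_nincr (le_trans x0 xc) cy y1.
by rewrite !ler_wpM2l ?subr_ge0 //; lra.
Qed.

Lemma sin_psum_riemann M K (d := 2 * pi / 3 / M.+1%:R) :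
  d * (\sum_(j < M.+1) log_chord (j.+1%:R * d)) - 2 * pi / 3 * (8 / 3 / K.+1%:R)
    <= sin_psum K (2 * pi / 3) <=
  d * (\sum_(j < M.+1) log_chord (j%:R * d)) + 2 * pi / 3 * (8 / 3 / K.+1%:R).
Proof.
have pi0 := @pi_gt0 R.
have d0 : 0 < d by rewrite /d divr_gt0 //; lra.
have Md : M.+1%:R * d = 2 * pi / 3 by rewrite /d mulrC divfK // pnatr_eq0.
have step j : (j < M.+1)%N ->
  d * (log_chord (j.+1%:R * d) - 8 / 3 / K.+1%:R) <=
    sin_psum K (j.+1%:R * d) - sin_psum K (j%:R * d) <=
  d * (log_chord (j%:R * d) + 8 / 3 / K.+1%:R).
  move=> jM.
  have E : j.+1%:R * d - j%:R * d = d by rewrite -mulrBl -natr1 addrAC subrr add0r mul1r.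
  rewrite -[X in X * _ <= _ <= _]E -[X in _ <= _ <= X * _]E.
  apply: sin_psum_increment; first by rewrite mulr_ge0 // ltW.
    by rewrite ler_pM2r // ler_nat.
  by rewrite -Md ler_pM2r // ler_nat.
have tel : sin_psum K (2 * pi / 3) =
    \sum_(j < M.+1) (sin_psum K (j.+1%:R * d) - sin_psum K (j%:R * d)).
  rewrite -(big_mkord xpredT (fun j => sin_psum K (j.+1%:R * d) - sin_psum K (j%:R * d))).
  rewrite telescope_sumr // Md mul0r {3}/sin_psum big1 ?subr0 // => k _.
  by rewrite mulr0 sin0 mulr0.
have cst : d * \sum_(j < M.+1) (8 / 3 / K.+1%:R) = 2 * pi / 3 * (8 / 3 / K.+1%:R) :> R.
  by rewrite sumr_const card_ord -[_ *+ M.+1]mulr_natl -Md mulrCA mulrA.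
rewrite tel -cst -mulrBr -mulrDr -sumrB -big_split /= !mulr_sumr.
by apply/andP; split; apply: ler_sum => j _; case/andP: (step j (ltn_ord j)).
Qed.

Lemma sin_psum_cvg : (fun m => sin_psum (2 * m)%N (2 * pi / 3)) @ \oo -->
  3 * Num.sqrt 3 / 4 * L2_chi_m3 R.
Proof.
have -> : (fun m => sin_psum (2 * m)%N (2 * pi / 3)) =
    (fun m => Num.sqrt 3 / 2 * \sum_(k < (2 * m)%N) (-1) ^+ k * (chi_m3 k.+1%:Z)%:~R * (k.+1%:R : R) ^- 2).
  apply/funext => m; rewrite mulr_sumr; apply: eq_bigr => k _.
  rewrite sin_chi_m3; ring.
have -> : 3 * Num.sqrt 3 / 4 * L2_chi_m3 R = Num.sqrt 3 / 2 * (3 / 2 * L2_chi_m3 R).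
  by field.
by apply: cvgMl_tmp; apply: alt_chi_sum_cvg.
Qed.

(** The mesh is fixed while the length of the series tends to infinity, through even lengths since
    [alt_chi_sum] evaluates those. *)
Lemma log_chord_riemann M (d := 2 * pi / 3 / M.+1%:R) :
  d * (\sum_(j < M.+1) log_chord (j.+1%:R * d)) <= 3 * Num.sqrt 3 / 4 * L2_chi_m3 R <=
  d * (\sum_(j < M.+1) log_chord (j%:R * d)).
Proof.
have e0 : (fun m => 2 * pi / 3 * (8 / 3 / (2 * m).+1%:R) : R) @ \oo --> (0 : R).
  rewrite -[X in _ --> X](mulr0 (2 * pi / 3)); apply: cvgMl_tmp.
  rewrite -[X in _ --> X](mulr0 (8 / 3)); apply: cvgMl_tmp.
  have H : (muln 2) @ \oo --> \oo by apply: cvg_mulnl.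
  apply: (@cvg_comp _ _ _ (muln 2) (@harmonic R) _ _ _ H); exact: cvg_harmonic.
have lim_ge (u : nat -> R) (l x : R) : u @ \oo --> l -> (forall n, x <= u n) -> x <= l.
  move=> ul xu; rewrite -(cvg_lim _ ul) //; apply: limr_ge; first by apply/cvg_ex; exists l.
  by apply: nearW.
have lim_le (u : nat -> R) (l x : R) : u @ \oo --> l -> (forall n, u n <= x) -> l <= x.
  move=> ul xu; rewrite -(cvg_lim _ ul) //; apply: limr_le; first by apply/cvg_ex; exists l.
  by apply: nearW.
apply/andP; split.
  rewrite -[X in _ <= X]addr0; apply: lim_ge (cvgD sin_psum_cvg e0) _ => m /=.
  by have /andP[] := sin_psum_riemann M (2 * m); rewrite lerBlDr.
rewrite -[X in X <= _]subr0; apply: lim_le (cvgB sin_psum_cvg e0) _ => m /=.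
by have /andP[_] := sin_psum_riemann M (2 * m); rewrite -lerBlDr.
Qed.

(** The two Riemann sums differ only by the end values, ln 2 at 0 and 0 at 2 pi / 3. *)
Lemma log_chord_sum_approx M (d := 2 * pi / 3 / M.+1%:R) :
  `|\sum_(1 <= j < M.+1) log_chord (j%:R * d) - 3 * Num.sqrt 3 / 4 * L2_chi_m3 R / d| <= ln 2.
Proof.
have pi0 := @pi_gt0 R.
have d0 : 0 < d by rewrite /d divr_gt0 //; lra.
have Md : M.+1%:R * d = 2 * pi / 3 by rewrite /d mulrC divfK // pnatr_eq0.
have := log_chord_riemann M; rewrite /= -/d.
have h0 : log_chord 0 = ln 2.
  rewrite /log_chord cos0 mulr1 (_ : 2 + 2 = 2 ^+ 2); last by ring.
  by rewrite lnXn // mulr2n; field.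
have h1 : log_chord (2 * pi / 3) = 0.
  by rewrite /log_chord cos_2pithird mulrN divff // (_ : 2 - 1 = 1) ?ln1 ?mul0r //; ring.
rewrite -(big_mkord xpredT (fun j => log_chord (j.+1%:R * d))).
rewrite -(big_mkord xpredT (fun j => log_chord (j%:R * d))).
rewrite big_nat_recr //= Md h1 addr0 [X in _ <= _ <= _ * X]big_nat_recl // mul0r h0.
rewrite [X in _ -> `|X - _| <= _]big_add1 /=; set A := \sum_(_ <= _ < _) _.
set I := _ * L2_chi_m3 R => /andP[lo hi].
have {}lo : A <= I / d by rewrite ler_pdivlMr // mulrC.
have {}hi : I / d <= ln 2 + A by rewrite ler_pdivrMr // mulrC.
rewrite distrC ger0_norm; lra.
Qed.

End Riemann.

(** * Asymptotics *)

Import ComplexField.Normc.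

Section Zeta.
Variable R : realType.

Definition angle (n : nat) : R := 2 * pi / (3 * n + 3)%:R.

Lemma zeta_expr (n k : nat) :
  (zeta n : R[i]) ^+ k = Complex (cos (k%:R * angle n)) (sin (k%:R * angle n)).
Proof.
elim: k => [|k IH]; first by rewrite mul0r cos0 sin0.
rewrite exprS IH /zeta -/(angle n).
have -> : k.+1%:R * angle n = angle n + k%:R * angle n by rewrite -nat1r mulrDl mul1r.
by rewrite cosD sinD /=; congr Complex; rewrite addrC mulrC [X in _ + X]mulrC.
Qed.

Lemma cos_eq1 (x : R) : 0 < x < 2 * pi -> cos x < 1.
Proof.
move=> /andP[x0 x2].
have s0 : 0 < sin (x / 2) by apply: sin_gt0_pi; apply/andP; split; lra.
have -> : x = (x / 2) *+ 2 by rewrite mulr2n; field.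
rewrite cos_mulr2n cos2sin2; have := exprn_gt0 2 s0; rewrite mulr2n; lra.
Qed.

Lemma zeta_prim (n : nat) : (3 * n + 3)%N.-primitive_root (zeta n : R[i]).
Proof.
have pi0 := @pi_gt0 R.
have N0 : 0 < (3 * n + 3)%:R :> R by rewrite ltr0n addn3.
rewrite /primitive_root_of_unity addn3 /=; apply/forallP => i.
rewrite unity_rootE zeta_expr eq_complex /=.
have [->|ne] := eqVneq i.+1 (3 * n).+3.
  have -> : (3 * n).+3%:R * angle n = pi *+ 2.
    rewrite /angle addn3 mulrCA mulfV ?pnatr_eq0 // mulr1 mulr2n.
    by rewrite mulrDl mul1r.
  by rewrite cos2pi sin2pi !eqxx.
have lt_i : (i.+1 < (3 * n).+3)%N by rewrite ltn_neqAle ne ltn_ord.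
have /cos_eq1 : 0 < i.+1%:R * angle n < 2 * pi.
  rewrite /angle; apply/andP; split.
    by rewrite mulr_gt0 ?divr_gt0 //; lra.
  rewrite mulrCA gtr_pMr; last by lra.
  by rewrite ltr_pdivrMr // mul1r ltr_nat addn3.
by move=> /lt_eqF ->.
Qed.

Lemma zeta_sub (n m d : nat) : n.+1 = (d * m.+1)%N -> (zeta n : R[i]) ^+ d = zeta m.
Proof.
move=> E; rewrite zeta_expr /zeta.
have -> : d%:R * angle n = 2 * pi / (3 * m + 3)%:R.
  rewrite /angle (_ : (3 * n + 3 = d * (3 * m + 3))%N); last by lia.
  have d0 : d%:R != 0 :> R by rewrite pnatr_eq0; case: d E.
  have M0 : (3 * m + 3)%:R != 0 :> R by rewrite pnatr_eq0 addn3.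
  rewrite natrM; move: d%:R (3 * m + 3)%:R d0 M0 => x y x0 y0.
  by field; rewrite x0 y0.
by [].
Qed.

Lemma norm_1zeta (n a : nat) :
  (normc (1 + (zeta n : R[i]) ^+ a)) ^+ 2 = 2 + 2 * cos (a%:R * angle n).
Proof.
rewrite zeta_expr /= sqr_sqrtr; last by rewrite addr_ge0 ?sqr_ge0.
by have := cos2Dsin2 (a%:R * angle n); rewrite add0r => E; lra.
Qed.

End Zeta.

Lemma bernoulli_ineq (R : realFieldType) (x : R) (k : nat) : 0 <= x ->
  1 + k%:R * x <= (1 + x) ^+ k.
Proof.
move=> x0; elim: k => [|k IH]; first by rewrite mul0r addr0.
rewrite exprS; have k0 : 0 <= k%:R :> R by [].
have kx : 0 <= k%:R * x by rewrite mulr_ge0.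
have := ler_wpM2l (_ : 0 <= 1 + x) IH; rewrite -nat1r; have xx : 0 <= k%:R * x * x by rewrite mulr_ge0.
move=> /(_ ltac:(lra)); lra.
Qed.

Section Norms.
Variable R : realType.
Implicit Types x y w : R[i].

Lemma normc_ge0 x : 0 <= normc x.
Proof. by case: x => a b; apply: sqrtr_ge0. Qed.

Lemma normcE x : (normc x)%:C%C = `|x|. Proof. by []. Qed.

Lemma normc_prod (I : Type) (s : seq I) (P : pred I) (F : I -> R[i]) :
  normc (\prod_(i <- s | P i) F i) = \prod_(i <- s | P i) normc (F i).
Proof. by apply: (big_morph _ (@normcM R)); apply: normc1. Qed.

Lemma normcX x k : normc (x ^+ k) = normc x ^+ k.
Proof. by elim: k => [|k IH]; rewrite ?expr0 ?normc1 // !exprS normcM IH. Qed.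

Lemma normc_sub1 x : `|normc x - 1| <= normc (x - 1) <= normc x + 1.
Proof.
have n1 : normc (1 : R[i]) = 1 := normc1 R.
have := le_normcD x (-1); have := le_normcD (x - 1) 1; have := le_normcD (1 - x) x.
rewrite !subrK (normcN (1 : R[i])) n1 -[1 - x]opprB normcN => h1 h2 h3.
by rewrite ler_norml; apply/andP; split; [apply/andP; split|]; lra.
Qed.

Lemma normc_real (r : R) : normc (r%:C)%C = `|r|.
Proof. by rewrite /= expr0n addr0 sqrtr_sqr. Qed.

Lemma ln_prod (I : eqType) (s : seq I) (F : I -> R) : (forall i, i \in s -> 0 < F i) ->
  ln (\prod_(i <- s) F i) = \sum_(i <- s) ln (F i).
Proof.
elim: s => [|i s IH] F0; first by rewrite !big_nil ln1.
have F0s j : j \in s -> 0 < F j by move=> js; apply: F0; rewrite inE js orbT.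
rewrite !big_cons lnM ?IH // posrE; first by apply: F0; rewrite inE eqxx.
rewrite big_seq; apply: prodr_gt0 => j; exact: F0s.
Qed.

Lemma ln_bound (x c : R) : 1 <= x <= c -> 0 <= ln x <= ln c.
Proof.
move=> /andP[x1 xc]; rewrite ln_ge0 // ler_ln ?posrE //; lra.
Qed.

End Norms.

(** * Products of eigenvalues along one row *)

Section Rows.
Variables (R : realType) (n : nat).
Hypothesis n_gt0 : (0 < n)%N.
Local Notation N := (3 * n + 3)%N.
Local Notation z := (zeta n : R[i]).
Let prim_z := zeta_prim R n.

(** The positions where 1 + z^a + z^b vanishes. *)
Definition central (a b : nat) : bool :=
  ((a, b) == (n + 1, 2 * n + 2)%N) || ((a, b) == (2 * n + 2, n + 1)%N).

Definition pair_norm (a b : nat) : R := normc (1 + z ^+ a + z ^+ b).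

Definition log_plus (a : nat) : R := ln (Num.max 1 (normc (1 + z ^+ a))).

Lemma normc_zeta (k : nat) : normc (z ^+ k) = 1.
Proof. by apply: complexI; rewrite normcE normrX (prim_root_norm prim_z) expr1n. Qed.

Lemma prod_row w : \prod_(b < N) normc (w + z ^+ b) = normc ((- w) ^+ N - 1).
Proof.
have := congr1 (fun p => p.[- w]) (factor_Xn_sub_1 prim_z).
rewrite horner_prod !hornerE => <-; rewrite normc_prod big_mkord.
by apply: eq_bigr => b _; rewrite !hornerE -opprD normcN.
Qed.

Lemma trig_factor (a : nat) :
  1 + z ^+ a + z ^+ (2 * a) = z ^+ a * ((1 + 2 * cos (a%:R * angle R n))%:C)%C.
Proof.
rewrite mulnC exprM zeta_expr; set c := cos _; set s := sin _.
have E : s ^+ 2 = 1 - c ^+ 2 by rewrite sin2cos2.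
rewrite expr2 /=; apply/eqP; rewrite eq_complex /=; apply/andP; split; apply/eqP.
  rewrite -[s * s]expr2 E; ring.
by ring.
Qed.

(* For a nontrivial [M]-th root of unity [y], [(y - 1) * \sum_j j y ^ j = M],
   so [y] cannot be too close to 1. *)
Lemma root_of_unity_gap (M : nat) (y : R[i]) : (1 < M)%N -> y ^+ M = 1 -> y != 1 ->
  2 / M.-1%:R <= normc (y - 1).
Proof.
case: M => [//|[//|k]] _ yM y1 /=; set M := k.+2.
have geo : \sum_(j < M) y ^+ j = 0.
  by apply: (mulfI (x := y - 1)); rewrite ?subr_eq0 // mulr0 -subrX1 yM subrr.
have E m : (y - 1) * (\sum_(j < m) j%:R * y ^+ j) = m%:R * y ^+ m - y * \sum_(j < m) y ^+ j.
  elim: m => [|m IH]; first by rewrite !big_ord0 !mulr0 mul0r subrr.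
  by rewrite !big_ord_recr /= !mulrDr IH -natr1 exprS; ring.
have := congr1 (@normc R) (E M); rewrite geo mulr0 subr0 yM mulr1 normcM.
have -> : normc (M%:R : R[i]) = M%:R.
  by rewrite -(rmorph_nat (@real_complex_def _ (Phant R))) normc_real normr_nat.
have normy : normc y = 1.
  have : normc y ^+ M == 1 by rewrite -normcX yM normc1.
  by rewrite pexpr_eq1 ?normc_ge0 // => /eqP.
have le_sum m : normc (\sum_(j < m) j%:R * y ^+ j) <= (m * m.-1)%:R / 2.
  elim: m => [|m IH]; first by rewrite big_ord0 normc0 mul0n mul0r.
  rewrite big_ord_recr /=; apply: le_trans (le_normcD _ _) _.
  rewrite normcM normcX normy expr1n mulr1.
  have -> : normc (m%:R : R[i]) = m%:R.
    by rewrite -(rmorph_nat (@real_complex_def _ (Phant R))) normc_real normr_nat.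
  apply: le_trans (lerD IH (lexx _)) _; case: m {IH} => [|m] /=; first by rewrite !mul0n mul0r add0r.
  by rewrite !natrM -[m.+2%:R]natr1 -[m.+1%:R]natr1 le_eqVlt; apply/orP; left; apply/eqP; field.
move=> H; rewrite ler_pdivrMr ?ltr0n // -(ler_pM2r (x := M%:R / 2)) ?divr_gt0 ?ltr0n //.
have -> : 2 * (M%:R / 2) = M%:R :> R by field.
rewrite -{1}H -mulrA; apply: ler_wpM2l; first exact: normc_ge0.
apply: le_trans (le_sum M) _; rewrite natrM /M /=; lra.
Qed.

(** Here |1 + z^a|^2 - 1 is, up to sign, |1 + z^a + z^(2a)|, the quotient of |z^(3a) - 1| by |z^a -
    1| <= 2. For nonzero [a], z^(3a) is a nontrivial root of unity of order dividing n + 1. *)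
Lemma normc_1zeta_gap (a : nat) : (a < N)%N -> (a != n + 1)%N -> (a != 2 * n + 2)%N ->
  n%:R^-1 <= `|normc (1 + z ^+ a) ^+ 2 - 1|.
Proof.
move=> aN a1 a2; have n0 : 0 < n%:R :> R by rewrite ltr0n.
rewrite norm_1zeta; have -> : 2 + 2 * cos (a%:R * angle R n) - 1 = 1 + 2 * cos (a%:R * angle R n) by ring.
have [->|a0] := eqVneq a 0%N.
  rewrite mul0r cos0 ger0_norm; last by lra.
  apply: le_trans (_ : 1 <= _); last by lra.
  by rewrite invf_le1 // ler1n.
rewrite -normc_real.
have -> : normc ((1 + 2 * cos (a%:R * angle R n))%:C)%C = normc (1 + z ^+ a + z ^+ (2 * a)).
  by rewrite trig_factor normcM normc_zeta mul1r.
have gap : 2 / n%:R <= normc (z ^+ (3 * a) - 1).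
  apply: (@root_of_unity_gap n.+1); first by rewrite ltnS.
    have E : (3 * a * n.+1 = N * a)%N by lia.
    by rewrite -exprM E exprM (prim_expr_order prim_z) expr1n.
  rewrite -(prim_order_dvd prim_z); apply/negP => /dvdnP[k Ek].
  have N0 : (0 < N)%N by rewrite addn3.
  have k3 : (k < 3)%N by rewrite -(ltn_pmul2r N0) -Ek; lia.
  by case: k Ek k3 => [|[|[|]]] //; lia.
have E : z ^+ (3 * a) - 1 = (z ^+ a - 1) * (1 + z ^+ a + z ^+ (2 * a)).
  by rewrite !(mulnC _ a) !exprM; ring.
rewrite E normcM in gap.
have le2 : normc (z ^+ a - 1) <= 2.
  by apply: le_trans (le_normcD _ _) _; rewrite normcN normc_zeta normc1.
have := ler_wpM2r (normc_ge0 (1 + z ^+ a + z ^+ (2 * a))) le2.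
by lra.
Qed.

(** The gap 1/n in x^2 is amplified by the exponent: (1 + 1/n)^N >= 4. With x^N off 1 by a factor 2,
    the row product, between |x^N - 1| and x^N + 1, is within a factor 2 of max(1, x)^N. *)
Lemma row_dichotomy (a : nat) (x := normc (1 + z ^+ a)) :
  (a < N)%N -> (a != n + 1)%N -> (a != 2 * n + 2)%N ->
  (1 <= x /\ 2 <= x ^+ N) \/ (x <= 1 /\ x ^+ N <= 2^-1).
Proof.
move=> aN a1 a2; have := normc_1zeta_gap aN a1 a2; rewrite -/x.
have x0 : 0 <= x by apply: normc_ge0.
have n0 : 0 < n%:R :> R by rewrite ltr0n.
have i0 : 0 < n%:R^-1 :> R by rewrite invr_gt0.
have four : 4 <= (1 + n%:R^-1) ^+ N :> R.
  apply: le_trans (bernoulli_ineq _ (ltW i0)).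
  by rewrite natrD natrM mulrDl -mulrA mulfV ?gt_eqF // mulr1; lra.
have xN0 : 0 <= x ^+ N by rewrite exprn_ge0.
case: (lerP 1 x) => x1.
  have xx1 : 1 <= x ^+ 2 by rewrite exprn_ege1.
  rewrite ger0_norm ?subr_ge0 // lerBrDl => gap; left; split=> //.
  rewrite -(ler_pXn2r (n := 2)) ?nnegrE // exprAC.
  apply: le_trans (_ : 4 <= _); first by rewrite expr2; lra.
  apply: (le_trans four); apply: lerXn2r => //; rewrite nnegrE ?exprn_ge0 // addr_ge0 // ltW.
have xx1 : x ^+ 2 < 1 by rewrite exprn_ilt1.
rewrite ltr0_norm ?subr_lt0 // opprB lerBrDr => gap; right; split; first exact: ltW.
rewrite -(ler_pXn2r (n := 2)) ?nnegrE ?invr_ge0 // exprAC.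
have : (x ^+ 2) ^+ N * (1 + n%:R^-1) ^+ N <= 1.
  rewrite -exprMn exprn_ile1 ?mulr_ge0 ?exprn_ge0 ?addr_ge0 ?(ltW i0) //.
  have h1 : 0 <= n%:R^-1 * (1 - (x ^+ 2 + n%:R^-1)) by rewrite mulr_ge0 ?(ltW i0) //; lra.
  have h2 : 0 <= n%:R^-1 * n%:R^-1 :> R by rewrite mulr_ge0 // ltW.
  lra.
have y0 : 0 <= (x ^+ 2) ^+ N by rewrite !exprn_ge0.
move: y0 four; move: ((x ^+ 2) ^+ N) ((1 + n%:R^-1) ^+ N : R) => y w y0 w4 yw.
have := ler_wpM2l y0 w4; rewrite expr2; lra.
Qed.

Definition log_row (a : nat) : R := \sum_(b < N | ~~ central a b) ln (pair_norm a b).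

Lemma ln2_le1 : ln 2 <= 1 :> R.
Proof. by rewrite -[leRHS]expRK ler_ln ?posrE ?expR_gt0 //; have := @expR_ge1Dx R 1; lra. Qed.

Lemma row_regular (a : nat) : (a < N)%N -> (a != n + 1)%N -> (a != 2 * n + 2)%N ->
  (forall b, (b < N)%N -> 0 < pair_norm a b) /\ `|log_row a - N%:R * log_plus a| <= ln 2.
Proof.
move=> aN a1 a2; have dich := row_dichotomy aN a1 a2.
have prodE : \prod_(b < N) pair_norm a b = normc ((- (1 + z ^+ a)) ^+ N - 1) by rewrite -prod_row.
have /andP[lo hi] := normc_sub1 ((- (1 + z ^+ a)) ^+ N).
rewrite normcX normcN -prodE in lo hi.
have prod0 : 0 < \prod_(b < N) pair_norm a b.
  apply: lt_le_trans lo; rewrite normr_gt0 subr_eq0.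
  by case: dich => -[_ h]; [rewrite gt_eqF|rewrite lt_eqF]; lra.
have pos b : (b < N)%N -> 0 < pair_norm a b.
  move=> bN; rewrite lt0r normc_ge0 andbT; apply/negP => /eqP t0.
  by move: prod0; rewrite (bigD1 (Ordinal bN)) //= t0 mul0r ltxx.
split=> //.
have -> : log_row a = ln (\prod_(b < N) pair_norm a b).
  rewrite ln_prod => [|b _]; last exact: pos.
  rewrite /log_row; apply: eq_bigl => b; rewrite /central !xpair_eqE.
  by rewrite (negPf a1) (negPf a2).
rewrite /log_plus; case: dich => -[x1 xN].
  rewrite max_r // mulr_natl -lnXn; last by lra.
  have x0 : 0 < normc (1 + z ^+ a) ^+ N by lra.
  rewrite -ln_div ?posrE //.
  have l2 : - ln 2 = ln (2^-1) :> R by rewrite lnV ?posrE.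
  rewrite ler_norml l2 !ler_ln ?posrE ?divr_gt0 // ler_pdivlMr // ler_pdivrMr //.
  rewrite ger0_norm in lo; last by lra.
  by apply/andP; split; lra.
rewrite max_l // ln1 mulr0 subr0.
have l2 : - ln 2 = ln (2^-1) :> R by rewrite lnV ?posrE.
rewrite ler_norml l2 !ler_ln ?posrE //.
rewrite ler0_norm in lo; last by lra.
by apply/andP; split; lra.
Qed.

(** With its zero factor removed, the row product is the modulus of the derivative of X^N - 1 at a
    root, which is [N]. *)
Lemma row_center (a b0 : nat) : central a b0 ->
  (forall b, (b < N)%N -> ~~ central a b -> 0 < pair_norm a b) /\ log_row a = ln N%:R.
Proof.
move=> cab.
have b0N : (b0 < N)%N by move: cab; rewrite /central !xpair_eqE; lia.
have cE b : central a b = (b == b0).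
  by move: cab; rewrite /central !xpair_eqE; lia.
have w0 : 1 + z ^+ a = - z ^+ b0.
  have prim3 : 3.-primitive_root (z ^+ (n + 1)).
    have -> : (n + 1 = N %/ 3)%N by lia.
    by apply: dvdn_prim_root => //; apply/dvdnP; exists (n + 1)%N; lia.
  have : 1 + z ^+ (n + 1) + z ^+ (2 * n + 2) = 0.
    have -> : (2 * n + 2 = (n + 1) * 2)%N by lia.
    rewrite exprM; set y := z ^+ (n + 1) in prim3 *.
    have y1 : y - 1 != 0.
      rewrite subr_eq0 -[y]expr1 -(prim_order_dvd prim3); lia.
    apply: (mulfI y1); rewrite mulr0.
    have -> : (y - 1) * (1 + y + y ^+ 2) = y ^+ 3 - 1 by ring.
    by rewrite (prim_expr_order prim3) subrr.
  move=> E; apply/eqP; rewrite -addr_eq0; move: cab; rewrite /central !xpair_eqE.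
  by case/orP => /andP[/eqP -> /eqP ->]; rewrite -?E // addrAC E.
pose B0 := Ordinal b0N.
have prodE : \prod_(b < N | b != B0) pair_norm a b = N%:R.
  have := congr1 (fun p => (p^`()).[z ^+ b0]) (factor_Xn_sub_1 prim_z).
  rewrite big_mkord (bigD1 B0) //= derivM derivXsubC mul1r.
  rewrite derivB derivXn derivC subr0 !hornerE subrr mul0r addr0 horner_prod.
  move/(congr1 (@normc R)).
  rewrite normc_prod hornerMn hornerXn -[_ *+ N]mulr_natl normcM normcX normc_zeta expr1n mulr1.
  rewrite -[in RHS](rmorph_nat (@real_complex_def _ (Phant R))) normc_real normr_nat => <-.
  apply: eq_bigr => b _; rewrite /pair_norm w0 !hornerE -opprB normcN addrC.
  by [].
have prod0 : 0 < \prod_(b < N | b != B0) pair_norm a b by rewrite prodE ltr0n addn3.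
have pos b : (b < N)%N -> ~~ central a b -> 0 < pair_norm a b.
  move=> bN; rewrite cE => bb0; rewrite lt0r normc_ge0 andbT; apply/negP => /eqP t0.
  by move: prod0; rewrite (bigD1 (Ordinal bN)) //= t0 mul0r ltxx.
split=> //; rewrite -prodE /log_row -big_filter -[in RHS]big_filter ln_prod => [|b].
  by congr (\sum_(_ <- _) _); apply: eq_filter => b; rewrite cE.
by rewrite mem_filter => /andP[bb0 _]; apply: pos; rewrite ?cE.
Qed.

End Rows.

Section LogPlus.
Variables (R : realType) (n : nat).
Local Notation N := (3 * n + 3)%N.
Local Notation z := (zeta n : R[i]).
Local Notation d := (angle R n).

Lemma angleE : d = 2 * pi / 3 / n.+1%:R.
Proof.
rewrite /angle (_ : (3 * n + 3 = 3 * n.+1)%N) ?natrM; last by rewrite mulnSr.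
by field; rewrite nat1r pnatr_eq0.
Qed.

Lemma log_plus_chord (a : nat) : (a <= n.+1)%N -> log_plus R n a = log_chord (a%:R * d).
Proof.
move=> an; have pi0 := @pi_gt0 R.
have c0 : - 2^-1 <= cos (a%:R * d).
  have n0 : 0 < n.+1%:R :> R by rewrite ltr0n.
  apply: cos_geNhalf; rewrite angleE mulr_ge0 ?divr_ge0 ?mulr_ge0 //=; last exact: ltW.
  rewrite mulrA ler_pdivrMr // mulrC ler_wpM2l //; last by rewrite ler_nat.
  by rewrite divr_ge0 // mulr_ge0 // ltW.
have x1 : 1 <= normc (1 + z ^+ a).
  by rewrite -(ler_pXn2r (n := 2)) ?nnegrE ?normc_ge0 // norm_1zeta expr1n; lra.
rewrite /log_plus max_r // /log_chord -norm_1zeta lnXn; last by lra.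
by rewrite -mulr_natl; field.
Qed.

Lemma log_plus_rev (a : nat) : (a <= N)%N -> log_plus R n (N - a) = log_plus R n a.
Proof.
move=> aN; rewrite /log_plus; congr (ln (Num.max 1 _)); apply/eqP.
rewrite -(eqrXn2 (n := 2)) ?normc_ge0 // !norm_1zeta; apply/eqP; congr (2 + 2 * _).
rewrite natrB // mulrBl {1}/angle mulrC mulfVK; last by rewrite pnatr_eq0 addn3.
by rewrite mulr_natl cosB cos2pi sin2pi mul0r addr0 mul1r.
Qed.

Lemma log_plus_eq0 (a : nat) : (n < a <= 2 * n + 2)%N -> log_plus R n a = 0.
Proof.
wlog an : a / (2 * a <= N)%N => [wl|] /andP[na a2].
  have [/wl|lt] := leqP (2 * a) N; first by apply; rewrite na a2.
  by rewrite -log_plus_rev ?wl //; lia.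
have pi0 := @pi_gt0 R.
have n0 : 0 < n.+1%:R :> R by rewrite ltr0n.
have c0 : cos (a%:R * d) <= - 2^-1.
  have l1 : 2 * pi / 3 <= a%:R * d.
    rewrite angleE mulrA ler_pdivlMr // mulrC ler_wpM2r ?ler_nat //.
    by rewrite divr_ge0 // mulr_ge0 // ltW.
  have l2 : a%:R * d <= pi.
    have N0 : 0 < N%:R :> R by rewrite ltr0n addn3.
    rewrite /angle mulrA ler_pdivrMr // mulrA [_ * 2]mulrC -natrM mulrC ler_wpM2l ?ler_nat //.
    exact: ltW.
  rewrite -(cos_2pithird R) ler_cos // in_itv /=; apply/andP; split; lra.
rewrite /log_plus max_l ?ln1 //.
by rewrite -(ler_pXn2r (n := 2)) ?nnegrE ?normc_ge0 // norm_1zeta expr1n; lra.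
Qed.

Lemma log_plus0 : log_plus R n 0 = ln 2.
Proof.
rewrite log_plus_chord // /log_chord mul0r cos0 mulr1.
rewrite (_ : 2 + 2 = 2 ^+ 2 :> R) ?lnXn //; last by ring.
by rewrite -mulr_natl; field.
Qed.

(** The middle third of the circle contributes 0, as |1 + z^a| <= 1 there, and the outer thirds are
    mirror images sharing only the term a = 0. *)
Lemma sum_log_plus : \sum_(a < N) log_plus R n a =
  ln 2 + 2 * \sum_(1 <= j < n.+1) log_chord (j%:R * d).
Proof.
rewrite -(big_mkord xpredT (log_plus R n)) big_ltn ?addn3 // log_plus0; congr (_ + _).
have E1 : \sum_(1 <= j < n.+1) log_plus R n j = \sum_(1 <= j < n.+1) log_chord (j%:R * d).
  by apply: eq_big_nat => a /andP[_ an]; rewrite log_plus_chord // ltnW.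
rewrite (@big_cat_nat _ _ _ n.+1) /=; [|lia|lia].
rewrite (@big_cat_nat _ _ _ (2 * n).+3 n.+1) /=; [|lia|lia].
have -> : \sum_(n.+1 <= a < (2 * n).+3) log_plus R n a = 0.
  by rewrite big_nat big1 // => a an; rewrite log_plus_eq0 //; lia.
rewrite add0r E1 mulr_natl mulr2n; congr (_ + _); rewrite -E1.
rewrite big_nat_rev /= (_ : (2 * n).+3 = 1 + (2 * n).+2)%N; last by lia.
rewrite (_ : (3 * n).+3 = n.+1 + (2 * n).+2)%N; last by lia.
rewrite big_addn addnK; apply: eq_big_nat => a an.
rewrite -log_plus_rev; last by lia.
by congr (log_plus R n _); lia.
Qed.

Lemma sum_log_plus_approx :
  `|\sum_(a < N) log_plus R n a - 2 * (3 * Num.sqrt 3 / 4 * L2_chi_m3 R / d)| <= 3.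
Proof.
have := log_chord_sum_approx R n; rewrite /= -angleE sum_log_plus.
have l2 := @ln2_le1 R; have l0 : 0 <= ln 2 :> R by rewrite ln_ge0 //; lra.
move: (\sum_(_ <= _ < _) _) (_ / d) => x y.
by rewrite !ler_norml => /andP[h1 h2]; apply/andP; split; lra.
Qed.

End LogPlus.

(** * From row sums to the logarithm of the tiling number *)

Section LogTilings.
Variables (R : realType) (n : nat).
Hypothesis n_gt0 : (0 < n)%N.
Local Notation N := (3 * n + 3)%N.
Local Notation z := (zeta n : R[i]).
Local Notation pair_norm := (pair_norm R n).
Local Notation log_row := (log_row R n).
Local Notation central := (central n).

Lemma pair_normC (a b : nat) : pair_norm a b = pair_norm b a.
Proof. by rewrite /pair_norm addrAC. Qed.

Lemma centralC (a b : nat) : central a b = central b a.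
Proof. by rewrite /central !xpair_eqE orbC andbC [X in _ || X]andbC. Qed.

Lemma tilings_cube_pair_norm :
  (tilings n)%:R ^+ 3 = \prod_(p <- generic_pairs n) pair_norm p.1 p.2.
Proof.
apply: complexI; rewrite rmorphXn rmorph_nat rmorph_prod /=.
exact: (tilings_cube_freq (zeta_prim R n)).
Qed.

(** No eigenvalue vanishes because a tiling exists. *)
Lemma pair_norm_gt0 (p : nat * nat) : p \in generic_pairs n -> 0 < pair_norm p.1 p.2.
Proof.
move=> pn; rewrite lt0r normc_ge0 andbT; apply/negP => /eqP t0.
have := tilings_cube_pair_norm; rewrite (perm_big _ (perm_to_rem pn)) big_cons /= t0 mul0r.
by move/eqP; rewrite expf_eq0 /= pnatr_eq0 gtn_eqF // tilings_gt0.
Qed.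

Lemma ln_tilings_pairs :
  3 * ln (tilings n)%:R = \sum_(p <- generic_pairs n) ln (pair_norm p.1 p.2).
Proof.
rewrite -ln_prod => [|p]; last exact: pair_norm_gt0.
by rewrite -tilings_cube_pair_norm lnXn ?mulr_natl // ltr0n tilings_gt0.
Qed.

(** Two of the three unit summands coincide, so the modulus is at least 2 - 1. *)
Lemma pair_norm_bounds (a b : nat) : (a == 0) || (b == 0) || (a == b) -> 1 <= pair_norm a b <= 3.
Proof.
move=> ab; rewrite /pair_norm; set x := normc _.
have hi : x <= 3.
  apply: le_trans (le_normcD _ _) _; rewrite normc_zeta.
  have := le_normcD (1 : R[i]) (z ^+ a); rewrite normc1 normc_zeta; lra.
rewrite hi andbT /x {x hi}.
have low (w v : R[i]) : normc w = 1 -> normc v = 1 -> 1 <= normc (w + w + v).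
  move=> w1 v1; have := le_normcD (w + w + v) (- v); rewrite addrK normcN v1.
  by rewrite -mulr2n -mulr_natl normcM w1 mulr1 -(rmorph_nat (@real_complex_def _ (Phant R))) normc_real normr_nat; lra.
have n1 : normc (1 : R[i]) = 1 := normc1 R.
case/orP: ab => [/orP[]|] /eqP ->.
- by rewrite expr0; apply: low; rewrite ?normc_zeta.
- by rewrite expr0 addrAC; apply: low; rewrite ?normc_zeta.
- by rewrite -addrA addrC; apply: low; rewrite ?normc_zeta.
Qed.

Let border (a b : nat) : bool := (a == 0%N) || (b == 0%N) || (a == b).

(** The 6 on the left is 2 for ordered pairs times 3 for the cube. The rows also contain the border
    pairs, at most 3[N] with multiplicity, each contributing at most ln 3 <= 2. *)
Lemma sum_rows_approx : `|\sum_(a < N) log_row a - 6 * ln (tilings n)%:R| <= 6 * N%:R.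
Proof.
pose F (p : nat * nat) : R := if border p.1 p.2 || central p.1 p.2 then 0 else ln (pair_norm p.1 p.2).
have sumF : \sum_(a < N) \sum_(b < N) F (a : nat, b : nat) = 6 * ln (tilings n)%:R.
  rewrite sum_square_generic_pairs.
  - rewrite (_ : 6 = 3 * 2); last by ring.
    rewrite -mulrA [2 * _]mulrC mulrA ln_tilings_pairs -[LHS]mulr_natr; congr (_ * _); apply: eq_big_seq => p.
    rewrite mem_generic_pairs /F /generic_pair /border /central; case: p => a b /=.
    rewrite !xpair_eqE => gp; rewrite ifN //; lia.
  - by move=> a b; rewrite /F /= pair_normC centralC /border [(a == b)%N]eq_sym [(a == 0%N) || _]orbC.
  - by [].
  - by move=> a; rewrite /F /border /= eqxx !orbT.
  - by rewrite /F /central /= eqxx !orbT.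
have step (a : 'I_N) : `|log_row a - \sum_(b < N) F (a : nat, b : nat)| <=
    \sum_(b < N) ((a == 0%N :> nat)%:R + (b == 0%N :> nat)%:R + (a == b)%:R) * ln 3.
  rewrite /log_row [\sum_(b < N | _) _]big_mkcond /= -sumrB; apply: le_trans (ler_norm_sum _ _ _) _.
  apply: ler_sum => b _; rewrite /F /=.
  have l3 : 0 <= ln 3 :> R by rewrite ln_ge0 //; lra.
  have rhs : 0 <= ((a == 0%N :> nat)%:R + (b == 0%N :> nat)%:R + (a == b)%:R) * ln 3 :> R.
    by rewrite mulr_ge0 // !addr_ge0.
  case: (boolP (central a b)) => [_|_] /=; first by rewrite orbT subrr normr0.
  rewrite orbF; case: ifP => [bd|_]; last by rewrite subrr normr0.
  have /ln_bound/andP[t0 t3] := pair_norm_bounds bd.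
  rewrite subr0 ger0_norm //; apply: le_trans t3 _; rewrite ler_peMl //.
  rewrite -!natrD ler1n; move: bd; rewrite /border -[(a : nat) == b]/(a == b).
  by case: (_ == 0%N); case: (_ == 0%N); case: (_ == _).
rewrite -sumF -sumrB; apply: le_trans (ler_norm_sum _ _ _) _.
apply: le_trans (ler_sum _ (fun a _ => step a)) _.
have one (i : 'I_N) : \sum_(b < N) (i == b)%:R = 1 :> R.
  by rewrite (bigD1 i) //= eqxx big1 ?addr0 // => b; rewrite eq_sym => /negPf ->.
have N0 : (0 < N)%N by rewrite addn3.
have zero : \sum_(b < N) (b == 0%N :> nat)%:R = 1 :> R.
  by rewrite -[RHS](one (Ordinal N0)); apply: eq_bigr => b _; rewrite eq_sym.
under eq_bigr do rewrite -mulr_suml.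
rewrite -mulr_suml.
have -> : \sum_(a < N) \sum_(b < N) ((a == 0%N :> nat)%:R + (b == 0%N :> nat)%:R + (a == b)%:R) = 3 * N%:R :> R.
  transitivity (\sum_(a < N) ((a == 0%N :> nat)%:R *+ N + 2) : R).
    apply: eq_bigr => a _; rewrite !big_split /= zero one sumr_const card_ord.
    by rewrite -addrA.
  by rewrite big_split /= sumr_const card_ord sumrMnl zero -[2 *+ _]mulr_natr; ring.
have l3 : ln 3 <= 2 :> R.
  rewrite -[leRHS]expRK ler_ln ?posrE ?expR_gt0 //.
  by have := @expR_ge1Dx R 2; lra.
have N0' : 0 <= N%:R :> R by [].
move: (ln 3) l3 N0' => l l2; move: N%:R => k k0.
have := ler_wpM2l k0 l2; lra.
Qed.

Lemma row_approx (a : nat) : (a < N)%N ->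
  `|log_row a - N%:R * log_plus R n a| <= 1 + ((a == n + 1)%N + (a == 2 * n + 2)%N)%:R * N%:R.
Proof.
move=> aN.
have lnN : 0 <= ln (N%:R : R) <= N%:R.
  have N0 : 0 < N%:R :> R by rewrite ltr0n addn3.
  rewrite ln_ge0 ?ler1n ?addn3 //= -addn3; apply: le_trans (_ : N%:R - 1 <= _); last by lra.
  by rewrite -[leRHS]expRK ler_ln ?posrE ?expR_gt0 //; have := @expR_ge1Dx R (N%:R - 1); lra.
have /andP[l0 lN] := lnN; have [a1|a1] := eqVneq a (n + 1)%N.
  have [|_ ->] := @row_center R n n_gt0 a (2 * n + 2)%N; first by rewrite /central a1 eqxx.
  rewrite log_plus_eq0 ?mulr0 ?subr0 ?ger0_norm; [|lra|lia].
  by rewrite a1 (_ : (_ == (2 * n + 2)%N) = false) ?mul1r; [lra|lia].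
have [a2|a2] := eqVneq a (2 * n + 2)%N.
  have [|_ ->] := @row_center R n n_gt0 a (n + 1)%N; first by rewrite /central a2 eqxx orbT.
  rewrite log_plus_eq0 ?mulr0 ?subr0 ?ger0_norm; [|lra|lia].
  by rewrite mul1r; lra.
rewrite mul0r addr0; apply: le_trans (ln2_le1 R).
by have [] := row_regular R n_gt0 aN a1 a2.
Qed.

(** The errors on six times the logarithm add up to 12[N]: 6[N] from the border, 3[N] from the rows
    (with [N] for each of the two central ones) and 3[N] from the Riemann sum. *)
Lemma ln_tilings_approx :
  `|ln (tilings n)%:R - growth R * n.+1%:R ^+ 2| <= 2 * N%:R.
Proof.
have N0 : 0 < N%:R :> R by rewrite ltr0n addn3.
have h1 := sum_rows_approx.
have h2 : `|\sum_(a < N) log_row a - N%:R * \sum_(a < N) log_plus R n a| <= 3 * N%:R.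
  rewrite mulr_sumr -sumrB; apply: le_trans (ler_norm_sum _ _ _) _.
  apply: le_trans (ler_sum _ (fun a _ => row_approx (ltn_ord a))) _.
  rewrite big_split /= sumr_const card_ord -mulr_suml -natr_sum big_split /=.
  have one (k : nat) : (k < N)%N -> (\sum_(a < N) (a == k :> nat) = 1)%N.
    move=> kN; rewrite (bigD1 (Ordinal kN)) //= eqxx big1 // => b.
    by rewrite -val_eqE /= => /negPf ->.
  rewrite !one; [|lia|lia]; rewrite -[1 *+ N]/(N%:R); lra.
have h3 := sum_log_plus_approx R n.
have h4 := ler_wpM2l (ltW N0) h3.
rewrite -[X in X * `|_|]ger0_norm ?(ltW N0) // -normrM mulrBr in h4.
have E : N%:R * (2 * (3 * Num.sqrt 3 / 4 * L2_chi_m3 R / angle R n)) = 6 * (growth R * n.+1%:R ^+ 2).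
  have pi0 : pi != 0 :> R by rewrite gt_eqF ?pi_gt0.
  rewrite angleE /growth (_ : (3 * n + 3 = 3 * n.+1)%N) ?natrM; last by rewrite mulnSr.
  have n0 : n.+1%:R != 0 :> R by rewrite pnatr_eq0.
  move: (pi : R) n.+1%:R (Num.sqrt _) (L2_chi_m3 R) pi0 n0; clear=> p x s l p0 x0.
  by field; rewrite p0 x0.
rewrite E in h4; move: h1 h2 h4 N0; clear.
move: (ln _) (\sum_(a < N) log_row a) (N%:R * \sum_(a < N) log_plus R n a) (growth R * _) (N%:R : R).
move=> x y w g k.
rewrite !ler_norml => /andP[? ?] /andP[? ?] /andP[? ?] ?.
by apply/andP; split; lra.
Qed.

(** For positive n the previous error is at most 12n, and passing from (n + 1)^2 to n^2 costs at
    most 3n/2. *)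
Lemma ln_tilings_linear : `|ln (tilings n)%:R - growth R * n%:R ^+ 2| <= 14 * n%:R.
Proof.
have := ln_tilings_approx; have /andP[g1 g2] := growth_bounds R.
have n1 : 1 <= n%:R :> R by rewrite ler1n.
have g0 : 0 <= growth R by lra.
have g3 : growth R <= 2^-1 by apply: le_trans g2 _; rewrite mulrA ler_pdivrMr; lra.
rewrite natrD natrM -natr1; move: (growth R) g0 g3 (n%:R : R) n1 (ln _); clear.
move=> g g0 g1 x x1 y; rewrite !ler_norml => /andP[h1 h2].
have h3 : 0 <= g * x by rewrite mulr_ge0 //; lra.
have h4 : 0 <= (2^-1 - g) * x by rewrite mulr_ge0 //; lra.
by apply/andP; split; lra.
Qed.

End LogTilings.

(** * Tiling numbers *)

Section PrimeFactors.
Local Open Scope nat_scope.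

Lemma num_prime_factors_sum (m B : nat) : m < B ->
  num_prime_factors m = \sum_(0 <= p < B) logn p m.
Proof.
move=> mB; rewrite /num_prime_factors.
have sub : {subset primes m <= index_iota 0 B}.
  move=> p; rewrite mem_index_iota mem_primes => /and3P[_ m0 pm].
  exact: leq_ltn_trans (dvdn_leq m0 pm) mB.
rewrite [RHS](bigID [in primes m]) /= [X in _ + X]big1 ?addn0 => [|p pm]; last first.
  by apply/eqP; rewrite -leqn0 leqNgt logn_gt0.
rewrite -[RHS]big_filter; apply: perm_big; apply: uniq_perm; rewrite ?filter_uniq ?iota_uniq ?primes_uniq //.
by move=> p; rewrite mem_filter; case: (boolP (p \in primes m)) => // /sub ->.
Qed.

Lemma num_prime_factorsM (m k : nat) : 0 < m -> 0 < k ->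
  num_prime_factors (m * k) = num_prime_factors m + num_prime_factors k.
Proof.
move=> m0 k0; rewrite !(@num_prime_factors_sum _ (m * k).+1) ?ltnS ?leq_pmulr ?leq_pmull //.
by rewrite -big_split /=; apply: eq_bigr => p _; rewrite lognM.
Qed.

Lemma num_prime_factors_gt0 (m : nat) : 1 < m -> 0 < num_prime_factors m.
Proof.
move=> m1; have pm : pdiv m \in primes m by rewrite mem_primes pdiv_prime // pdiv_dvd ltnW.
by rewrite /num_prime_factors (big_rem _ pm) /= ltn_addr // logn_gt0.
Qed.

(** A factor greater than 1 is at most [B] and brings at least one prime; factors equal to 1 cost
    nothing. *)
Lemma prod_leq_num_prime_factors (I : eqType) (s : seq I) (v : I -> nat) (B : nat) :
  0 < B -> (forall i, i \in s -> 0 < v i <= B) ->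
  \prod_(i <- s) v i <= B ^ num_prime_factors (\prod_(i <- s) v i).
Proof.
move=> B0; elim: s => [|i s IH] vB; first by rewrite big_nil expn_gt0 B0.
have vBs j : j \in s -> 0 < v j <= B by move=> js; apply: vB; rewrite inE js orbT.
have /andP[vi0 viB] : 0 < v i <= B by apply: vB; rewrite inE eqxx.
have p0 : 0 < \prod_(j <- s) v j.
  by rewrite big_seq; apply: prodn_cond_gt0 => j /vBs/andP[].
rewrite big_cons num_prime_factorsM // expnD leq_mul ?IH //.
have [le1|lt1] := leqP (v i) 1; first by apply: leq_trans le1 _; rewrite expn_gt0 B0.
apply: leq_trans viB _; rewrite -[leqLHS]expn1.
by rewrite leq_pexp2l // num_prime_factors_gt0.
Qed.

End PrimeFactors.

Section Tilings.
Variable R : realType.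

Local Notation intrp := (map_poly (intr : int -> R[i])).

Lemma P_generic_pairs (n : nat) :
  P R n = \prod_(p <- generic_pairs n) ('X + (zeta n ^+ p.1 + zeta n ^+ p.2)%:P).
Proof. by rewrite -big_generic_pairs_seq /P -addnS. Qed.

Lemma norm_P1 (n : nat) : (0 < n)%N -> `|(P R n).[1]| = (tilings n)%:R ^+ 3.
Proof.
move=> n0; rewrite P_generic_pairs horner_prod normr_prod (tilings_cube_freq (zeta_prim R n)).
by apply: eq_bigr => p _; rewrite hornerD hornerX hornerC addrA.
Qed.

Lemma P_factors (n : nat) : exists s : seq {poly int},
  P R n = intrp (\prod_(q <- s) q) /\
  forall q, q \in s -> ((size q).-1 <= 2 * n + 2)%N /\ (`|q.[1]| <= 3 ^ (2 * n + 2))%N.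
Proof.
have [s [sE sq]] := generic_factors (zeta_prim R n).
exists s; split; first by rewrite P_generic_pairs sE.
move=> q /sq[-> q1]; split=> //; move: q1; rewrite -[X in _.[X]](rmorph1 intr) horner_map /=.
by rewrite -intr_norm -natr_absz -[3 in X in X -> _]/(3%:R) -natrX ler_nat.
Qed.

Lemma P_int (n : nat) : (0 < n)%N ->
  (exists Q : {poly int},
    P R n = map_poly (intr : int -> R[i]) Q /\
    exists s : seq {poly int},
      Q = \prod_(q <- s) q /\
      (forall q, q \in s -> ((size q).-1 <= 2 * n + 2)%N)) /\
  ((P R n).[1] = (tilings n)%:R ^+ 3 \/
   (P R n).[1] = - (tilings n)%:R ^+ 3).
Proof.
move=> n0; have [s [sE sq]] := P_factors n; split.
  by exists (\prod_(q <- s) q); split=> //; exists s; split=> // q qs; have [] := sq q qs.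
have := norm_P1 n0.
rewrite sE -[X in _.[X]](rmorph1 intr) horner_map /=; move: (\prod_(q <- s) q).[1] => x.
rewrite -intr_norm => <-; case: (ger0P x) => _; [by left | right].
by rewrite rmorphN opprK.
Qed.

Lemma tilings_dvd (m n : nat) : (0 < m)%N -> (0 < n)%N ->
  (m.+1 %| n.+1)%N -> (tilings m %| tilings n)%N.
Proof.
move=> m0 n0 /dvdnP[d E].
have [r rE] := subgroup_factor (zeta_prim R n) E.
rewrite -(@dvdn_pexp2r _ _ 3) //; apply/dvdnP; exists `|r|%N.
apply/eqP; rewrite -(eqr_nat R[i]) natrM !natrX.
rewrite (tilings_cube_freq (zeta_prim R n)) (tilings_cube_freq (zeta_prim R m)).
by rewrite -!normr_prod rE normrM (zeta_sub R E) -intr_norm natr_absz.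
Qed.

Lemma tilings_growth : exists e : nat -> R,
  e =o_\oo (fun n : nat => n%:R ^+ 2 : R) /\
  (forall n : nat, (0 < n)%N -> (tilings n)%:R = expR (growth R * n%:R ^+ 2 + e n)).
Proof.
exists (fun n => ln (tilings n)%:R - growth R * n%:R ^+ 2); split; last first.
  by move=> n n0; rewrite addrC subrK lnK // posrE ltr0n tilings_gt0.
apply/eqoP => eps eps0; near=> n.
have n0 : (0 < n)%N by near: n; exists 1%N.
apply: le_trans (ln_tilings_linear R n0) _.
rewrite (ger0_norm (sqr_ge0 _)) expr2 mulrA ler_wpM2r // -ler_pdivrMl //.
near: n; exact: nbhs_infty_ger.
Unshelve. all: by end_near. Qed.

Lemma ln3_lt : ln 3 <= 28 / 25 :> R.
Proof.
rewrite -[leRHS]expRK ler_ln ?posrE ?expR_gt0 //.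
have := @expR_ge4 R (28 / 25); move=> /(_ ltac:(lra)); lra.
Qed.

Lemma tilings_num_prime_factors : exists N : nat, forall n : nat, (N <= n)%N ->
  (n%:R / 5%:R : R) <= (num_prime_factors (tilings n))%:R.
Proof.
(* With [growth] >= 204/421, error 14n and ln 3 <= 28/25, the claim reduces to about 0.0366 n >=
   14.45, true from 396 on. *)
exists 500%N => n nN; have n0 : (0 < n)%N by apply: leq_trans nN.
have T0 := tilings_gt0 n.
have nN' : 100 * 5 <= n%:R :> R by rewrite -natrM ler_nat.
have [s [sE sq]] := P_factors n.
have E : ((tilings n) ^ 3 = \prod_(q <- s) `|q.[1]|)%N.
  apply/eqP; rewrite -(eqr_nat R[i]) natrX natr_prod -norm_P1 // sE.
  rewrite -[X in _.[X]](rmorph1 intr) horner_map /= horner_prod rmorph_prod normr_prod.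
  by apply/eqP; apply: eq_bigr => q _; rewrite natr_absz intr_norm.
have bound : (tilings n <= (3 ^ (2 * n + 2)) ^ num_prime_factors (tilings n))%N.
  rewrite -(@leq_exp2r _ _ 3) // -expnM E.
  apply: leq_trans (@prod_leq_num_prime_factors _ s _ (3 ^ (2 * n + 2)) _ _) _.
  - by rewrite expn_gt0.
  - move=> q qs; have [_ ->] := sq q qs; rewrite andbT lt0n; apply/negP => /eqP q0.
    by move: (expn_gt0 (tilings n) 3); rewrite T0 E (big_rem _ qs) /= q0.
  (* The cube has three times as many prime factors, which cancels the exponent 3 on the left. *)
  - rewrite leq_pexp2l ?expn_gt0 // -E !expnS expn0 muln1 !num_prime_factorsM ?muln_gt0 ?T0 //.
    by clear; lia.
move: bound; rewrite -(ler_nat R) !natrX -exprM => h.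
have {}h : ln (tilings n)%:R <= ((2 * n + 2) * num_prime_factors (tilings n))%:R * ln (3 : R).
  rewrite mulr_natl -lnXn // ler_ln ?posrE ?ltr0n ?exprn_gt0 //.
have /andP[g1 _] := growth_bounds R.
have l3 := ln3_lt; have := ln_tilings_linear R n0.
rewrite ler_norml => /andP[lo _].
move: h lo; rewrite natrM natrD natrM; move: (num_prime_factors _)%:R (ler0n R (num_prime_factors (tilings n))) => k k0.
move: k0 (n%:R : R) nN' (ln 3) l3 (growth R) g1 (ln _); clear=> k0 x x0 l l1 g g1 y h lo.
have h1 : (2 * x + 2) * k * l <= (2 * x + 2) * k * (28 / 25).
  by rewrite ler_wpM2l // mulr_ge0 //; lra.
have h2 : 4 * (51 / 421) * x ^+ 2 <= g * x ^+ 2 by rewrite ler_wpM2r ?sqr_ge0.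
have h3 : (2 * x + 2) * (28 / 25) * (x / 5) <= (2 * x + 2) * (28 / 25) * k.
  have : 0 <= x * (x - 100 * 5) by rewrite mulr_ge0 //; lra.
  lra.
by rewrite -(ler_pM2l (x := (2 * x + 2) * (28 / 25))) //; lra.
Qed.

End Tilings.

Theorem theorem1p2 (R : realType) :
  (* (a) *)
  (forall n : nat, (0 < n)%N ->
     (exists Q : {poly int},
        P R n = map_poly (intr : int -> R[i]) Q /\
        exists s : seq {poly int},
          Q = \prod_(q <- s) q /\
          (forall q, q \in s -> ((size q).-1 <= 2 * n + 2)%N)) /\
     ((P R n).[1] = (tilings n)%:R ^+ 3 \/
      (P R n).[1] = - (tilings n)%:R ^+ 3)) /\
  (* (b) *)
  (forall m n : nat, (0 < m)%N -> (0 < n)%N ->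
     (m.+1 %| n.+1)%N -> (tilings m %| tilings n)%N) /\
  (* (c) *)
  ((exists e : nat -> R,
      e =o_\oo (fun n : nat => n%:R ^+ 2 : R) /\
      (forall n : nat, (0 < n)%N ->
         (tilings n)%:R = expR (growth R * n%:R ^+ 2 + e n))) /\
   `|expR (growth R) - 16235%:R / 10%:R ^+ 4| < (2 * 10%:R ^+ 4)^-1) /\
  (* (d) *)
  (exists N : nat, forall n : nat, (N <= n)%N ->
     (n%:R / 5%:R : R) <= (num_prime_factors (tilings n))%:R).
Proof.
split; first by move=> n; apply: P_int.
split; first exact: tilings_dvd.
split; first by split; [exact: tilings_growth | exact: exp_growth].
exact: tilings_num_prime_factors.
Qed.
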